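(* Let $\alpha>\frac32$ and let $E\subset\mathbb R$ be an $h_\alpha$-$(\gamma,L)$ thick set for some constants $\gamma,L>0$. Then for each $T>0$ there is $C_{obs}>0$, depending only on $T,\alpha,E,\gamma$ and $L$, such that any solution $u$ of the heat equation $\partial_tu=\partial_x^2u$ ($t>0$, $x\in\mathbb R$), $u(0,\cdot)\in L^2(\mathbb R)$, satisfies $$\|u(T,\cdot)\|_{L^2(\mathbb R)}\le C_{obs}\int_0^T\Big\|\big\{\sup_{x\in E\cap[k,k+L]}|u(t,x)|\big\}_{k\in\mathbb Z}\Big\|_{l^2(\mathbb Z)}\,dt .$$
   Context: A gauge function is a strictly increasing continuous $f:(0,\infty)\to[0,\infty)$ with $\lim_{t\to0^+}f(t)=0$. For a gauge function $f$, the $f$-Hausdorff content of $E\subset\mathbb R$ is $c_f(E)=\inf\{\sum_{j\ge1} f(d(B_j)):E\subset\bigcup_{j\ge1} B_j\}$, where the $B_j$ are open balls (intervals) in $\mathbb R$ with diameter $d(B_j)$. $h_\alpha(t)=(\log\frac1t)^{-1/2}(\log\log\frac1t)^{-\alpha}$ for $0<t\le e^{-3}$, understood as a gauge function on $(0,\infty)$ via a fixed extension with $h_\alpha(t)\sim1$ as $t\to+\infty$. A subset $E\subset\mathbb R$ is $f$-$(\gamma,L)$ thick (with $\gamma,L>0$) if $\inf_{x\in\mathbb R}c_f(E\cap[x,x+L])\ge\gamma L$. *)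

(* Defs.v *)
From HB Require Import structures.
From mathcomp Require Import all_boot all_order all_algebra.
From mathcomp Require Import all_classical all_reals all_analysis.
From mathcomp Require Import complex.
Set Implicit Arguments.
Unset Strict Implicit.
Unset Printing Implicit Defensive.
Import Order.TTheory GRing.Theory Num.Theory.
Import numFieldNormedType.Exports.

Local Open Scope classical_set_scope.
Local Open Scope ring_scope.

(* A function on (0, +oo) is represented by a total function on R of which
   only the values at positive arguments matter. *)
Definition gauge_function (R : realType) (f : R -> R) : Prop :=
  [/\ forall t : R, 0 < t -> 0 <= f t,
      forall (s t : R), 0 < s -> s < t -> f s < f t,
      forall t : R, 0 < t -> {for t, continuous f}
    & f t @[t --> 0^'+] --> (0 : R)].

(* The open balls of R are the intervals ball (c j) (r j), of diameter
   2 * r j. Finite covers may be completed by arbitrarily small balls, since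
   f tends to 0 at 0, so infinite sequences of balls suffice. *)
Definition hausdorff_content (R : realType) (f : R -> R) (E : set R) : \bar R :=
  ereal_inf [set s : \bar R | exists c r : nat -> R,
    [/\ forall j, 0 < r j,
        E `<=` \bigcup_j ball (c j) (r j)
      & s = (\sum_(0 <= j <oo) (f (2 * r j))%:E)%E]].

Definition thick (R : realType) (f : R -> R) (gamma L : R) (E : set R) : Prop :=
  ((gamma * L)%:E <=
     ereal_inf [set hausdorff_content f (E `&` `[x, (x + L)%R]) | x in [set: R]])%E.

(* h is one of the admissible extensions of h_alpha to (0, +oo); h ~ 1 at
   infinity is read as two-sided comparability. *)
Definition h_gauge (R : realType) (alpha : R) (h : R -> R) : Prop :=
  [/\ gauge_function h,
      forall t : R, 0 < t -> t <= expR (- 3) ->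
        h t = ln (t^-1) `^ (- 2^-1) * ln (ln (t^-1)) `^ (- alpha)
    & exists c C : R, 0 < c /\ \forall t \near +oo, c <= h t <= C].

Definition L2norm (R : realType) (f : R -> R[i]) : \bar R :=
  Lnorm (@lebesgue_measure R) 2%:E (fun x => (Normc.normc (f x))%:E).

Definition in_L2 (R : realType) (f : R -> R[i]) : Prop :=
  [/\ measurable_fun [set: R] (fun x => complex.Re (f x)),
      measurable_fun [set: R] (fun x => complex.Im (f x))
    & (L2norm f < +oo)%E].

Definition l2norm (R : realType) (a : int -> \bar R) : \bar R :=
  ((\esum_(k in [set: int]) (`|a k| `^ 2)) `^ 2^-1)%E.

(* v t x is of class C^{1,2} on (0, +oo) x R and satisfies the heat equation
   there pointwise. *)
Definition classical_heat (R : realType) (v : R -> R -> R) : Prop :=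
  [/\ forall (t x : R), 0 < t ->
        [/\ derivable (fun s => v s x) t 1,
            derivable (v t) x 1 & derivable (derive1 (v t)) x 1],
      forall p : R * R, 0 < p.1 ->
        [/\ {for p, continuous (fun q : R * R => v q.1 q.2)},
            {for p, continuous (fun q : R * R => derive1 (fun s => v s q.2) q.1)},
            {for p, continuous (fun q : R * R => derive1 (v q.1) q.2)}
          & {for p, continuous (fun q : R * R => derive1n 2 (v q.1) q.2)}]
    & forall (t x : R), 0 < t -> derive1 (fun s => v s x) t = derive1n 2 (v t) x].

(* Solutions with datum u 0 in L^2 are taken in C([0, +oo); L^2(R)), the class
   in which the Cauchy problem is well posed; without a condition of this kind
   uniqueness fails (Tychonoff). Parabolic smoothing makes the pointwise
   equation for t > 0 no restriction. A complex-valued function solves the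
   equation iff its real and imaginary parts do. *)
Definition heat_solution (R : realType) (u : R -> R -> R[i]) : Prop :=
  [/\ classical_heat (fun t x => complex.Re (u t x)),
      classical_heat (fun t x => complex.Im (u t x)),
      forall t : R, 0 <= t -> in_L2 (u t)
    & forall s : R, 0 <= s ->
        L2norm (fun x => u t x - u s x) @[t --> within `[0, +oo[ (nbhs s)]
          --> (0 : \bar R)%E].

(* For a thick set E every E `&` [k, k + L] is nonempty (its content is
   positive), so the supremum is never -oo. *)
Definition local_sup (R : realType) (E : set R) (L : R) (f : R -> R[i])
    (k : int) : \bar R :=
  ereal_sup [set (Normc.normc (f x))%:E | x in E `&` `[k%:~R, k%:~R + L]].

(* Main.v *)
Require Import Defs.
From mathcomp Require Import all_boot all_order all_algebra.
From mathcomp Require Import all_classical all_reals all_analysis.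
From mathcomp Require Import measurable_realfun complex ring lra zify.
Import Order.TTheory GRing.Theory Num.Theory.
Import numFieldNormedType.Exports.
Local Open Scope classical_set_scope.
Local Open Scope ring_scope.
Set Implicit Arguments.
Unset Strict Implicit.
Unset Printing Implicit Defensive.

(* Real and imaginary parts are treated separately, and a solution v is first
   written as v (t + s) = heat s * v t, by pairing it with a cut-off backward
   kernel.

   Spectral step. Cartan's covering lemma shows that a set of positive
   h_alpha-content in a bounded interval is not covered by the points close to
   many of n = 4^p given points; almost maximizing the Vandermonde product
   (Fekete) then yields n points of E in [k, k + L] whose Lagrange polynomials
   are bounded by exp(C n^2 / p^2). Interpolating the Gaussian kernel itself,
   whose n-th derivative is of size (n / s)^(n/2), gives
     v t = (Lagrange interpolant of v t) + O(e^{-2n}) |v (t - s)|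
   in L^2 as soon as s is of order 1/n. The error is absorbed in v t unless
   |v (t - s)| > e^{c n^2 s} |v t|, and by symmetry of the semigroup this
   propagates to every larger s (log-convexity). Hence, for every tau >> 1/n,
     |v t| <= e^{- c n^2 tau} |v (t - tau)|  or
     |v t| <= e^{C n^2 / p^2} |sup over E of v t|_{l^2}.

   Telescoping step. Since 1/p^2 is summable, one can choose times
   t_p = T/2 + (T/2) J/p, with t_p - t_{p+1} of order J/p^2, so that for J large
   dissipation on [t_{p+1}, t_p] beats the cost at level p + 1; the resulting
   inequalities telescope. *)

(** * Cartan's covering lemma and Hausdorff content *)

(** The difficulty is that the problem is critical. Because of the power 1/2 in the gauge, radii
    with [h (4 * r i)] of order i / n have, up to the double logarithm, log (1 / r i) of order (n /
    i)^2. The sum over i is of order n^2, which is the size of the dissipation exponent n^2 tau; for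
    a set of positive Lebesgue measure it would be of order n. Only the double logarithm separates
    the two: with n = 4^p it is of order p, its square gives the gain 1 / p^2, and time steps of
    that same order still add up to a finite time. No frequency is cut off. The interpolation takes
    place in physical space, and being of low frequency is replaced by slow growth of |v| backward
    in time. Symmetry of the semigroup gives convexity at midpoints, so this growth is carried along
    dyadic fractions of a time step. The set E is arbitrary, and measurability in time of the
    observed quantity is never established: its integral is bounded from below by explicit step
    functions. *)

Section Cartan.
Variable R : realType.
Implicit Types (r : nat -> R) (s : seq R) (x y : R).

Definition count_near x (e : R) s := count (fun y => `|x - y| < e) s.

(** Greedy choice: take the largest i for which some ball of radius [r i] holds at least i points,
    discard the points in that ball and repeat. A ball of index i uses up at least i points, which
    bounds the sum of the indices. *)
Lemma cartan_cover r s (r_gt0 : forall i, 0 < r i)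
    (r_mono : forall i j, (i <= j)%N -> r i <= r j) :
  exists l : seq (R * nat), [/\ (\sum_(q <- l) q.2 <= size s)%N,
    all (fun q => 0 < q.2)%N l &
    forall x i, (0 < i)%N -> (i <= count_near x (r i) s)%N ->
      exists2 q, q \in l & `|x - q.1| < 2 * r q.2].
Proof.
have [n] := ubnP (size s); elim: n s => // n IH s; rewrite ltnS => sn.
pose P i := `[< exists x, (0 < i)%N /\ (i <= count_near x (r i) s)%N >].
have [exP|noP] := pselect (exists i, P i); last first.
  exists [::]; split => //; first by rewrite big_nil.
  move=> x i i0 xi; exfalso; apply: noP; exists i.
  by apply/asboolP; exists x.
have bP i : P i -> (i <= size s)%N.
  by move=> /asboolP[x [_ /leq_trans]]; apply; exact: count_size.
have [i /asboolP[y [i0 yi]] imax] := ex_maxnP exP bP.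
pose s' := [seq z <- s | ~~ (`|y - z| < r i)].
have sz : (count_near y (r i) s + size s' = size s)%N.
  by rewrite size_filter count_predC.
have s'n : (size s' < n)%N.
  by apply: leq_trans sn; rewrite -sz -addn1 addnC leq_add2r (leq_trans i0).
have [l [l1 l2 l3]] := IH _ s'n.
exists ((y, i) :: l); split.
- by rewrite big_cons /= -sz leq_add.
- by rewrite /= i0.
move=> x j j0 xj.
have ji : (j <= i)%N by apply: imax; apply/asboolP; exists x.
have [xy|xy] := ltP `|x - y| (2 * r i).
  by exists (y, i) => //; rewrite mem_head.
(* Since j <= i, the ball of radius [r j] about a point at distance at least [2 * r i] from y
   contains no discarded point, so its count is the same in s'. *)
have [|q ql qx] := l3 x j j0.
  apply: (leq_trans xj); rewrite /count_near count_filter leq_eqVlt.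
  apply/orP; left; apply/eqP/eq_count => z /=.
  case: (ltP `|x - z| (r j)) => //= xz; apply/esym; rewrite -leNgt.
  have := ler_distD z x y; have := r_mono _ _ ji.
  rewrite (distrC z y); lra.
by exists q => //; rewrite inE ql orbT.
Qed.

(** If the points are sorted by distance to x, the i-th one is at distance at least [r i]. The
    induction removes one point at distance at least [r n] from a list of n, which exists because
    fewer than n of them are closer. *)
Lemma prod_dist_ge r s x (r_gt0 : forall i, 0 < r i) :
  (forall i, (0 < i)%N -> (count_near x (r i) s < i)%N) ->
  \prod_(1 <= i < (size s).+1) r i <= \prod_(y <- s) `|x - y|.
Proof.
move: {2}(size s) (erefl (size s)) => n.
elim: n s => [|n IH] s sn hs.
  by move: sn {hs}; case: s => // _; rewrite big_geq// big_nil.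
have /hasP[y ys yx] : has (predC (fun y => `|x - y| < r n.+1)) s.
  rewrite has_predC; apply/negP; rewrite all_count => /eqP E.
  by have := hs n.+1 isT; rewrite /count_near E sn ltnn.
have ps := perm_to_rem ys.
rewrite (perm_big _ ps) big_cons sn big_nat_recr//= mulrC.
have szr : size (rem y s) = n by rewrite size_rem// sn.
rewrite /= -leNgt in yx.
apply: ler_pM => //.
- exact/ltW.
- by apply: prodr_ge0 => i _; exact/ltW.
- have := IH _ szr; rewrite szr; apply => i i0.
  apply: leq_ltn_trans (hs i i0).
  by rewrite /count_near (permP ps) leq_addl.
Qed.

End Cartan.

Section Content.
Variable R : realType.
Implicit Types (f : R -> R) (A : set R).

(** The content is defined by infinite sequences of balls of positive radius; a finite cover is
    completed by tiny balls whose total cost is at most e. *)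
Lemma content_le_cover f A (l : seq (R * R)) : gauge_function f ->
  all (fun q => 0 < q.2) l ->
  (forall x, A x -> exists2 q, q \in l & `|x - q.1| < q.2) ->
  (hausdorff_content f A <= (\sum_(q <- l) f (2 * q.2))%:E)%E.
Proof.
move=> [f_ge0 _ _ f0] l0 Al; apply/lee_addgt0Pr => e e0.
have rhoP (j : nat) : exists2 d : R, 0 < d & f (2 * d) <= e / (2 ^ j.+1)%:R.
  have ej : 0 < e / (2 ^ j.+1)%:R by rewrite divr_gt0// ltr0n expn_gt0.
  have /cvgrPdist_le/(_ _ ej) := f0.
  rewrite near_withinE => -[d /= d0 hd].
  exists (d / 4); first by lra.
  have d4 : 0 < 2 * (d / 4) by lra.
  have := hd (2 * (d / 4)); rewrite /= !sub0r !normrN (gtr0_norm d4) => hd'.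
  by apply: le_trans (ler_norm _) (hd' _ _) => //; lra.
pose rho j := projT1 (cid2 (rhoP j)).
have rho0 j : 0 < rho j by rewrite /rho; case: cid2.
have frho j : f (2 * rho j) <= e / (2 ^ j.+1)%:R by rewrite /rho; case: cid2.
pose c j := (nth (0, 0) l j).1.
pose r j := if (j < size l)%N then (nth (0, 0) l j).2 else rho j.
have r0 j : 0 < r j.
  rewrite /r; case: ltnP => // jl.
  by move/allP : l0; apply; exact: mem_nth.
pose a j : R := if (j < size l)%N then f (2 * (nth (0, 0) l j).2) else 0.
have a0 j : 0 <= a j.
  rewrite /a; case: ltnP => // jl; apply: f_ge0.
  by rewrite mulr_gt0//; move/allP : l0; apply; exact: mem_nth.
apply: ge_ereal_inf; exists (\sum_(0 <= j <oo) (f (2 * r j))%:E)%E.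
  exists c, r; split => // x /Al[q ql xq].
  exists (index q l) => //; rewrite /ball /= /c /r index_mem ql nth_index//.
  by rewrite distrC.
apply: le_trans (_ : _ <= \sum_(0 <= j <oo) ((a j)%:E + (e / (2 ^ j.+1)%:R)%:E))%E _.
  apply: lee_nneseries => j _.
    by move=> _; rewrite lee_fin f_ge0// mulr_gt0.
  rewrite -EFinD lee_fin /r /a; case: ltnP => jl; last by rewrite add0r.
  by rewrite lerDl divr_ge0 ?ltW.
apply: le_trans (epsilon_trick _ _ _) _; [by move=> j; rewrite lee_fin|exact: ltW|].
rewrite leeD2r// (nneseries_split 0 (size l)); last by move=> j _; rewrite lee_fin.
rewrite [X in (_ + X)%E]eseries0 ?adde0; last first.
  by move=> j lj _; rewrite /a ltnNge (leq_trans _ lj)// .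
rewrite add0n sumEFin lee_fin (big_nth (0, 0)).
rewrite !big_nat; apply: ler_sum => j /andP[_ jl].
by rewrite /a jl.
Qed.

(* Cartan's argument: the points close to many points of s have too small a
   content to cover A. *)
Lemma content_good_point f A (H c : R) (n : nat) (r : nat -> R) (s : seq R) :
  gauge_function f -> (H%:E <= hausdorff_content f A)%E ->
  (forall i, 0 < r i) -> (forall i j, (i <= j)%N -> r i <= r j) ->
  (forall i, (0 < i <= n)%N -> f (4 * r i) <= i%:R * c) ->
  0 <= c -> n%:R * c < H -> (size s <= n)%N ->
  exists2 x, A x & forall i, (0 < i)%N -> (count_near x (r i) s < i)%N.
Proof.
move=> gf HA r0 rm rc c0 ncH sn; apply: contrapT => noP.
have [l [l1 l2 l3]] := cartan_cover s r0 rm.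
(* The covering balls have radius [2 * r i], hence diameter [4 * r i]: this is the argument of f in
   the hypothesis. *)
pose l' := [seq (q.1, 2 * r q.2) | q <- l].
suff : (hausdorff_content f A <= (\sum_(q <- l') f (2 * q.2))%:E)%E.
  move=> /(le_trans HA); rewrite lee_fin; apply/negP; rewrite -ltNge.
  apply: le_lt_trans ncH; rewrite big_map /=.
  apply: (@le_trans _ _ (\sum_(q <- l) q.2%:R * c)).
    rewrite !big_seq; apply: ler_sum => q ql.
    rewrite mulrA (_ : 2 * 2 = 4); last by ring.
    apply: rc; have/allP/(_ _ ql) -> := l2; rewrite /=.
    apply: leq_trans sn; apply: leq_trans l1.
    by rewrite (big_rem q)//= leq_addr.
  by rewrite -mulr_suml -natr_sum ler_wpM2r// ler_nat (leq_trans l1).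
apply: content_le_cover => //.
  by apply/allP => _ /mapP[q _ ->] /=; rewrite mulr_gt0.
move=> x Ax; apply: contrapT => nox; apply: noP; exists x => // i i0.
rewrite ltnNge; apply/negP => /(l3 x i i0)[q ql xq]; apply: nox.
by exists (q.1, 2 * r q.2) => //; apply/mapP; exists q.
Qed.

End Content.

(** * Cartan radii adapted to the logarithmic gauge *)

Section Scale.
Variable R : realType.

Lemma ln2_ge_half : 2^-1 <= ln (2 : R).
Proof.
have h : -1 < - 2^-1 :> R by lra.
have := le_ln1Dx h; rewrite (_ : 1 - 2^-1 = 2^-1 :> R); last by field.
by rewrite lnV ?posrE//; lra.
Qed.

(** Lowering the base from 4 to 3 absorbs the polynomial factor p^2; this is what makes 3^p the
    reference scale for the gauge. From p = 8 on, the ratio of consecutive terms is favourable. *)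
Lemma sqr_mul3X_le p : (p ^ 2 * 3 ^ p <= 64 * 4 ^ p)%N.
Proof.
have small m : (m <= 8)%N -> (m ^ 2 * 3 ^ m <= 64 * 4 ^ m)%N.
  move=> m8; apply: leq_mul; last by case: m {m8} => // m; rewrite leq_exp2r.
  by rewrite -mulnn -[64%N]/(8 * 8)%N leq_mul.
have [/small//|/ltnW/subnK<-] := leqP p 8.
elim: (p - 8)%N => [|k IH]; first exact: small.
have : (3 * (k.+1 + 8) ^ 2 <= 4 * (k + 8) ^ 2)%N by rewrite -!mulnn; nia.
move: IH; rewrite !addSn.
rewrite (expnS 3) (expnS 4); set a := (3 ^ _)%N; set b := (4 ^ _)%N.
rewrite -!mulnn; nia.
Qed.

(** In the variable s = log (1 / t) the gauge is s^(-1/2) (log s)^(-alpha). As s >= 2^p, log s is at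
    least p / 2, and the second factor is at most 2 / p. *)
Lemma log_gauge_le alpha h (s : R) (p : nat) : 3 / 2 < alpha ->
  h_gauge alpha h -> (0 < p)%N -> 4 * 3 ^+ p <= s ->
  h (expR (- s)) <= 2 / (p%:R * Num.sqrt s).
Proof.
move=> a32 [_ hE _] p0 sp.
have p3 : 3 <= 3 ^+ p :> R.
  by rewrite -[leLHS]expr1 ler_weXn2l//; lra.
have s0 : 0 < s by lra.
rewrite hE ?expR_gt0 ?ler_expR//; last by lra.
rewrite -expRN opprK expRK.
have lns1 : 1 <= ln s.
  have : ln (2 ^+ 2 : R) <= ln s by rewrite ler_ln ?posrE//; lra.
  rewrite lnXn//; have := ln2_ge_half; lra.
have lnsp : p%:R / 2 <= ln s.
  have : ln (2 ^+ p : R) <= ln s.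
    rewrite ler_ln ?posrE ?exprn_gt0//.
    have : 2 ^+ p <= 3 ^+ p :> R by rewrite lerXn2r ?nnegrE//; lra.
    lra.
  rewrite lnXn// -[X in X <= _]mulr_natr => /(le_trans _); apply.
  rewrite mulrC ler_wpM2r ?ler0n//; exact: ln2_ge_half.
have sq0 : 0 < Num.sqrt s by rewrite sqrtr_gt0.
have pr : 0 < p%:R :> R by rewrite ltr0n.
rewrite (powRN s) (powR12_sqrt (ltW s0)).
apply: (@le_trans _ _ ((Num.sqrt s)^-1 * (ln s)^-1)).
  rewrite ler_wpM2l ?invr_ge0 ?(ltW sq0)//.
  rewrite -(@powR_inv1 _ (ln s)); last by lra.
  by apply: ler_powR => //; lra.
rewrite invfM mulrA mulrC ler_wpM2r ?invr_ge0 ?(ltW sq0)//.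
rewrite ler_pdivlMr// mulrC ler_pdivrMr; lra.
Qed.

End Scale.

Section CartanScale.
Variable R : realType.

Lemma sum_inv_sqr_le (n : nat) :
  \sum_(1 <= i < n.+1) (i%:R ^+ 2)^-1 <= 2 :> R.
Proof.
suff : \sum_(1 <= i < n.+1) (i%:R ^+ 2)^-1 <= 2 - 2 / n.+1%:R :> R.
  by move=> /le_trans; apply; rewrite gerBl divr_ge0.
elim: n => [|n IH]; first by rewrite big_geq// divr1 subrr.
rewrite big_nat_recr//=; apply: le_trans (lerD IH (lexx _)) _.
have n1 : 0 < n.+1%:R :> R by rewrite ltr0n.
rewrite -(natr1 n.+1).
set x : R := n.+1%:R in n1 *.
have x1 : 1 <= x by rewrite /x ler1n.
clearbody x; rewrite -subr_ge0.
have -> : 2 - 2 / (x + 1) - (2 - 2 / x + (x ^+ 2)^-1) =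
          (x - 1) / (x ^+ 2 * (x + 1)) by field; rewrite !gt_eqF//; lra.
by rewrite divr_ge0//; [lra|rewrite mulr_ge0 ?sqr_ge0//; lra].
Qed.

(** The radii are exp(- q_i^2) / 4 with q_i = K0 4^p / (i p): by the gauge estimate, [h (4 * r i)]
    is then at most 2 i / (K0 4^p). The exponents q_i^2 sum to O(16^p / p^2) because the series of 1
    / i^2 converges. *)
Lemma cartan_scale alpha h (c : R) : 3 / 2 < alpha -> h_gauge alpha h ->
  0 < c ->
  exists2 K : R, 0 < K & forall p, (0 < p)%N -> exists r : nat -> R,
    [/\ forall i, 0 < r i <= 1,
        forall i j, (i <= j)%N -> r i <= r j,
        forall i, (0 < i <= 4 ^ p)%N -> h (4 * r i) <= i%:R * (c / 4 ^+ p) &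
        expR (- (K * 16 ^+ p / p%:R ^+ 2)) <=
          \prod_(1 <= i < (4 ^ p).+1) r i].
Proof.
move=> a32 hh c0.
(* The term 16 yields q_i^2 >= 256 * 4^p / p^2 >= 4 * 3^p, as [log_gauge_le] requires; the term 2 /
   c yields 2 / K0 <= c. *)
pose K0 := 16 + 2 / c.
have ci0 : 0 < 2 / c by rewrite divr_gt0.
have K00 : 16 <= K0 by rewrite lerDl ltW.
exists (3 * K0 ^+ 2 + 2); first by rewrite addr_gt0// mulr_gt0// exprn_gt0//; lra.
move=> p p0.
(* The index is frozen from 2^p on, since otherwise q_i would fall below the range of
   [log_gauge_le]. The 4^p indices then add at most 4^p * 4^(-p) = 1 to the sum of 1 / i^2, whence
   the bound 3 below. The maximum with 1 takes care of i = 0. *)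
pose j i := maxn 1 (minn i (2 ^ p)).
have j0 i : (0 < j i)%N by rewrite leq_max.
have M0 : (0 < 2 ^ p)%N by rewrite expn_gt0.
have jM i : (j i <= 2 ^ p)%N by rewrite geq_max M0 geq_minr.
pose q i : R := K0 * 4 ^+ p / ((j i)%:R * p%:R).
have pr : 0 < p%:R :> R by rewrite ltr0n.
have jr i : 0 < (j i)%:R :> R by rewrite ltr0n.
have p4 : 0 < 4 ^+ p :> R by rewrite exprn_gt0.
have q0 i : 0 < q i.
  by rewrite divr_gt0 ?mulr_gt0//; lra.
have qmono i k : (i <= k)%N -> q k <= q i.
  move=> ik; rewrite ler_wpM2l//; first by rewrite mulr_ge0 ?(ltW p4)//; lra.
  rewrite lef_pV2 ?posrE ?mulr_gt0// ler_wpM2r ?(ltW pr)// ler_nat.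
  by rewrite /j; lia.
have q3 i : 4 * 3 ^+ p <= q i ^+ 2.
  have : 16 * 4 ^+ p / (2 ^+ p * p%:R) <= q i.
    rewrite /q ler_pM ?mulr_ge0 ?invr_ge0 ?mulr_ge0 ?exprn_ge0 ?(ltW pr)//.
      by rewrite ler_wpM2r ?(ltW p4).
    rewrite lef_pV2 ?posrE ?mulr_gt0 ?exprn_gt0//.
    by rewrite ler_wpM2r ?(ltW pr)// -natrX ler_nat.
  move=> qi; apply: (@le_trans _ _ ((16 * 4 ^+ p / (2 ^+ p * p%:R)) ^+ 2)); last first.
    have A0 : 0 <= 16 * 4 ^+ p / (2 ^+ p * p%:R) :> R.
      by rewrite divr_ge0 ?mulr_ge0 ?exprn_ge0 ?(ltW pr).
    by rewrite lerXn2r ?nnegrE ?(ltW (q0 i)).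
  have -> : (16 * 4 ^+ p / (2 ^+ p * p%:R)) ^+ 2 = 256 * 4 ^+ p / p%:R ^+ 2 :> R.
    have -> : 4 ^+ p = 2 ^+ p * 2 ^+ p :> R by rewrite -exprMn; congr (_ ^+ _); ring.
    by field; rewrite !gt_eqF// exprn_gt0.
  rewrite ler_pdivlMr ?exprn_gt0//.
  have := sqr_mul3X_le p; rewrite -(ler_nat R) !natrM !natrX.
  rewrite -expr2; lra.
exists (fun i => expR (- q i ^+ 2) / 4); split.
- move=> i; rewrite divr_gt0 ?expR_gt0//= ler_pdivrMr// mul1r.
  have : expR (- q i ^+ 2) <= 1 by rewrite -expR0 ler_expR oppr_le0 sqr_ge0.
  lra.
- move=> i k ik; rewrite ler_wpM2r// ler_expR lerN2.
  by rewrite lerXn2r ?nnegrE ?(ltW (q0 _))// qmono.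
- move=> i /andP[i0 ip]; rewrite mulrC divfK//.
  apply: le_trans (log_gauge_le a32 hh p0 (q3 i)) _.
  rewrite sqrtr_sqr gtr0_norm//.
  have -> : 2 / (p%:R * q i) = (j i)%:R * (2 / (K0 * 4 ^+ p)).
    by rewrite /q; field; rewrite !gt_eqF//; lra.
  rewrite ler_pM//.
  + by rewrite divr_ge0// mulr_ge0 ?(ltW p4)//; lra.
  + by rewrite ler_nat /j; lia.
  rewrite invfM mulrA ler_wpM2r ?invr_ge0 ?(ltW p4)//.
  rewrite ler_pdivrMr; last by lra.
  by rewrite -ler_pdivrMl// mulrC /K0; lra.
(* The factor 1/4 of each radius is at least exp(-2); the resulting total 2 * 4^p is below 2 * 16^p
   / p^2. *)
rewrite (@le_trans _ _ (\prod_(1 <= i < (4 ^ p).+1) expR (- (q i ^+ 2 + 2))))//.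
  rewrite -expR_sum ler_expR sumrN lerN2.
  rewrite big_split/= sumr_const_nat subn1/=.
  have E i : q i ^+ 2 = K0 ^+ 2 * 16 ^+ p / p%:R ^+ 2 * ((j i)%:R ^+ 2)^-1.
    rewrite /q (_ : 16 ^+ p = 4 ^+ p * 4 ^+ p :> R).
      by field; rewrite !gt_eqF.
    by rewrite -exprMn; congr (_ ^+ _); ring.
  under eq_bigr do rewrite E.
  rewrite -mulr_sumr.
  have S3 : \sum_(1 <= i < (4 ^ p).+1) ((j i)%:R ^+ 2)^-1 <= 3 :> R.
    apply: (@le_trans _ _ (\sum_(1 <= i < (4 ^ p).+1) ((i%:R ^+ 2)^-1 + (4 ^+ p)^-1))).
      rewrite !big_nat; apply: ler_sum => i /andP[i0 _].
      have [ip|ip] := leqP i (2 ^ p).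
        rewrite (_ : j i = i); last by rewrite /j; lia.
        by rewrite lerDl invr_ge0 ltW.
      rewrite (_ : j i = 2 ^ p)%N; last by rewrite /j; lia.
      rewrite natrX -exprM mulnC exprM (_ : 2 ^+ 2 = 4 :> R); last by ring.
      by rewrite lerDr invr_ge0 sqr_ge0.
    rewrite big_split/= sumr_const_nat subn1/= -[X in _ + X]mulr_natr natrX mulVf ?gt_eqF//.
    have := sum_inv_sqr_le (4 ^ p); lra.
  have F : 4 ^+ p <= 16 ^+ p / p%:R ^+ 2 :> R.
    rewrite (_ : 16 ^+ p = 4 ^+ p * 4 ^+ p :> R); last first.
      by rewrite -exprMn; congr (_ ^+ _); ring.
    rewrite -mulrA ler_peMr ?(ltW p4)// ler_pdivlMr ?exprn_gt0// mul1r.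
    rewrite -natrX -natrX ler_nat (_ : 4 ^ p = (2 ^ p) ^ 2)%N; last first.
      by rewrite -expnM mulnC expnM.
    by rewrite leq_sqr ltnW// ltn_expl.
  rewrite -(mulr_natr 2) natrX.
  have X0 : 0 <= 16 ^+ p / p%:R ^+ 2 :> R by lra.
  set X := 16 ^+ p / p%:R ^+ 2 in F X0 *.
  rewrite -(mulrA (K0 ^+ 2)) -(mulrA (3 * _ + 2)) -/X.
  have : K0 ^+ 2 * X * \sum_(1 <= i < (4 ^ p).+1) ((j i)%:R ^+ 2)^-1 <=
         K0 ^+ 2 * X * 3 by rewrite ler_wpM2l// mulr_ge0 ?sqr_ge0.
  set S := \sum_(_ <= _ < _) _ => H; lra.
apply: ler_prod => i _; rewrite expR_ge0/= opprD expRD ler_wpM2l ?expR_ge0//.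
rewrite expRN lef_pV2 ?posrE ?expR_gt0//.
have -> : (2 : R) = 1 + 1 by ring.
rewrite expRD; have := expR_ge1Dx (1 : R) => h1.
by apply: (@le_trans _ _ ((1 + 1) * (1 + 1))); [lra|rewrite ler_pM].
Qed.

End CartanScale.

(** * Fekete points and Lagrange interpolation *)

(** The cost c of [cartan_scale] is gamma L / 2, so that balls of total index at most 4^p have cost
    below the content gamma L of the window, and some point of E escapes them. *)
Lemma thick_far_point (R : realType) (alpha : R) h (gamma L : R) E :
  3 / 2 < alpha -> h_gauge alpha h -> 0 < gamma -> 0 < L ->
  thick h gamma L E ->
  exists2 K : R, 0 < K & forall p (x : R) (s : seq R), (0 < p)%N ->
    (size s <= 4 ^ p)%N -> exists2 y, (E `&` `[x, x + L]) y &
    expR (- (K * 16 ^+ p / p%:R ^+ 2)) <= \prod_(z <- s) `|y - z|.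
Proof.
move=> a32 hh g0 L0 thE.
have gL : 0 < gamma * L / 2 by rewrite divr_gt0// mulr_gt0.
have [K K0 HK] := cartan_scale a32 hh gL.
exists K => // p x s p0 sp.
have [r [r0 rm hr pr]] := HK p p0.
have [gh _ _] := hh.
have p4 : 0 < 4 ^+ p :> R by rewrite exprn_gt0.
have r0' i : 0 < r i by case/andP: (r0 i).
have [|||y yE yr] := @content_good_point _ h (E `&` `[x, x + L]) (gamma * L) _ _ r s
  gh _ r0' rm hr _ _ sp.
- apply: le_trans thE _; apply: ereal_inf_lbound; exists x => //.
- by rewrite divr_ge0 ?(ltW p4)// ltW.
- by rewrite natrX mulrC divfK ?gt_eqF//; lra.
exists y => //; apply: (le_trans pr); apply: le_trans (prod_dist_ge r0' yr).
(* The list may have fewer than 4^p points; radii are at most 1, so dropping the last ones only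
   increases the product. *)
rewrite (@big_cat_nat _ _ _ (size s).+1)//=.
rewrite ler_piMr//; first by apply: prodr_ge0 => i _; exact/ltW.
rewrite -[leRHS](@big1_eq R 1 *%R _ (index_iota (size s).+1 (4 ^ p).+1) xpredT).
by apply: ler_prod => i _; case/andP: (r0 i) => /ltW -> ->.
Qed.

Section Fekete.
Variable R : realType.

(** The absolute denominator of the i-th Lagrange polynomial. The product of these over i runs over
    ordered pairs, hence is the square of the Vandermonde determinant. *)
Definition vdm_node n (f : 'I_n -> R) i := \prod_(j | j != i) `|f i - f j|.
Definition vdm n (f : 'I_n -> R) := \prod_i vdm_node f i.

(** Isolates the dependence on [f i], in order to compare two configurations that differ at one
    node; the square appears because each pair is counted twice. *)
Lemma vdm_split n (f : 'I_n -> R) i : vdm f = vdm_node f i ^+ 2 *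
  \prod_(k | k != i) \prod_(j | (j != k) && (j != i)) `|f k - f j|.
Proof.
rewrite /vdm (bigD1 i)//= expr2 -mulrA; congr (_ * _).
rewrite [X in _ = X * _](_ : _ = \prod_(k | k != i) `|f k - f i|); last first.
  by rewrite /vdm_node; apply: eq_bigr => k _; rewrite distrC.
rewrite -big_split/=; apply: eq_bigr => k ki.
by rewrite /vdm_node (bigD1 i)//= eq_sym.
Qed.

Lemma vdm_node_ge0 n (f : 'I_n -> R) i : 0 <= vdm_node f i.
Proof. by apply: prodr_ge0. Qed.

(* Fekete's argument: almost maximize the Vandermonde product over A. *)
Lemma fekete n (A : set R) (a D eps : R) : 0 < eps -> A `<=` `[a, a + D] ->
  (forall s : seq R, (size s <= n)%N ->
     exists2 y, A y & eps <= \prod_(z <- s) `|y - z|) ->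
  exists f : 'I_n -> R, (forall i, A (f i)) /\
    forall i, eps / 2 <= vdm_node f i.
Proof.
move=> e0 AD far.
(* Distinct points give one configuration with nonzero product, so the supremum is positive and 3/4
   of it is strictly below it. *)
have [s [sn us As]] : exists s : seq R, [/\ size s = n, uniq s &
    forall y, y \in s -> A y].
  suff : forall m, (m <= n)%N -> exists s : seq R, [/\ size s = m, uniq s &
    forall y, y \in s -> A y] by exact.
  elim => [_|m IH mn]; first by exists [::].
  have [s [sm us As]] := IH (ltnW mn).
  have [|y Ay yp] := far s; first by rewrite sm ltnW.
  exists (y :: s); split => /=; first by rewrite sm.
    rewrite us andbT; apply/negP => ys.
    by move: yp; rewrite (big_rem y)//= subrr normr0 mul0r leNgt e0.
  by move=> z; rewrite inE => /predU1P[->//|/As].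
pose S := [set vdm f | f in [set f : 'I_n -> R | forall i, A (f i)]].
pose f0 (i : 'I_n) := nth 0 s i.
have Af0 i : A (f0 i) by apply: As; rewrite mem_nth// sn.
have vf0 : 0 < vdm f0.
  apply: prodr_gt0 => i _; apply: prodr_gt0 => j ji.
  by rewrite normr_gt0 subr_eq0 nth_uniq ?sn// eq_sym.
have Dn f : (forall i, A (f i)) -> forall i j : 'I_n, `|f i - f j| <= `|D|.
  move=> Af i j; have := AD _ (Af i); have := AD _ (Af j).
  rewrite /= !in_itv/= => /andP[? ?] /andP[? ?].
  by rewrite (le_trans _ (ler_norm _))// ler_norml; apply/andP; split; lra.
have supS : has_sup S.
  split; first by exists (vdm f0); exists f0.
  exists (\prod_(i < n) \prod_(j < n | j != i) `|D|) => _ [f Af <-].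
  apply: ler_prod => i _; rewrite vdm_node_ge0/=.
  by apply: ler_prod => j _; rewrite normr_ge0 Dn.
have S0 : 0 < sup S.
  by apply: lt_le_trans vf0 _; apply: ub_le_sup; [case: supS|exists f0].
(* A is not assumed closed, so a maximizer may not exist. If node i were below eps / 2, moving it to
   a far point would multiply the product by at least 4, more than the factor 4/3 left by this
   choice. *)
have [|_ [f Af <-] fS] := @sup_adherent _ S (3 / 4 * sup S) _ supS.
  by rewrite mulr_gt0//; lra.
exists f; split => // i; rewrite leNgt; apply/negP => fi.
have [|y Ay yp] := far [seq f j | j <- enum 'I_n & j != i].
  by rewrite size_map size_filter (leq_trans (count_size _ _))// size_enum_ord.
rewrite big_map big_filter big_enum_cond/= in yp.
pose g j := if j == i then y else f j.
have gi : vdm_node g i = \prod_(j | j != i) `|y - f j|.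
  apply: eq_bigr => j /negPf ji; by rewrite /g eqxx ji.
have : vdm g <= sup S.
  apply: ub_le_sup; [by case: supS|exists g => // j].
  by rewrite /g; case: ifP.
move: fS; rewrite (vdm_split g i) (vdm_split f i).
have -> : \prod_(k | k != i) \prod_(j | (j != k) && (j != i)) `|g k - g j| =
          \prod_(k | k != i) \prod_(j | (j != k) && (j != i)) `|f k - f j|.
  apply: eq_bigr => k /negPf ki; apply: eq_bigr => j /andP[_ /negPf ji].
  by rewrite /g ki ji.
set P := \prod_(k | _) _.
have P0 : 0 <= P by apply: prodr_ge0 => k _; apply: prodr_ge0.
have : eps ^+ 2 <= vdm_node g i ^+ 2.
  by rewrite lerXn2r ?nnegrE ?vdm_node_ge0 ?(ltW e0)// gi.
have : vdm_node f i ^+ 2 <= (eps / 2) ^+ 2.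
  by rewrite lerXn2r ?nnegrE ?vdm_node_ge0 ?divr_ge0 ?(ltW e0)// ltW.
rewrite expr_div_n; move: (vdm_node f i ^+ 2) (vdm_node g i ^+ 2) => u v uv ev.
have : u * P <= eps ^+ 2 / 2 ^+ 2 * P by rewrite ler_wpM2r.
have : eps ^+ 2 * P <= v * P by rewrite ler_wpM2r.
rewrite (mulrAC _ _ P); move: (eps ^+ 2 * P) => w.
rewrite (_ : 2 ^+ 2 = 4 :> R); last by ring.
by lra.
Qed.

End Fekete.

Section LagrangeRemainder.
Variable R : realType.

Lemma rolle_interleave (f df : R -> R) (x : R) (s : seq R) :
  (forall y : R, is_derive y 1 f (df y)) -> path <%R x s ->
  (forall y, y \in x :: s -> f y = 0) ->
  exists t, [/\ size t = size s, path <%R x t,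
    forall y, y \in t -> df y = 0 & forall y, y \in t -> y < last x s].
Proof.
move=> hf; elim: s x => [|y s IH] x /=; first by move=> _ _; exists [::].
move=> /andP[xy ys] f0.
have [w _|||c] := @Rolle R f x y xy.
- by have [] := hf w.
- apply: derivable_within_continuous => w _; by have [] := hf w.
- by rewrite !f0 ?inE ?eqxx ?orbT.
rewrite in_itv/= => /andP[xc cy] hc.
have [|t [st pt t0 tl]] := IH y ys; first by move=> w ws; rewrite f0// inE ws orbT.
have lys : y <= last y s.
  have := mem_last y s; rewrite inE => /predU1P[->//|].
  by have /allP H := order_path_min lt_trans ys; move=> /H/ltW.
exists (c :: t); split => /=; first by rewrite st.
- rewrite xc/=; case: t pt {st t0 tl} => //= w t /andP[yw ->]; rewrite andbT.
  exact: lt_trans yw.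
- move=> w; rewrite inE => /predU1P[->|/t0//].
  by have [_ <-] := hf c; have [_ <-] := hc.
- move=> w; rewrite inE => /predU1P[->|/tl//]; exact: lt_le_trans lys.
Qed.

Lemma rolle_iter (n : nat) (g : nat -> R -> R) (s : seq R) (a b : R) :
  (forall m (y : R), is_derive y 1 (g m) (g m.+1 y)) ->
  sorted <%R s -> size s = n.+1 ->
  (forall y, y \in s -> g 0%N y = 0) -> (forall y, y \in s -> a <= y <= b) ->
  exists2 y, a <= y <= b & g n y = 0.
Proof.
elim: n g s => [|n IH] g s hg.
  case: s => // y s _ _ g0 ab; exists y; [apply: ab|apply: g0]; exact: mem_head.
case: s => // x s /= xs [sn] g0 ab.
have [t [st pt t0 tl]] := rolle_interleave (hg 0%N) xs g0.
apply: (IH (fun m => g m.+1) t) => //.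
- by move: pt => /path_sorted.
- by rewrite st.
- move=> y yt; have /andP[_ lb] := ab _ (mem_last x s).
  have /andP[ax _] := ab _ (mem_head x s).
  have /allP/(_ _ yt) xy := order_path_min lt_trans pt.
  by rewrite (le_trans ax (ltW xy)) (le_trans (ltW (tl _ yt)) lb).
Qed.

Definition lag n (x : 'I_n -> R) (i : 'I_n) (z : R) :=
  \prod_(j | j != i) ((z - x j) / (x i - x j)).

Lemma lag_self n (x : 'I_n -> R) i : injective x -> lag x i (x i) = 1.
Proof.
move=> xi; apply: big1 => j ji; rewrite divff// subr_eq0.
by apply: contra ji => /eqP/xi ->.
Qed.

Lemma lag_other n (x : 'I_n -> R) i k : k != i -> lag x i (x k) = 0.
Proof. by move=> ki; rewrite /lag (bigD1 k)//= subrr !mul0r. Qed.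

(** Add to the interpolant the multiple of the nodal polynomial that also matches g at z. The
    difference with g has n + 1 zeros, so by Rolle its n-th derivative vanishes somewhere, and the
    n-th derivative of the polynomial is constant. If z is a node, where the nodal polynomial
    vanishes, the formula is checked directly. *)
Lemma lagrange_remainder n (x : 'I_n -> R) (g : nat -> R -> R) (a b z : R) :
  (forall m (y : R), is_derive y 1 (g m) (g m.+1 y)) -> injective x ->
  (forall i, a <= x i <= b) -> a <= z <= b ->
  exists2 y, a <= y <= b & g 0%N z =
    \sum_i g 0%N (x i) * lag x i z + g n y / n`!%:R * \prod_i (z - x i).
Proof.
move=> hg xinj xab zab.
have [[i zi]|zx] := pselect (exists i, z = x i).
  exists z => //; rewrite [X in _ + _ * X](bigD1 i)//= zi subrr mul0r mulr0 addr0.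
  rewrite (bigD1 i)//= lag_self// mulr1 big1 ?addr0// => j ji.
  by rewrite lag_other ?mulr0// eq_sym.
pose l i := \prod_(j | j != i) ((x i - x j)^-1 *: ('X - (x j)%:P)).
have lE i w : (l i).[w] = lag x i w.
  rewrite horner_prod; apply: eq_bigr => j _.
  by rewrite hornerZ hornerXsubC mulrC.
have sl i : (size (l i) <= n)%N.
  apply: leq_trans (size_prod_leq _ _) _.
  have -> : #|[pred j | j != i]| = n.-1.
    by have := cardC1 i; rewrite card_ord.
  have : (\sum_(j | j != i) size ((x i - x j)^-1 *: ('X - (x j)%:P)) <= n.-1 * 2)%N.
    apply: leq_trans (_ : _ <= \sum_(j | j != i) 2)%N _.
      by apply: leq_sum => j _; rewrite (leq_trans (size_scale_leq _ _))// size_XsubC.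
    rewrite sum_nat_const leq_mul//.
    by have := cardC1 i; rewrite card_ord => ->.
  by have := ltn_ord i; lia.
pose W := \prod_(i <- enum 'I_n) ('X - (x i)%:P).
have WE w : W.[w] = \prod_i (w - x i).
  by rewrite horner_prod big_enum/=; apply: eq_bigr => j _; rewrite hornerXsubC.
have sW : size W = n.+1 by rewrite /W size_prod_XsubC size_enum_ord.
have W1 : W`_n = 1.
  have /monicP := monic_prod_XsubC (enum 'I_n) predT x.
  by rewrite /lead_coef -/W sW.
have Wz : W.[z] != 0.
  rewrite WE; apply/prodf_neq0 => i _; rewrite subr_eq0.
  by apply/eqP => zi; apply: zx; exists i.
pose P := \sum_i (g 0%N (x i)) *: l i.
have sP : (size P <= n)%N.
  apply: (leq_trans (size_sum _ _ _)); apply/bigmax_leqP => i _.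
  exact: leq_trans (size_scale_leq _ _) _.
have PE w : P.[w] = \sum_i g 0%N (x i) * lag x i w.
  by rewrite horner_sum; apply: eq_bigr => i _; rewrite hornerZ lE.
pose c := (g 0%N z - P.[z]) / W.[z].
pose Q := P + c *: W.
have Qx i : Q.[x i] = g 0%N (x i).
  rewrite hornerD hornerZ PE WE [X in c * X](bigD1 i)//= subrr mul0r mulr0 addr0.
  rewrite (bigD1 i)//= lag_self// mulr1 big1 ?addr0// => j ji.
  by rewrite lag_other ?mulr0// eq_sym.
have Qz : Q.[z] = g 0%N z.
  by rewrite hornerD hornerZ /c divfK// addrC subrK.
pose phi m w := g m w - Q^`(m).[w].
pose s := sort <=%R (z :: [seq x i | i <- enum 'I_n]).
have us : uniq s.
  rewrite sort_uniq /= map_inj_uniq// enum_uniq andbT.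
  by apply/negP => /mapP[i _ zi]; apply: zx; exists i.
have [||||y yab phiy] := @rolle_iter n phi s a b.
- by rewrite sort_lt_sorted -(sort_uniq <=%R).
- by rewrite size_sort/= size_map size_enum_ord.
- move=> w; rewrite mem_sort inE => /predU1P[->|/mapP[i _ ->]].
    by rewrite /phi derivn0 Qz subrr.
  by rewrite /phi derivn0 Qx subrr.
- by move=> w; rewrite mem_sort inE => /predU1P[->//|/mapP[i _ ->]].
exists y => //.
have Qn : Q^`(n) = (c * n`!%:R)%:P.
  apply/polyP => k; rewrite coef_derivn coefC coefD coefZ.
  case: k => [|k].
    by rewrite addn0 ffactnn (nth_default 0 sP) add0r W1 mulr1 mulr_natr.
  rewrite !nth_default ?mulr0 ?addr0 ?mul0rn// ?sW; first by lia.
  by apply: leq_trans sP _; lia.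
move: phiy; rewrite /phi Qn hornerC => /subr0_eq ->.
rewrite mulfK ?pnatr_eq0 ?gtn_eqF ?fact_gt0// -PE -WE /c divfK//.
by rewrite addrC subrK.
Qed.

End LagrangeRemainder.

(** * Derivatives of the Gaussian *)

Section GaussDerivatives.
Variable R : realType.
Implicit Types (a x : R).

(* The m-th derivative of exp(- a x^2) is gauss_poly a m x * exp(- a x^2). *)
Fixpoint gauss_poly a (m : nat) x : R :=
  match m with
  | 0 => 1
  | m1.+1 => match m1 with
             | 0 => - (2 * a) * x
             | m2.+1 => - (2 * a) * (x * gauss_poly a m1 x + m1%:R * gauss_poly a m2 x)
             end
  end.

Definition gauss_der a (m : nat) x := gauss_poly a m x * expR (- (a * x ^+ 2)).

Arguments gauss_poly : simpl never.

Lemma gauss_polySS a m x : gauss_poly a m.+2 x =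
  - (2 * a) * (x * gauss_poly a m.+1 x + m.+1%:R * gauss_poly a m x).
Proof. by []. Qed.

(** A rescaled form of H_n' = 2 n H_(n-1) for Hermite polynomials. Two consecutive indices are
    treated together because the recursion has depth two. *)
Lemma is_derive_gauss_poly a m x :
  is_derive x 1 (gauss_poly a m.+1) (- (2 * a) * m.+1%:R * gauss_poly a m x).
Proof.
suff : is_derive x 1 (gauss_poly a m.+1) (- (2 * a) * m.+1%:R * gauss_poly a m x) /\
  is_derive x 1 (gauss_poly a m.+2) (- (2 * a) * m.+2%:R * gauss_poly a m.+1 x) by case.
elim: m => [|m [IH1 IH2]].
  have D1 : is_derive x 1 (gauss_poly a 1) (- (2 * a) * 1%:R * gauss_poly a 0 x).
    rewrite (_ : gauss_poly a 1 = fun x => - (2 * a) * x)//.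
    by apply: is_derive_eq; rewrite /GRing.scale/= /gauss_poly; ring.
  split => //.
  rewrite [X in is_derive _ _ X](_ : _ = fun x => - (2 * a) * (x * gauss_poly a 1 x + 1))//.
    by apply: is_derive_eq; rewrite /GRing.scale/= /gauss_poly; ring.
  by apply/funext => y; rewrite /gauss_poly mulr1.
split => //.
rewrite (_ : gauss_poly a m.+3 = fun x =>
  - (2 * a) * (x * gauss_poly a m.+2 x + m.+2%:R * gauss_poly a m.+1 x))//.
apply: is_derive_eq.
rewrite /GRing.scale/= gauss_polySS -(natr1 m.+2) -(natr1 m.+1).
ring.
Qed.

Lemma is_derive_gauss_der a m x :
  is_derive x 1 (gauss_der a m) (gauss_der a m.+1 x).
Proof.
have E : is_derive x 1 (fun x => expR (- (a * x ^+ 2)))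
    (- (2 * a * x) * expR (- (a * x ^+ 2))).
  apply: is_derive_eq; rewrite /GRing.scale/=; ring.
case: m => [|m].
  rewrite (_ : gauss_der a 0 = fun x => expR (- (a * x ^+ 2))); last first.
    by apply/funext => y; rewrite /gauss_der /gauss_poly mul1r.
  by apply: is_derive_eq; rewrite /gauss_der /gauss_poly; ring.
have D := is_derive_gauss_poly a m x.
rewrite [X in is_derive _ _ X](_ : _ = fun x => gauss_poly a m.+1 x * expR (- (a * x ^+ 2)))//.
apply: is_derive_eq; rewrite /gauss_der gauss_polySS /GRing.scale/=; ring.
Qed.

(** The base y satisfies y^2 >= 2 a |x| y + 2 a N, which is what the recursion needs to propagate
    the bound y^m up to index N. *)
Lemma gauss_poly_le a N m x : 0 < a -> (m <= N)%N ->
  `|gauss_poly a m x| <= (2 * a * `|x| + Num.sqrt (2 * a * N%:R)) ^+ m.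
Proof.
move=> a0; set y := _ + _.
have s0 : 0 <= Num.sqrt (2 * a * N%:R) by exact: sqrtr_ge0.
have ax0 : 0 <= 2 * a * `|x| by rewrite !mulr_ge0// ltW.
have y0 : 0 <= y by rewrite addr_ge0.
suff H k : (k.+1 <= N)%N ->
    `|gauss_poly a k x| <= y ^+ k /\ `|gauss_poly a k.+1 x| <= y ^+ k.+1.
  by case: m => [_|m /H[]//]; rewrite expr0 /gauss_poly normr1.
elim: k => [_|k IH kN].
  rewrite expr0 expr1 /gauss_poly normr1; split => //.
  rewrite normrM normrN (@gtr0_norm _ (2 * a)) ?mulr_gt0//.
  by rewrite lerDl.
have [H1 H2] := IH (ltnW kN); split => //.
rewrite gauss_polySS normrM normrN (@gtr0_norm _ (2 * a)) ?mulr_gt0//.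
apply: (@le_trans _ _ (2 * a * (`|x| * y ^+ k.+1 + N%:R * y ^+ k))).
  rewrite ler_wpM2l ?mulr_ge0 ?(ltW a0)//.
  rewrite (le_trans (ler_normD _ _))// !normrM (ger0_norm (ler0n _ k.+1)).
  rewrite lerD ?ler_wpM2l//.
  by rewrite ler_pM// ler_nat ltnW.
rewrite !exprS.
have -> : 2 * a * (`|x| * (y * y ^+ k) + N%:R * y ^+ k) =
   (2 * a * `|x| * y + 2 * a * N%:R) * y ^+ k by ring.
rewrite mulrA ler_wpM2r ?exprn_ge0//.
have sE : 2 * a * N%:R = Num.sqrt (2 * a * N%:R) ^+ 2.
  by rewrite sqr_sqrtr// !mulr_ge0// ltW.
rewrite [in X in _ + X]sE [X in _ <= X]mulrDl lerD2l expr2 ler_wpM2l//.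
by rewrite lerDr.
Qed.

(** With s = sqrt (2 a N), (s + 2 a |x|)^N is at most s^N exp(s |x|), and s |x| <= a x^2 / 2 + N:
    half of the Gaussian decay is spent to absorb the polynomial. *)
Lemma gauss_der_le a N x : 0 < a -> `|gauss_der a N x| <=
  Num.sqrt (2 * a * N%:R) ^+ N * expR N%:R * expR (- (a * x ^+ 2 / 2)).
Proof.
move=> a0; rewrite /gauss_der normrM (ger0_norm (expR_ge0 _)).
apply: le_trans (ler_wpM2r (expR_ge0 _) (gauss_poly_le x a0 (leqnn N))) _.
case: N => [|N].
  rewrite !expr0 expR0 !mul1r ler_expR lerN2.
  have : 0 <= a * x ^+ 2 by rewrite mulr_ge0 ?sqr_ge0// ltW.
  by lra.
set s := Num.sqrt _.
have n0 : 0 < N.+1%:R :> R by rewrite ltr0n.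
have s0 : 0 < s by rewrite sqrtr_gt0 !mulr_gt0.
have sE : s ^+ 2 = 2 * a * N.+1%:R by rewrite sqr_sqrtr// !mulr_ge0// ltW.
have -> : 2 * a * `|x| + s = s * (1 + 2 * a * `|x| / s).
  by field; rewrite gt_eqF.
rewrite exprMn -2!(mulrA (s ^+ N.+1)) ler_wpM2l ?exprn_ge0 ?(ltW s0)//.
apply: (@le_trans _ _ (expR (2 * a * `|x| / s) ^+ N.+1 * expR (- (a * x ^+ 2)))).
  rewrite ler_wpM2r ?expR_ge0// lerXn2r ?nnegrE ?expR_ge0 ?expR_ge1Dx//.
  by rewrite addr_ge0// !mulr_ge0 ?invr_ge0// ltW.
rewrite -expRM_natr -!expRD ler_expR.
have -> : 2 * a * `|x| / s * N.+1%:R = s * `|x|.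
  rewrite (_ : N.+1%:R = s ^+ 2 / (2 * a)); first by field; rewrite !gt_eqF.
  by rewrite sE; field; rewrite gt_eqF.
rewrite -(real_normK (num_real x)).
have : 0 <= (a * `|x| - s) ^+ 2 / (2 * a).
  by rewrite divr_ge0 ?sqr_ge0// mulr_ge0// ltW.
rewrite (_ : _ / (2 * a) = a * `|x| ^+ 2 / 2 - s * `|x| + s ^+ 2 / (2 * a)); last first.
  by field; rewrite gt_eqF.
have -> : s ^+ 2 / (2 * a) = N.+1%:R by rewrite sE; field; rewrite gt_eqF.
by lra.
Qed.

End GaussDerivatives.

(** * The heat kernel on square integrable functions *)

Section HeatKernel.
Variable R : realType.
Implicit Types (s x y z : R) (f g : R -> R).
Local Notation mu := (@lebesgue_measure R).

(** This is (4 pi s)^(-1/2) for s > 0; the exponential form is positive for every s and is easily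
    differentiated in s. *)
Definition heat_peak s : R := expR (- (ln (4 * pi * s) / 2)).
Definition heat s z : R := heat_peak s * expR (- (z ^+ 2 / (4 * s))).

Lemma heat_peak_gt0 s : 0 < heat_peak s. Proof. exact: expR_gt0. Qed.

Lemma heat_gt0 s z : 0 < heat s z.
Proof. by rewrite mulr_gt0 ?expR_gt0. Qed.

Lemma heat_ge0 s z : 0 <= heat s z. Proof. exact/ltW/heat_gt0. Qed.

Lemma heatN s z : heat s (- z) = heat s z.
Proof. by rewrite /heat sqrrN. Qed.

Lemma heat_le_peak s z : 0 < s -> heat s z <= heat_peak s.
Proof.
move=> s0; rewrite ler_piMr ?expR_ge0// -[leRHS]expR0 ler_expR oppr_le0.
by rewrite divr_ge0 ?sqr_ge0// mulr_ge0// ltW.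
Qed.

Lemma heatE s x y : 0 < s ->
  heat s (x - y) = normal_pdf x (Num.sqrt (2 * s)) y.
Proof.
move=> s0; have s20 : 0 < 2 * s by rewrite mulr_gt0.
rewrite normal_pdfE; last by rewrite gt_eqF// sqrtr_gt0.
rewrite /normal_peak /normal_fun sqr_sqrtr ?(ltW s20)//.
have p0 : 0 < 4 * pi * s :> R by rewrite !mulr_gt0// pi_gt0.
have E : 2 * s * pi *+ 2 = 4 * pi * s :> R by rewrite -mulr_natr; ring.
congr (_ * _).
  rewrite E /heat_peak -powR12_sqrt ?(ltW p0)// -powRN /powR gt_eqF//.
  by congr expR; field.
by congr expR; rewrite -mulNr -(mulr_natr (2 * s)); congr (_ / _); ring.
Qed.

Lemma continuous_heat s : continuous (heat s).
Proof.
move=> z; apply: cvgM; first exact: cvg_cst.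
apply: (cvg_comp _ expR); last exact: continuous_expR.
apply: (@cvgN _ R^o); apply: cvgM; last exact: cvg_cst.
exact: exprn_continuous.
Qed.

Lemma measurable_heat s x : measurable_fun setT (fun y => heat s (x - y)).
Proof.
apply: measurableT_comp; first exact: continuous_measurable_fun (@continuous_heat s).
exact: measurable_funB.
Qed.

Lemma measurable_heat2 s : measurable_fun setT (fun p : R * R => heat s (p.1 - p.2)).
Proof.
apply: measurableT_comp; first exact: continuous_measurable_fun (@continuous_heat s).
by apply: measurable_funB; [exact: measurable_fst|exact: measurable_snd].
Qed.

Lemma integral_heat s x : 0 < s -> (\int[mu]_y (heat s (x - y))%:E = 1)%E.
Proof.
move=> s0; under eq_integral do rewrite heatE//.
exact: integral_normal_pdf.
Qed.

Lemma integral_heat_l s y : 0 < s -> (\int[mu]_x (heat s (x - y))%:E = 1)%E.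
Proof.
move=> s0; rewrite -[RHS](integral_heat y s0).
by apply: eq_integral => x _; rewrite -heatN opprB.
Qed.

Lemma integrable_heat s x : 0 < s ->
  mu.-integrable setT (EFin \o (fun y => heat s (x - y))).
Proof.
move=> s0; apply: eq_integrable (integrable_normal_pdf x (Num.sqrt (2 * s))) => //.
by move=> y _; rewrite /= heatE.
Qed.

Lemma Rintegral_heat s x : 0 < s -> \int[mu]_y heat s (x - y) = 1.
Proof. by move=> s0; rewrite /Rintegral integral_heat. Qed.

Definition L2 f := measurable_fun setT f /\
  mu.-integrable setT (EFin \o (fun x => f x ^+ 2)).

Definition sqn f : R := \int[mu]_x (f x ^+ 2).

Lemma sqn_ge0 f : 0 <= sqn f.
Proof. by apply: Rintegral_ge0 => x _; exact: sqr_ge0. Qed.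

Lemma sqnE f : L2 f -> (\int[mu]_x (f x ^+ 2)%:E = (sqn f)%:E)%E.
Proof. by move=> [_ If]; rewrite fineK//; exact: integrable_fin_num. Qed.

Lemma integrable_dominated f g : measurable_fun setT f ->
  mu.-integrable setT (EFin \o g) -> (forall x, `|f x| <= g x) ->
  mu.-integrable setT (EFin \o f).
Proof.
move=> mf Ig fg; apply: le_integrable Ig => //; first exact/measurable_EFinP.
by move=> x _; rewrite /= lee_fin (le_trans (fg x))// ler_norm.
Qed.

Lemma integrable_mulL2 f g : L2 f -> L2 g ->
  mu.-integrable setT (EFin \o (fun x => f x * g x)).
Proof.
move=> [mf If] [mg Ig].
apply: (@integrable_dominated _ (fun x => f x ^+ 2 + g x ^+ 2)).
- exact: measurable_funM.
- rewrite (_ : _ \o _ = (EFin \o (fun x => f x ^+ 2)%R) \+ (EFin \o (fun x => g x ^+ 2)%R))%E//.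
  exact: integrableD.
- move=> x; rewrite normrM -(real_normK (num_real (f x))) -(real_normK (num_real (g x))).
  have := sqr_ge0 (`|f x| - `|g x|); have := mulr_ge0 (normr_ge0 (f x)) (normr_ge0 (g x)).
  by set a := `|f x|; set b := `|g x|; rewrite sqrrB -mulr_natr; lra.
Qed.

Lemma integrable_heatM s x f : 0 < s -> measurable_fun setT f ->
  mu.-integrable setT (EFin \o f) ->
  mu.-integrable setT (EFin \o (fun y => heat s (x - y) * f y)).
Proof.
move=> s0 mf If.
apply: (@integrable_dominated _ (fun y => heat_peak s * `|f y|)).
- by apply: measurable_funM => //; exact: measurable_heat.
- rewrite (_ : _ \o _ = fun y => (heat_peak s)%:E * `|(f y)%:E|)%E//.
  by apply: integrableZl => //; exact: integrable_abse.
- move=> y; rewrite normrM ler_wpM2r// ger0_norm ?heat_ge0//.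
  exact: heat_le_peak.
Qed.

Lemma L2_heat s x : 0 < s -> L2 (fun y => heat s (x - y)).
Proof.
move=> s0; split; first exact: measurable_heat.
rewrite (_ : (fun y => _) = (fun y => heat s (x - y) * heat s (x - y)))//.
by apply: integrable_heatM => //; [exact: measurable_heat|exact: integrable_heat].
Qed.

Definition heat_conv s f x : R := \int[mu]_y (heat s (x - y) * f y).

Lemma integrable_heatL2 s x f : 0 < s -> L2 f ->
  mu.-integrable setT (EFin \o (fun y => heat s (x - y) * f y)).
Proof. by move=> s0 Lf; apply: integrable_mulL2 => //; exact: L2_heat. Qed.

(** Jensen's inequality for the probability density [heat s (x - y)]: the variance of f about its
    mean c is nonnegative. *)
Lemma heat_conv_sqr_le s f x : 0 < s -> L2 f ->
  heat_conv s f x ^+ 2 <= \int[mu]_y (heat s (x - y) * f y ^+ 2).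
Proof.
move=> s0 Lf; have [mf If] := Lf; set c := heat_conv s f x.
have Ihf := integrable_heatL2 x s0 Lf.
have Ih := integrable_heat x s0.
have Ihf2 := @integrable_heatM s x (fun y => f y ^+ 2) s0 (measurable_funX _ mf) If.
have : 0 <= \int[mu]_y (heat s (x - y) * (f y - c) ^+ 2).
  by apply: Rintegral_ge0 => y _; rewrite mulr_ge0 ?sqr_ge0 ?heat_ge0.
rewrite (_ : \int[mu]_y _ =
    \int[mu]_y (heat s (x - y) * f y ^+ 2 - (2 * c) * (heat s (x - y) * f y) +
      c ^+ 2 * heat s (x - y))); last first.
  by apply: eq_Rintegral => y _; ring.
have I2 : mu.-integrable setT (EFin \o (fun y => 2 * c * (heat s (x - y) * f y))).
  exact: (@integrableZl _ _ _ _ _ _ (2 * c) _ Ihf).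
have I3 : mu.-integrable setT (EFin \o (fun y => c ^+ 2 * heat s (x - y))).
  exact: (@integrableZl _ _ _ _ _ _ (c ^+ 2) _ Ih).
rewrite RintegralD//; last exact: (@integrableB _ _ _ _ _ _ _ _ Ihf2 I2).
rewrite RintegralB// (RintegralZl (2 * c) measurableT Ihf).
rewrite (RintegralZl (c ^+ 2) measurableT Ih) Rintegral_heat// -/(heat_conv s f x) -/c.
by lra.
Qed.

Lemma heat_conv_sqn s f : 0 < s -> L2 f ->
  (\int[mu]_x \int[mu]_y (heat s (x - y) * f y ^+ 2)%:E = (sqn f)%:E)%E.
Proof.
move=> s0 Lf; have [mf If] := Lf.
pose F (p : R * R) := (heat s (p.1 - p.2) * f p.2 ^+ 2)%:E.
have mF : measurable_fun setT F.
  apply/measurable_EFinP; apply: measurable_funM; first exact: measurable_heat2.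
  by apply: measurable_funX; apply: measurableT_comp => //; exact: measurable_snd.
have F0 p : (0 <= F p)%E by rewrite lee_fin mulr_ge0 ?sqr_ge0 ?heat_ge0.
rewrite [LHS](@fubini_tonelli _ _ _ _ R mu mu F mF F0)/=.
under eq_integral => y _.
  under eq_integral do rewrite /F/= EFinM muleC.
  rewrite ge0_integralZl//; last 3 first.
  + apply/measurable_EFinP; apply: measurableT_comp.
      exact: continuous_measurable_fun (@continuous_heat s).
    exact: measurable_funB.
  + by move=> x _; rewrite lee_fin heat_ge0.
  + by rewrite lee_fin sqr_ge0.
  rewrite integral_heat_l// mule1; over.
exact: sqnE.
Qed.

Lemma integral_heat_conv s f : 0 < s -> L2 f ->
  mu.-integrable setT (EFin \o (fun x => \int[mu]_y (heat s (x - y) * f y ^+ 2))) /\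
  \int[mu]_x \int[mu]_y (heat s (x - y) * f y ^+ 2) = sqn f.
Proof.
move=> s0 Lf; have [mf If] := Lf.
set G := fun x => \int[mu]_y (heat s (x - y) * f y ^+ 2).
have E : EFin \o G =
    (fun x => \int[mu]_y (heat s (x - y) * f y ^+ 2)%:E)%E.
  apply/funext => x; rewrite /G /= fineK//; apply: integrable_fin_num => //.
  by apply: integrable_heatM => //; exact: measurable_funX.
split; last by rewrite -[LHS]/(fine (\int[mu]_x (EFin \o G) x)%E) E heat_conv_sqn.
rewrite E; apply/integrableP; split.
  pose F (p : R * R) := (heat s (p.1 - p.2) * f p.2 ^+ 2)%:E.
  apply: (@measurable_fun_fubini_tonelli_F _ _ _ _ R mu F).
  - apply/measurable_EFinP; apply: measurable_funM; first exact: measurable_heat2.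
    by apply: measurable_funX; apply: measurableT_comp => //; exact: measurable_snd.
  - by move=> p; rewrite lee_fin mulr_ge0 ?sqr_ge0 ?heat_ge0.
under eq_integral => x _.
  rewrite gee0_abs; last by apply: integral_ge0 => y _; rewrite lee_fin mulr_ge0 ?sqr_ge0 ?heat_ge0.
  over.
by rewrite heat_conv_sqn// ltry.
Qed.

End HeatKernel.

Section HeatSymmetry.
Variable R : realType.
Implicit Types (s x y z : R) (f g : R -> R).
Local Notation mu := (@lebesgue_measure R).

(** Fubini applies because the double integrand is dominated by the kernel times f(y)^2 + g(x)^2,
    and each of the two terms is integrable by Tonelli, in the order that first integrates the
    kernel to 1 or its mirror image. *)
Lemma heat_conv_sym s f g : 0 < s -> L2 f -> L2 g ->
  \int[mu]_x (heat_conv s f x * g x) = \int[mu]_x (f x * heat_conv s g x).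
Proof.
move=> s0 Lf Lg; have [mf If] := Lf; have [mg Ig] := Lg.
pose F (p : R * R) := (heat s (p.1 - p.2) * (f p.2 * g p.1))%:E.
pose F1 (p : R * R) := (heat s (p.1 - p.2) * f p.2 ^+ 2)%:E.
pose F2 (p : R * R) := (heat s (p.1 - p.2) * g p.1 ^+ 2)%:E.
have mf2 : measurable_fun setT (fun p : R * R => f p.2).
  by apply: measurableT_comp => //; exact: measurable_snd.
have mg1 : measurable_fun setT (fun p : R * R => g p.1).
  by apply: measurableT_comp => //; exact: measurable_fst.
have mh := measurable_heat2 s.
have mF : measurable_fun setT F.
  by apply/measurable_EFinP; apply: measurable_funM => //; exact: measurable_funM.
have mF1 : measurable_fun setT F1.
  by apply/measurable_EFinP; apply: measurable_funM => //; exact: measurable_funX.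
have mF2 : measurable_fun setT F2.
  by apply/measurable_EFinP; apply: measurable_funM => //; exact: measurable_funX.
have F10 p : (0 <= F1 p)%E by rewrite lee_fin mulr_ge0 ?sqr_ge0 ?heat_ge0.
have F20 p : (0 <= F2 p)%E by rewrite lee_fin mulr_ge0 ?sqr_ge0 ?heat_ge0.
have IF1 : (mu \x mu)%E.-integrable setT F1.
  apply/(@integrable12ltyP _ _ _ _ R mu mu F1 mF1).
  under eq_integral do under eq_integral do rewrite gee0_abs//.
  by rewrite [X in (X < _)%E](heat_conv_sqn s0 Lf) ltry.
have IF2 : (mu \x mu)%E.-integrable setT F2.
  apply/(@integrable21ltyP _ _ _ _ R mu mu F2 mF2).
  under eq_integral do under eq_integral do rewrite gee0_abs//.
  rewrite [X in (X < _)%E](_ : _ =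
     \int[mu]_x \int[mu]_y (heat s (x - y) * g y ^+ 2)%:E)%E.
    by rewrite (heat_conv_sqn s0 Lg) ltry.
  apply: eq_integral => x _; apply: eq_integral => y _.
  by rewrite /F2 /= -heatN opprB.
have IF : (mu \x mu)%E.-integrable setT F.
  have I12 := integrableD measurableT IF1 IF2.
  apply: (le_integrable measurableT _ _ I12) => //.
  move=> p _; rewrite /F /F1 /F2 /= lee_fin -mulrDr [leRHS]ger0_norm; last first.
    by rewrite mulr_ge0 ?heat_ge0// addr_ge0 ?sqr_ge0.
  rewrite normrM (normrM (f _)) (ger0_norm (heat_ge0 _ _)) ler_wpM2l ?heat_ge0//.
  rewrite -(real_normK (num_real (f _))) -(real_normK (num_real (g _))).
  have := sqr_ge0 (`|f p.2| - `|g p.1|).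
  have := mulr_ge0 (normr_ge0 (f p.2)) (normr_ge0 (g p.1)).
  by set a := `|f _|; set b := `|g _|; rewrite sqrrB -mulr_natr; lra.
have Iheat h x : L2 h -> mu.-integrable setT (fun y => (heat s (x - y) * h y)%:E).
  exact: integrable_heatL2.
have := @Fubini _ _ _ _ R mu mu F IF; rewrite /F/=.
have -> : (fun x => \int[mu]_y (heat s (x - y) * (f y * g x))%:E)%E =
    (fun x => (heat_conv s f x * g x)%:E).
  apply/funext => x; rewrite (_ : (fun y => _) = (fun y => (g x)%:E * (heat s (x - y) * f y)%:E)%E).
    rewrite integralZl//; last exact: Iheat.
    rewrite /heat_conv /Rintegral EFinM muleC fineK//.
    by apply: integrable_fin_num => //; exact: Iheat.
  by apply/funext => y; rewrite -EFinM; congr EFin; ring.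
have -> : (fun y => \int[mu]_x (heat s (x - y) * (f y * g x))%:E)%E =
    (fun y => (f y * heat_conv s g y)%:E).
  apply/funext => y; rewrite (_ : (fun x => _) = (fun x => (f y)%:E * (heat s (y - x) * g x)%:E)%E).
    rewrite integralZl//; last exact: Iheat.
    rewrite /heat_conv /Rintegral EFinM fineK//.
    by apply: integrable_fin_num => //; exact: Iheat.
  by apply/funext => x; rewrite -EFinM -(heatN _ (x - y)) opprB; congr EFin; ring.
by rewrite /Rintegral => ->.
Qed.

End HeatSymmetry.

(** * Representation of classical solutions *)

Section HeatDerivatives.
Variable R : realType.
Implicit Types (s t x y z : R).
Local Notation mu := (@lebesgue_measure R).

Lemma is_derive_heat_z s z : 0 < s ->
  is_derive z 1 (heat s) (heat s z * (- (z / (2 * s)))).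
Proof.
move=> s0.
rewrite (_ : heat s = fun z => heat_peak s * expR (- (z ^+ 2 / (4 * s))))//.
apply: is_derive_eq; rewrite /heat /GRing.scale/=.
by field; rewrite gt_eqF.
Qed.

Lemma is_derive_heat_y s x y : 0 < s ->
  is_derive y 1 (fun y => heat s (x - y)) (heat s (x - y) * ((x - y) / (2 * s))).
Proof.
move=> s0; have D := is_derive_heat_z (x - y) s0.
have := @is_derive1_comp _ (heat s) (fun y => x - y) y _ _ D.
move=> /(_ (- 1)) H.
have D2 : is_derive y 1 (fun y => x - y) (- 1) by apply: is_derive_eq; ring.
by have := H D2; rewrite /comp mulrN1 mulrN opprK.
Qed.

Lemma is_derive_heat_yy s x y : 0 < s ->
  is_derive y 1 (fun y => heat s (x - y) * ((x - y) / (2 * s)))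
    (heat s (x - y) * ((x - y) ^+ 2 / (4 * s ^+ 2) - (2 * s)^-1)).
Proof.
move=> s0; have D := is_derive_heat_y x y s0.
apply: is_derive_eq; rewrite /GRing.scale/=.
by field; rewrite gt_eqF.
Qed.

(** The right-hand side agrees with that of [is_derive_heat_yy]: the kernel solves the heat
    equation. *)
Lemma is_derive_heat_s s z : 0 < s ->
  is_derive s 1 (fun s => heat s z)
    (heat s z * (z ^+ 2 / (4 * s ^+ 2) - (2 * s)^-1)).
Proof.
move=> s0; have q0 : 0 < 4 * pi :> R by rewrite mulr_gt0// pi_gt0.
have D2 : is_derive s 1 (fun s => ln (4 * pi * s)) (s^-1).
  move: q0; generalize (4 * pi : R) => q q0.
  have D := is_derive1_ln (mulr_gt0 q0 s0).
  have D1 : is_derive s 1 (fun s => q * s : R) q.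
    by apply: is_derive_eq; rewrite /GRing.scale/=; ring.
  have := @is_derive1_comp _ (@ln R) (fun s => q * s) s _ _ D D1.
  rewrite /comp => H; apply: is_derive_eq => //.
  by field; rewrite (gt_eqF s0) (gt_eqF q0).
have s4 : 4 * s != 0 by rewrite gt_eqF// mulr_gt0.
have D3 : is_derive s 1 (fun s => (4 * s)^-1) (- (4 * s ^+ 2)^-1).
  have D4 : is_derive s 1 (fun s => 4 * s : R) 4.
    by apply: is_derive_eq; rewrite /GRing.scale/=; ring.
  have D5 := is_deriveV s4 D4.
  by apply: is_derive_eq; rewrite /GRing.scale/=; field; rewrite gt_eqF.
rewrite (_ : (fun s => heat s z) =
    fun s => expR (- (ln (4 * pi * s) / 2)) * expR (- (z ^+ 2 * (4 * s)^-1))); last first.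
  by [].
apply: is_derive_eq; rewrite /heat /heat_peak /GRing.scale/=.
move: (expR (- (ln _ / 2))) => e1.
by field; rewrite gt_eqF.
Qed.

End HeatDerivatives.

Section Pairing.
Variable R : realType.
Implicit Types (s t x y z r : R).
Local Notation mu := (@lebesgue_measure R).

(* The time derivative is identified with the second space derivative. *)
Definition heat_data (v v1 v2 : R -> R -> R) : Prop :=
  [/\ forall t x : R, 0 < t -> is_derive t 1 (fun s => v s x) (v2 t x),
      forall t x : R, 0 < t -> is_derive x 1 (v t) (v1 t x),
      forall t x : R, 0 < t -> is_derive x 1 (v1 t) (v2 t x),
      forall p : R * R, 0 < p.1 -> {for p, continuous (fun q : R * R => v q.1 q.2)} &
      forall p : R * R, 0 < p.1 -> {for p, continuous (fun q : R * R => v2 q.1 q.2)}].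

Lemma classical_heat_data v : classical_heat v ->
  heat_data v (fun t => derive1 (v t)) (fun t => derive1 (derive1 (v t))).
Proof.
move=> [d c e]; split => [t x t0|t x t0|t x t0|p p0|p p0].
- have [d1 _ _] := d t x t0; apply: DeriveDef; first exact: d1.
  by rewrite -derive1E (e t x t0).
- by have [_ d1 _] := d t x t0; apply: DeriveDef; [exact: d1|rewrite -derive1E].
- by have [_ _ d1] := d t x t0; apply: DeriveDef; [exact: d1|rewrite -derive1E].
- by have [] := c p p0.
- by have [_ _ _] := c p p0.
Qed.

Lemma rect_bound (g : R * R -> R) (a b r : R) : 0 < a ->
  (forall p : R * R, 0 < p.1 -> {for p, continuous g}) ->
  exists2 C : R, 0 <= C &
    forall t y, a <= t <= b -> - r <= y <= r -> `|g (t, y)| <= C.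
Proof.
move=> a0 cg; pose K : set (R * R) := `[a, b] `*` `[- r, r].
have cK : compact K by apply: compact_setX; exact: segment_compact.
have cgK : {within K, continuous g}.
  apply: continuous_in_subspaceT => p; rewrite inE => -[/= p1 _].
  by apply: cg; move: p1; rewrite in_itv/= => /andP[ap _]; exact: lt_le_trans ap.
have /compact_bounded[M [Mr HM]] := continuous_compact cgK cK.
exists (`|M| + 1); first by rewrite addr_ge0.
move=> t y tab yr; apply: (HM (`|M| + 1)).
  by rewrite (le_lt_trans (ler_norm M))// ltrDl.
by exists (t, y) => //; split; rewrite /= in_itv.
Qed.

Lemma heat_peak_anti s0 s : 0 < s0 -> s0 <= s -> heat_peak s <= heat_peak s0.
Proof.
move=> s00 s0s; have p4 : 0 < 4 * pi :> R by rewrite mulr_gt0// pi_gt0.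
rewrite ler_expR lerN2 ler_pM2r// ler_ln ?posrE ?mulr_gt0 ?pi_gt0//.
  by rewrite ler_pM2l.
exact: lt_le_trans s0s.
Qed.

(** A polynomial cut-off, meant for the interval from -r to r only. It vanishes to second order at
    both ends, so that two integrations by parts leave no boundary term. *)
Definition cutoff r y : R := (1 - (y / r) ^+ 2) ^+ 2.
Definition cutoff1 r y : R := - (4 * (y / r ^+ 2)) * (1 - (y / r) ^+ 2).
Definition cutoff2 r y : R := (12 * (y / r) ^+ 2 - 4) / r ^+ 2.

Lemma is_derive_cutoff r y : 0 < r -> is_derive y 1 (cutoff r) (cutoff1 r y).
Proof.
move=> r0; rewrite (_ : cutoff r = fun y => (1 - (y / r) ^+ 2) ^+ 2)//.
apply: is_derive_eq; rewrite /cutoff1 /GRing.scale/=.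
by field; rewrite gt_eqF.
Qed.

Lemma is_derive_cutoff1 r y : 0 < r -> is_derive y 1 (cutoff1 r) (cutoff2 r y).
Proof.
move=> r0; rewrite (_ : cutoff1 r = fun y => - (4 * (y / r ^+ 2)) * (1 - (y / r) ^+ 2))//.
apply: is_derive_eq; rewrite /cutoff2 /GRing.scale/=.
by field; rewrite gt_eqF.
Qed.

Lemma cutoff_bounds r y : 1 <= r -> - r <= y <= r ->
  [/\ 0 <= cutoff r y <= 1, `|cutoff1 r y| <= 4 / r & `|cutoff2 r y| <= 12 / r].
Proof.
move=> r1 /andP[yr1 yr2]; have r0 : 0 < r by lra.
have u1 : -1 <= y / r <= 1.
  by rewrite ler_pdivlMr// ler_pdivrMr// mulN1r mul1r yr1.
have u2 : 0 <= (y / r) ^+ 2 <= 1.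
  by rewrite sqr_ge0/=; move: u1; set u := y / r => /andP[? ?]; nra.
split.
- rewrite /cutoff sqr_ge0/=; move: u2; set u := (y / r) ^+ 2 => /andP[? ?]; nra.
- rewrite /cutoff1 normrM (_ : - _ = (- (y / r) * 4) / r); last by field; rewrite gt_eqF.
  rewrite normrM (gtr0_norm (_ : 0 < r^-1)) ?invr_gt0// normrM normrN (@ger0_norm _ 4)//.
  have h1 : `|y / r| <= 1 by rewrite ler_norml.
  have h2 : `|1 - (y / r) ^+ 2| <= 1.
    by rewrite ger0_norm; move: u2 => /andP[? ?]; lra.
  rewrite mulrAC ler_wpM2r ?invr_ge0 ?(ltW r0)//.
  by have := ler_pM (normr_ge0 _) (normr_ge0 _) h1 h2; rewrite mulr1; lra.
- rewrite /cutoff2 normrM (gtr0_norm (_ : 0 < (r ^+ 2)^-1)) ?invr_gt0 ?exprn_gt0//.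
  apply: (@le_trans _ _ (12 * (r ^+ 2)^-1)).
    rewrite ler_wpM2r ?invr_ge0 ?exprn_ge0 ?(ltW r0)// ler_norml.
    by move: u2 => /andP[? ?]; lra.
  rewrite ler_wpM2l// lef_pV2 ?posrE ?exprn_gt0// expr2 ler_peMr//; lra.
Qed.

Lemma heat_yy_bound s0 s x y r : 0 < s0 -> s0 <= s -> - r <= y <= r ->
  `|heat s (x - y) * ((x - y) ^+ 2 / (4 * s ^+ 2) - (2 * s)^-1)| <=
  heat_peak s0 * ((`|x| + r) ^+ 2 / (4 * s0 ^+ 2) + (2 * s0)^-1).
Proof.
move=> s00 s0s yr; have s1 : 0 < s by lra.
have yr' : `|y| <= r by rewrite ler_norml.
rewrite (normrM (heat _ _)) ler_pM//.
  rewrite ger0_norm ?heat_ge0// (le_trans (heat_le_peak _ s1))//.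
  exact: heat_peak_anti.
rewrite (le_trans (ler_normB _ _))// lerD//.
  rewrite ger0_norm; last first.
    by apply: divr_ge0; [exact: sqr_ge0|rewrite pmulr_rge0// sqr_ge0].
  apply: ler_pM; [exact: sqr_ge0|by rewrite invr_ge0 pmulr_rge0// sqr_ge0| |].
    rewrite -(real_normK (num_real (x - y))) lerXn2r ?nnegrE ?addr_ge0//.
      exact: le_trans yr'.
    by rewrite (le_trans (ler_normB _ _))// lerD2l.
  by rewrite lef_pV2 ?posrE ?pmulr_rgt0 ?exprn_gt0// ler_pM2l// lerXn2r ?nnegrE// ltW.
rewrite ger0_norm; last by rewrite invr_ge0; lra.
by rewrite lef_pV2 ?posrE; lra.
Qed.

(** The weight comes from the bounds 12 / r and 4 / r on the derivatives of the cut-off, and is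
    squared because v will be split off by the inequality between arithmetic and geometric means. A
    factor u = z^2 / (4 s) is absorbed by exp(- u). *)
Lemma heat_weight_le s z : 0 < s ->
  heat s z * (12 + 4 * `|z| / s) ^+ 2 <= heat_peak s * (288 + 128 / s).
Proof.
move=> s0; rewrite /heat -mulrA ler_wpM2l ?expR_ge0//.
set u := z ^+ 2 / (4 * s).
have u0 : 0 <= u by rewrite divr_ge0 ?sqr_ge0// mulr_ge0// ltW.
have eu : expR (- u) * u <= 1.
  rewrite expRN mulrC ler_pdivrMr ?expR_gt0// mul1r.
  by have := expR_ge1Dx u; lra.
have e1 : expR (- u) <= 1 by rewrite -expR0 ler_expR oppr_le0.
have E : (12 + 4 * `|z| / s) ^+ 2 <= 288 + 128 / s * u.
  have -> : 128 / s * u = 32 * (`|z| / s) ^+ 2.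
    by rewrite /u -(real_normK (num_real z)); field; rewrite gt_eqF.
  rewrite -mulrA; set w := `|z| / s.
  by have := sqr_ge0 (12 - 4 * w); rewrite -subr_ge0 !expr2; lra.
apply: le_trans (ler_wpM2l (expR_ge0 _) E) _.
have s1 : 0 <= 128 / s by rewrite divr_ge0// ltW.
have -> : expR (- u) * (288 + 128 / s * u) = 288 * expR (- u) + 128 / s * (expR (- u) * u).
  by ring.
apply: lerD; first by lra.
by rewrite -[leRHS]mulr1 ler_wpM2l.
Qed.

Section Fixed.
Variables (v v1 v2 : R -> R -> R) (hv : heat_data v v1 v2).
Variables (t tau x r : R) (r1 : 1 <= r).

Let f s y := cutoff r y * (v (t + s) y * heat (tau - s) (x - y)).
Let heat_yy s z := heat s z * (z ^+ 2 / (4 * s ^+ 2) - (2 * s)^-1).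
Let df s y := cutoff r y * (v2 (t + s) y * heat (tau - s) (x - y) -
  v (t + s) y * heat_yy (tau - s) (x - y)).
(** What remains of [df] after moving both space derivatives from v to the cut-off kernel: as v and
    the backward kernel solve adjoint equations, only terms with a derivative on the cut-off
    survive. *)
Let err s y := v (t + s) y * (cutoff2 r y * heat (tau - s) (x - y) +
  2 * cutoff1 r y * (heat (tau - s) (x - y) * ((x - y) / (2 * (tau - s))))).

Let is_derive_f s y : - t < s -> s < tau -> is_derive s 1 (fun s => f s y) (df s y).
Proof.
move=> ts st; have [h1 _ _ _ _] := hv.
have ts0 : 0 < t + s by lra.
have st0 : 0 < tau - s by lra.
have D1 : is_derive s 1 (fun s => v (t + s) y) (v2 (t + s) y).
  have := @is_derive1_comp _ (fun s => v s y) (fun s => t + s) s _ _ (h1 _ y ts0).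
  have D : is_derive s 1 (fun s => t + s) 1 by apply: is_derive_eq; ring.
  by move=> /(_ _ D); rewrite mulr1.
have D2 : is_derive s 1 (fun s => heat (tau - s) (x - y)) (- heat_yy (tau - s) (x - y)).
  have := @is_derive1_comp _ (fun s => heat s (x - y)) (fun s => tau - s) s _ _
     (is_derive_heat_s (x - y) st0).
  have D : is_derive s 1 (fun s => tau - s) (- 1) by apply: is_derive_eq; ring.
  by move=> /(_ _ D); rewrite mulrN1.
by rewrite /f; apply: is_derive_eq; rewrite /df /GRing.scale/=; ring.
Qed.

Let cvy w (hw : forall p : R * R, 0 < p.1 -> {for p, continuous (fun q : R * R => w q.1 q.2)})
   s : 0 < s -> continuous (w s : R -> R).
Proof.
move=> s0 y; have /= := hw (s, y) s0; move=> c.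
apply: (cvg_comp (fun y : R => (s, y)) (fun q : R * R => w q.1 q.2) _ c).
exact: (@cvg_pair R R R (nbhs y) (nbhs s) (nbhs y) _ _ _ (fun=> s) id (cvg_cst s) cvg_id).
Qed.

Let derivable_cont (g : R -> R) (dg : R -> R) :
  (forall y : R, is_derive y 1 g (dg y)) -> continuous g.
Proof.
move=> h y; apply/differentiable_continuous/derivable1_diffP.
by have [] := h y.
Qed.

Let c_heat s : 0 < s -> continuous (fun y => heat s (x - y)).
Proof. by move=> s0; apply: derivable_cont => y; exact: is_derive_heat_y. Qed.

Let c_cutoff : continuous (cutoff r).
Proof. by apply: derivable_cont => y; apply: is_derive_cutoff; lra. Qed.

Let c_f s : - t < s -> s < tau -> continuous (f s).
Proof.
move=> ts st; have [_ _ _ cv _] := hv; move=> y.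
apply: cvgM; first exact: c_cutoff.
by apply: cvgM; [apply: (cvy cv); lra|apply: c_heat; lra].
Qed.

Let int_cont (g : R -> R) : continuous g -> mu.-integrable `[- r, r] (EFin \o g).
Proof.
move=> cg; apply: continuous_compact_integrable; first exact: segment_compact.
exact: continuous_subspaceT.
Qed.

Let F s := \int[mu]_(y in `[- r, r]) f s y.

Let is_derive_F s : - t < s -> s < tau ->
  is_derive s 1 F (\int[mu]_(y in `[- r, r]) df s y).
Proof.
move=> ts st; have [_ _ _ cv cv2] := hv.
(* Midpoints keep both t + c and tau - c away from 0 for c between a and b, so the time derivative
   has a constant bound there. *)
pose a := (- t + s) / 2; pose b := (s + tau) / 2.
have aI : a < s < b by rewrite /a /b; apply/andP; split; lra.
have sub c : a < c < b -> - t < c /\ c < tau by rewrite /a /b => /andP[? ?]; split; lra.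
have ta : 0 < t + a by rewrite /a; lra.
have [C1 C10 HC1] := rect_bound (t + b) r ta cv.
have [C2 C20 HC2] := rect_bound (t + b) r ta cv2.
pose s0 := tau - b; have s00 : 0 < s0 by rewrite /s0 /b; lra.
pose Z := (`|x| + r) ^+ 2 / (4 * s0 ^+ 2) + (2 * s0)^-1.
have Z0 : 0 <= Z.
  apply: addr_ge0; last by rewrite invr_ge0; lra.
  by apply: divr_ge0; [exact: sqr_ge0|rewrite pmulr_rge0// sqr_ge0].
pose C := C2 * heat_peak s0 + C1 * (heat_peak s0 * Z).
have Hder c y : a < c < b -> is_derive c 1 (fun s => f s y) (df c y).
  by move=> /sub[? ?]; exact: is_derive_f.
have peak c : a < c < b -> heat_peak (tau - c) <= heat_peak s0.
  by move=> /andP[? ?]; apply: heat_peak_anti => //; rewrite /s0; lra.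
have dE c y : a < c < b -> partial1of2 f c y = df c y.
  by move=> cI; rewrite partial1of2E; have [_] := Hder c y cI.
have derF := @derivable_under_integral R _ _ mu f `[- r, r] _ s a b.
have derFE := @differentiation_under_integral R _ _ mu f `[- r, r] _ s a b.
have A1 : `]a, b[%classic s by rewrite /= in_itv.
have A2 c : `]a, b[%classic c -> mu.-integrable `[- r, r] (EFin \o f c).
  rewrite /= in_itv/= => /sub[? ?]; exact/int_cont/c_f.
have A3 c y : `]a, b[%classic c -> `[- r, r]%classic y -> derivable (f ^~ y) c 1.
  by rewrite /= in_itv/= => cI _; have [] := Hder c y cI.
have A4 : forall y : R, 0 <= (fun=> C) y.
  move=> y; rewrite addr_ge0 ?mulr_ge0//; exact/ltW/heat_peak_gt0.
have A5 : mu.-integrable `[- r, r] (EFin \o (fun=> C)).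
  by apply: int_cont => y; exact: cvg_cst.
have A6 c y : `]a, b[%classic c -> `[- r, r]%classic y -> `|partial1of2 f c y| <= C.
  rewrite /= !in_itv/= => cI yI; rewrite dE//.
  have /andP[ca cb] := cI.
  have tc : t + a <= t + c <= t + b by rewrite !lerD2l !ltW.
  have h1 := HC1 _ _ tc yI; have h2 := HC2 _ _ tc yI.
  have [/andP[p0 p1] _ _] := cutoff_bounds r1 yI.
  rewrite /df normrM (ger0_norm p0) (le_trans (ler_wpM2r (normr_ge0 _) p1))// mul1r.
  rewrite (le_trans (ler_normB _ _))// /C !(normrM (v2 _ _)) !(normrM (v _ _)).
  have k0 := heat_ge0 (tau - c) (x - y).
  have k1 : heat (tau - c) (x - y) <= heat_peak s0.
    apply: le_trans (heat_le_peak _ _) (peak _ cI).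
    by rewrite subr_gt0; have [] := sub _ cI.
  apply: lerD.
    by apply: ler_pM => //; rewrite ger0_norm.
  have sc : s0 <= tau - c by rewrite lerD2l lerN2 ltW.
  by apply: ler_pM => //; exact: (heat_yy_bound x s00 sc yI).
have dfE : \int[mu]_(y in `[- r, r]) df s y =
    \int[mu]_(y in `[- r, r]) (partial1of2 f s y).
  by apply: eq_Rintegral => y _; rewrite dE.
apply: DeriveDef.
  exact: (derF _ A1 A2 A3 _ A4 A5 A6).
by rewrite -derive1E [RHS]dfE; exact: (derFE _ A1 A2 A3 _ A4 A5 A6).
Qed.

(** The Green bracket of v and the cut-off kernel, a primitive of [df - err]. It vanishes at both
    ends together with the cut-off and its derivative. *)
Let H s y := cutoff r y * heat (tau - s) (x - y) * v1 (t + s) y -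
  (cutoff1 r y * heat (tau - s) (x - y) +
   cutoff r y * (heat (tau - s) (x - y) * ((x - y) / (2 * (tau - s))))) * v (t + s) y.

Let is_derive_H s y : - t < s -> s < tau -> is_derive y 1 (H s) (df s y - err s y).
Proof.
move=> ts st; have [_ h1 h2 _ _] := hv.
have ts0 : 0 < t + s by rewrite -ltrBlDl sub0r.
have st0 : 0 < tau - s by rewrite subr_gt0.
have r0 : 0 < r by exact: lt_le_trans r1.
have D1 := h1 _ y ts0; have D2 := h2 _ y ts0.
have D3 := is_derive_heat_y x y st0; have D4 := is_derive_heat_yy x y st0.
have D5 := is_derive_cutoff y r0; have D6 := is_derive_cutoff1 y r0.
rewrite /H; apply: is_derive_eq; rewrite /df /err /heat_yy /GRing.scale/=.
ring.
Qed.

Let c_df s : - t < s -> s < tau -> continuous (df s).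
Proof.
move=> ts st; have [_ _ _ cv cv2] := hv.
have ts0 : 0 < t + s by rewrite -ltrBlDl sub0r.
have st0 : 0 < tau - s by rewrite subr_gt0.
move=> y; apply: cvgM; first exact: c_cutoff.
apply: cvgB; first by apply: cvgM; [exact: (cvy cv2)|exact: c_heat].
apply: cvgM; first exact: (cvy cv).
apply: cvgM; first exact: c_heat.
apply: cvgB; last exact: cvg_cst.
apply: cvgM; last exact: cvg_cst.
apply: (cvg_comp (fun y => x - y) (fun z => z ^+ 2)); last exact: exprn_continuous.
by apply: cvgB; [exact: cvg_cst|exact: cvg_id].
Qed.

Let c_err s : - t < s -> s < tau -> continuous (err s).
Proof.
move=> ts st; have [_ _ _ cv cv2] := hv.
have ts0 : 0 < t + s by rewrite -ltrBlDl sub0r.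
have st0 : 0 < tau - s by rewrite subr_gt0.
have r0 : 0 < r by exact: lt_le_trans r1.
have c1 : continuous (cutoff1 r).
  by apply: derivable_cont => y; exact: is_derive_cutoff1.
have c2 : continuous (cutoff2 r).
  move=> y; apply: cvgM; last exact: cvg_cst.
  apply: cvgB; last exact: cvg_cst.
  apply: cvgM; first exact: cvg_cst.
  apply: (cvg_comp (fun y => y / r) (fun z => z ^+ 2)); last exact: exprn_continuous.
  by apply: cvgM; [exact: cvg_id|exact: cvg_cst].
have ch1 : continuous (fun y => heat (tau - s) (x - y) * ((x - y) / (2 * (tau - s)))).
  by apply: derivable_cont => y; exact: is_derive_heat_yy.
move=> y; apply: cvgM; first exact: (cvy cv).
apply: cvgD; first by apply: cvgM; [exact: c2|exact: c_heat].
by apply: cvgM; [apply: cvgM; [exact: cvg_cst|exact: c1]|exact: ch1].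
Qed.

Let int_df s : - t < s -> s < tau ->
  \int[mu]_(y in `[- r, r]) df s y = \int[mu]_(y in `[- r, r]) err s y.
Proof.
move=> ts st; apply/eqP; rewrite -subr_eq0; apply/eqP.
have r0 : 0 < r by exact: lt_le_trans r1.
rewrite -RintegralB//; [|exact/int_cont/c_df|exact/int_cont/c_err].
have rr : - r < r by rewrite -subr_gt0 opprK addr_gt0.
have dH y := is_derive_H y ts st.
rewrite /Rintegral (@continuous_FTC2 R _ (H s) _ _ rr).
- have E y : (y / r) ^+ 2 = 1 -> H s y = 0.
    by move=> yr; rewrite /H /cutoff /cutoff1 yr subrr expr0n/= !mulr0 !mul0r addr0 mul0r subr0.
  rewrite !E ?subee//.
    by rewrite mulNr divff ?gt_eqF// sqrrN expr1n.
  by rewrite divff ?gt_eqF// expr1n.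
- apply: continuous_subspaceT => y; apply: cvgB; [exact: c_df|exact: c_err].
- have cH := derivable_cont dH.
  split.
  + by move=> y _; have [] := dH y.
  + by apply: cvg_at_right_filter; exact: cH.
  + by apply: cvg_at_left_filter; exact: cH.
- by move=> y _; have [_ <-] := dH y; rewrite derive1E.
Qed.

Let err_le s y : - t < s -> s < tau -> - r <= y <= r -> `|err s y| <=
  r^-1 * (v (t + s) y ^+ 2 + heat_peak (tau - s) * (288 + 128 / (tau - s)) *
    heat (tau - s) (x - y)).
Proof.
move=> ts st yr.
have st0 : 0 < tau - s by rewrite subr_gt0.
have r0 : 0 < r by exact: lt_le_trans r1.
have [_ b1 b2] := cutoff_bounds r1 yr.
have W := heat_weight_le (x - y) st0.
rewrite /err; move: (tau - s) (v (t + s) y) (x - y) st0 W {ts st} => {}s w z s0 W.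
move: b1 b2; move: (cutoff1 r y) (cutoff2 r y) => c1 c2 b1 b2.
have k0 := heat_ge0 s z; move: (heat s z) k0 W => k k0.
set C := heat_peak s * _ => W.
have zs : 0 <= `|z| / s by rewrite divr_ge0// ltW.
have B : `|c2 * k + 2 * c1 * (k * (z / (2 * s)))| <= r^-1 * (k * (12 + 4 * `|z| / s)).
  rewrite (le_trans (ler_normD _ _))//.
  have -> : r^-1 * (k * (12 + 4 * `|z| / s)) =
     12 / r * k + 4 / r * (k * (`|z| / s)) by ring.
  apply: lerD; first by rewrite normrM (ger0_norm k0) ler_wpM2r.
  rewrite (_ : 2 * c1 * _ = c1 * (k * (z / s))); last by field; rewrite gt_eqF.
  rewrite !normrM normfV (gtr0_norm s0) (ger0_norm k0) ler_wpM2r//.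
  by rewrite mulr_ge0.
rewrite normrM; apply: le_trans (ler_wpM2l (normr_ge0 _) B) _.
rewrite mulrCA ler_wpM2l ?invr_ge0 ?(ltW r0)//.
set p := 12 + _ in W *.
have p0 : 0 <= p by rewrite /p -mulrA; lra.
apply: (@le_trans _ _ (w ^+ 2 + (k * p) ^+ 2)).
  rewrite -(real_normK (num_real w)).
  have := sqr_ge0 (`|w| - k * p); have := mulr_ge0 (normr_ge0 w) (mulr_ge0 k0 p0).
  by move: `|w| (k * p) => a b; rewrite sqrrB -mulr_natr; lra.
rewrite lerD2l (_ : (k * p) ^+ 2 = k * p ^+ 2 * k); last by ring.
by rewrite ler_wpM2r.
Qed.

(** The bound decays like 1 / r and involves v only through its L2 norm: no growth condition on v or
    on its derivatives enters. *)
Lemma pairing_derive_le s : - t < s -> s < tau -> L2 (v (t + s)) ->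
  exists2 dF : R, is_derive s 1 F dF &
    `|dF| <= r^-1 * (sqn (v (t + s)) + heat_peak (tau - s) * (288 + 128 / (tau - s))).
Proof.
move=> ts st Lv; have [mv Iv] := Lv.
exists (\int[mu]_(y in `[- r, r]) df s y); first exact: is_derive_F.
have st0 : 0 < tau - s by rewrite subr_gt0.
have r0 : 0 < r by exact: lt_le_trans r1.
rewrite int_df//.
have Ierr := int_cont (c_err ts st).
apply: le_trans (le_normr_Rintegral _ Ierr) _ => //.
set C := heat_peak _ * _.
pose G y := r^-1 * (v (t + s) y ^+ 2 + C * heat (tau - s) (x - y)).
have C0 : 0 <= C.
  apply: mulr_ge0; first exact: expR_ge0.
  by apply: addr_ge0; [exact: ler0n|apply: divr_ge0; [exact: ler0n|exact: ltW]].
have G0 y : 0 <= G y.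
  by rewrite mulr_ge0 ?invr_ge0 ?(ltW r0)// addr_ge0 ?sqr_ge0// mulr_ge0 ?heat_ge0.
have Ih := integrable_heat x st0.
have ICh : mu.-integrable setT (EFin \o (fun y => C * heat (tau - s) (x - y))).
  exact: (@integrableZl _ _ _ _ _ _ C _ Ih).
have I1 : mu.-integrable setT (EFin \o (fun y => v (t + s) y ^+ 2 + C * heat (tau - s) (x - y))).
  exact: (@integrableD _ _ _ _ _ _ _ _ Iv ICh).
have IG : mu.-integrable setT (EFin \o G).
  exact: (@integrableZl _ _ _ _ _ _ r^-1 _ I1).
have EG : \int[mu]_y G y = r^-1 * (sqn (v (t + s)) + C).
  rewrite (RintegralZl r^-1 measurableT I1) (RintegralD measurableT Iv ICh).
  by rewrite (RintegralZl C measurableT Ih) Rintegral_heat// mulr1.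
rewrite -EG.
have IG' : mu.-integrable `[- r, r] (EFin \o G).
  by apply: integrableS IG.
apply: (@le_trans _ _ (\int[mu]_(y in `[- r, r]) G y)).
  apply: le_Rintegral => //.
    exact: integrable_norm.
  by move=> y; rewrite /= in_itv/= => yr; exact: err_le.
rewrite -lee_fin /Rintegral !fineK; [|exact: integrable_fin_num|exact: integrable_fin_num].
apply: ge0_subset_integral => //.
  by have /integrableP[] := IG.
by move=> y _; rewrite lee_fin.
Qed.

End Fixed.
End Pairing.

Section PairingConst.
Variable R : realType.
Implicit Types (s t x y z r : R).
Local Notation mu := (@lebesgue_measure R).

Lemma cutoff_integral_cvg (g : R -> R) : measurable_fun setT g ->
  mu.-integrable setT (EFin \o g) ->
  \int[mu]_(y in `[- n.+1%:R, n.+1%:R]) (cutoff n.+1%:R y * g y) @[n --> \oo] -->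
  \int[mu]_y g y.
Proof.
move=> mg Ig.
pose f (n : nat) := (fun y => cutoff n.+1%:R y * g y) \_ (`[- n.+1%:R, n.+1%:R]%classic : set R).
have fE n : \int[mu]_(y in `[- n.+1%:R, n.+1%:R]) (cutoff n.+1%:R y * g y) = \int[mu]_y f n y.
  by rewrite Rintegral_mkcond.
under eq_fun do rewrite fE.
have mf n : measurable_fun setT (f n).
  apply: (measurable_restrictT _ _).1 => //; apply: measurable_funTS.
  apply: measurable_funM => //; apply: continuous_measurable_fun => y.
  have n0 : 0 < n.+1%:R :> R by rewrite ltr0n.
  apply/differentiable_continuous/derivable1_diffP.
  by have [] := is_derive_cutoff y n0.
have fg n y : `|f n y| <= `|g y|.
  rewrite /f patchE; case: ifPn => [|_]; last by rewrite normr0.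
  rewrite inE/= in_itv/= => yn.
  have n1 : 1 <= n.+1%:R :> R by rewrite ler1n.
  have [/andP[c0 c1] _ _] := cutoff_bounds n1 yn.
  by rewrite normrM ger0_norm// ler_piMl.
have fcvg y : f n y @[n --> \oo] --> g y.
  rewrite -[X in _ --> X]mul1r.
  have h0 : (y / n.+1%:R) @[n --> \oo] --> (0 : R).
    rewrite -[X in _ --> X](mulr0 y); apply: cvgM; first exact: cvg_cst.
    exact: cvg_harmonic.
  have h1 : cutoff n.+1%:R y * g y @[n --> \oo] --> 1 * g y.
    apply: cvgM; last exact: cvg_cst.
    rewrite [X in _ --> X](_ : _ = (1 - 0 ^+ 2) ^+ 2); last first.
      by rewrite expr0n/= subr0 expr1n.
    apply: (cvg_comp (fun n => y / n.+1%:R) (fun z => (1 - z ^+ 2) ^+ 2) h0).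
    have D : is_derive (0 : R) 1 (fun z : R => (1 - z ^+ 2) ^+ 2) 0.
      by apply: is_derive_eq; rewrite /GRing.scale/=; ring.
    have [dD _] := D.
    have H : {for (0 : R), continuous (fun z : R => (1 - z ^+ 2) ^+ 2)}.
      exact/differentiable_continuous/derivable1_diffP.
    exact: H.
  apply: cvg_trans h1; apply: near_eq_cvg.
  near=> n; rewrite /f patchE ifT// inE/= in_itv/= -ler_norml.
  apply: (@le_trans _ _ n%:R); last by rewrite ler_nat.
  by near: n; exact: nbhs_infty_ger.
have mf' n : measurable_fun setT (EFin \o f n) by exact/measurable_EFinP.
have mg' : measurable_fun setT (EFin \o g) by exact/measurable_EFinP.
have fcvg' : {ae mu, forall y, [set: R] y -> (EFin \o f n) y @[n --> \oo] --> (EFin \o g) y}.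
  by apply: aeW => y _; apply: cvg_EFin; [exact: nearW|exact: fcvg].
have fg' : {ae mu, forall y n, [set: R] y -> (`|(EFin \o f n) y| <= (EFin \o (fun y => `|g y|)%R) y)%E}.
  by apply: aeW => y n _; rewrite lee_fin.
have [_ _ H] := @dominated_convergence _ _ R mu setT measurableT
   (fun n => EFin \o f n) _ _ mf' mg' fcvg' (integrable_norm Ig) fg'.
by apply: fine_cvg; rewrite /Rintegral fineK//; exact: integrable_fin_num.
Unshelve. all: by end_near.
Qed.

(** By the mean value theorem the cut-off pairing varies by at most s C / r between times 0 and s;
    then r tends to infinity through the positive integers. *)
Lemma pairing_const (v v1 v2 : R -> R -> R) t tau x s M :
  heat_data v v1 v2 -> 0 < t -> 0 <= s -> s < tau ->
  (forall s', 0 <= s' <= s -> L2 (v (t + s')) /\ sqn (v (t + s')) <= M) ->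
  \int[mu]_y (v (t + s) y * heat (tau - s) (x - y)) =
  \int[mu]_y (v t y * heat tau (x - y)).
Proof.
move=> hv t0 s0 st HM.
have [->|sn0] := eqVneq s 0; first by rewrite addr0 subr0.
have sp : 0 < s by rewrite lt_def sn0.
pose f r c y := cutoff r y * (v (t + c) y * heat (tau - c) (x - y)).
pose F r c := \int[mu]_(y in `[- r, r]) f r c y.
pose C := M + heat_peak (tau - s) * (288 + 128 / (tau - s)).
have ts0 : 0 < tau - s by rewrite subr_gt0.
have HF (n : nat) : `|F n.+1%:R s - F n.+1%:R 0| <= s * C * n.+1%:R^-1.
  have r1 : 1 <= n.+1%:R :> R by rewrite ler1n.
  have dF c : 0 <= c <= s -> exists2 dF : R, is_derive c 1 (F n.+1%:R) dF &
      `|dF| <= n.+1%:R^-1 * C.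
    move=> /[dup] cs /andP[c0 cs']; have [Lc sc] := HM c cs.
    have tc : - t < c by lra.
    have ct : c < tau by lra.
    have [d Hd dle] := pairing_derive_le hv x r1 tc ct Lc.
    exists d => //; apply: le_trans dle _.
    rewrite ler_wpM2l ?invr_ge0// lerD//.
    have h1 : tau - s <= tau - c by lra.
    apply: ler_pM; [exact: expR_ge0| |exact: heat_peak_anti|].
      apply: addr_ge0; first exact: ler0n.
      by apply: divr_ge0; [exact: ler0n|rewrite subr_ge0; exact: ltW].
    by rewrite lerD2l ler_wpM2l// lef_pV2 ?posrE//; lra.
  have dF' c : 0 <= c <= s -> derivable (F n.+1%:R) c 1 by move=> /dF[d []].
  have [c||c] := @MVT R (F n.+1%:R) (fun c => derive1 (F n.+1%:R) c) 0 s sp.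
  - rewrite in_itv/= => /andP[c0 cs].
    apply: DeriveDef; last by rewrite derive1E.
    by apply: dF'; rewrite !ltW.
  - apply: derivable_within_continuous => c; rewrite in_itv/=; exact: dF'.
  rewrite in_itv/= => /andP[c0 cs] ->.
  have [|d Hd dle] := dF c; first by rewrite !ltW.
  rewrite derive1E; have [_ ->] := Hd.
  by rewrite normrM subr0 (gtr0_norm sp) mulrC -mulrA ler_wpM2l// mulrC.
have cvF c : 0 <= c <= s -> F n.+1%:R c @[n --> \oo] -->
    \int[mu]_y (v (t + c) y * heat (tau - c) (x - y)).
  move=> /[dup] cs /andP[c0 cs']; have [Lc _] := HM c cs.
  have tc0 : 0 < tau - c by lra.
  have Lh := L2_heat x tc0.
  apply: cutoff_integral_cvg; last exact: integrable_mulL2.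
  by apply: measurable_funM; [case: Lc|case: Lh].
have cs : 0 <= s <= s by apply/andP.
have c0 : 0 <= (0 : R) <= s by rewrite lexx s0.
have := cvF _ c0; rewrite addr0 subr0 => cv0.
have cvs := cvF _ cs.
apply/eqP; rewrite -subr_eq0; apply/eqP.
set A := \int[mu]_y _; set B := \int[mu]_y _.
have c1 : F n.+1%:R s - F n.+1%:R 0 @[n --> \oo] --> A - B.
  by apply: cvgB; [exact: cvs|exact: cv0].
have c2 : F n.+1%:R s - F n.+1%:R 0 @[n --> \oo] --> (0 : R).
  apply: norm_cvg0.
  have c3 : s * C * n.+1%:R^-1 @[n --> \oo] --> (0 : R).
    rewrite -[X in _ --> X](mulr0 (s * C)); apply: cvgM; first exact: cvg_cst.
    exact: cvg_harmonic.
  apply: (squeeze_cvgr _ (cvg_cst (0 : R)) c3).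
  by apply: nearW => n; rewrite normr_ge0 HF.
have l1 := cvg_lim (@Rhausdorff R) c1.
have l2 := cvg_lim (@Rhausdorff R) c2.
by rewrite -l1 -[RHS]l2.
Qed.

End PairingConst.

Section Representation.
Variable R : realType.
Implicit Types (s t x y z r : R).
Local Notation mu := (@lebesgue_measure R).

Lemma heat_peak_half s : 0 < s -> heat_peak s <= 2 * heat_peak (2 * s).
Proof.
move=> s0; rewrite /heat_peak.
have q0 : 0 < 4 * pi * s :> R by rewrite !mulr_gt0// pi_gt0.
rewrite (_ : 4 * pi * (2 * s) = 2 * (4 * pi * s)); last by ring.
move: (4 * pi * s) q0 => q q0.
have E : ln (2 * q) = ln 2 + ln q by rewrite lnM ?posrE.
rewrite E (_ : - ((ln 2 + ln q) / 2) = - (ln 2 / 2) + - (ln q / 2)); last by ring.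
rewrite expRD mulrA ler_peMl ?expR_ge0//.
rewrite expRN ler_pdivlMr ?expR_gt0// mul1r.
rewrite -ler_ln ?posrE ?expR_gt0// expRK ler_pdivrMr//.
have : 0 <= ln (2 : R) by rewrite ln_ge0//; lra.
by lra.
Qed.

Lemma heat_peak_le s : 0 < s -> s * heat_peak s <= s + 1.
Proof.
move=> s0; rewrite /heat_peak.
have q0 : 0 < 4 * pi * s :> R by rewrite !mulr_gt0// pi_gt0.
have sq : s <= 4 * pi * s.
  by rewrite ler_peMl ?(ltW s0)//; have := pi_ge2 R; lra.
move: (4 * pi * s) q0 sq => q q0 sq.
suff : expR (- (ln q / 2)) <= 1 + q^-1.
  move=> /(ler_wpM2l (ltW s0)) /le_trans; apply.
  by rewrite mulrDr mulr1 lerD2l ler_pdivrMr// mul1r.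
have [q1|q1] := leP 1 q.
  rewrite (@le_trans _ _ 1) ?lerDl ?invr_ge0 ?(ltW q0)//.
  by rewrite -[leRHS]expR0 ler_expR oppr_le0 divr_ge0// ln_ge0.
apply: (@le_trans _ _ q^-1); last by rewrite lerDr.
rewrite -[leRHS]lnK ?posrE ?invr_gt0// ler_expR lnV ?posrE//.
have : ln q <= 0 by rewrite ln_le0// ltW.
by lra.
Qed.

(** Half of the exponent is bounded by exp(- u) <= 2 / u^2 with u = d^2 / (8 s); the other half is
    the Gaussian at time 2 s. One factor s will compensate the peak of the kernel, the other makes
    the tail vanish as s tends to 0. *)
Lemma heat_tail s z d : 0 < s -> 0 < d -> d <= `|z| ->
  heat s z <= 256 * s ^+ 2 / d ^+ 4 * heat (2 * s) z.
Proof.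
move=> s0 d0 dz.
have s80 : 0 < 8 * s by rewrite mulr_gt0.
have E : expR (- (z ^+ 2 / (4 * s))) =
    expR (- (z ^+ 2 / (8 * s))) * expR (- (z ^+ 2 / (4 * (2 * s)))).
  by rewrite -expRD; congr expR; field; rewrite gt_eqF.
rewrite /heat E.
have dz2 : d ^+ 2 <= z ^+ 2.
  by rewrite -(real_normK (num_real z)) lerXn2r ?nnegrE// ltW.
set u := d ^+ 2 / (8 * s).
have u0 : 0 < u by rewrite divr_gt0 ?exprn_gt0.
have e1 : expR (- (z ^+ 2 / (8 * s))) <= 2 / u ^+ 2.
  apply: (@le_trans _ _ (expR (- u))).
    by rewrite ler_expR lerN2 ler_wpM2r// invr_ge0 ltW.
  rewrite expRN -[2 / _]invrK lef_pV2 ?posrE ?expR_gt0 ?invr_gt0 ?divr_gt0 ?exprn_gt0//.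
  rewrite invf_div; have := expR_ge1Dxn 1 (ltW u0).
  by rewrite (_ : 2`!%:R = 2 :> R)//; lra.
rewrite (_ : 256 * s ^+ 2 / d ^+ 4 = 2 * (2 / u ^+ 2)); last first.
  by rewrite /u; field; rewrite !gt_eqF.
set e2 := expR (- (z ^+ 2 / (4 * (2 * s)))).
have -> : 2 * (2 / u ^+ 2) * (heat_peak (2 * s) * e2) =
  2 * heat_peak (2 * s) * (2 / u ^+ 2) * e2 by ring.
rewrite mulrA ler_wpM2r ?expR_ge0// ler_pM ?expR_ge0//.
exact: heat_peak_half.
Qed.

(** The constant pairing is evaluated at time tau - s with s small, where the kernel concentrates at
    x. Points y near x are handled by joint continuity of v, the others by [heat_tail] and the
    uniform L2 bound. *)
Lemma heat_repr (v v1 v2 : R -> R -> R) t tau x M :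
  heat_data v v1 v2 -> 0 < t -> 0 < tau ->
  (forall s, 0 <= s <= tau -> L2 (v (t + s)) /\ sqn (v (t + s)) <= M) ->
  v (t + tau) x = heat_conv tau (v t) x.
Proof.
move=> hv t0 tau0 HM; set c := v (t + tau) x.
apply/eqP; rewrite eq_sym -subr_eq0 -normr_le0; apply/eqP/eqP.
have M0 : 0 <= M.
  have /HM[_] : 0 <= (0 : R) <= tau by rewrite lexx ltW.
  exact/le_trans/sqn_ge0.
apply/ler_addgt0Pr => e e0; rewrite add0r.
have [_ _ _ cv _] := hv.
have tt0 : 0 < t + tau by rewrite addr_gt0.
have e20 : 0 < e / 2 by rewrite divr_gt0.
have /cvgrPdist_le/(_ _ e20) := cv (t + tau, x) tt0.
rewrite -nbhs_ballE => -[d /= d0 Hd].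
pose K := 256 / d ^+ 4 * (M + `|c| + 4).
have K0 : 0 < K.
  apply: mulr_gt0.
    by apply: divr_gt0; [rewrite ltr0n|exact: exprn_gt0].
  by rewrite ltr_wpDl// addr_ge0.
have [s [s0 sd stau s1 sK]] : exists s, [/\ 0 < s, s < d, s <= tau, s <= 1 & s * K <= e / 2].
  exists (Num.min (Num.min (d / 2) tau) (Num.min 1 (e / 2 / K))).
  rewrite !lt_min !ge_min !divr_gt0// tau0 ltr01.
  split => //.
  - by rewrite !gt_min; apply/orP; left; apply/orP; left; rewrite ltr_pdivrMr// ltr_pMr// ltr1n.
  - by rewrite lexx orbT.
  - by rewrite lexx orbT.
  - by rewrite -ler_pdivlMr// !ge_min lexx !orbT.
have ts0 : 0 <= tau - s by rewrite subr_ge0.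
have ts1 : tau - s < tau by rewrite ltrBlDr ltrDl.
have HM' s' : 0 <= s' <= tau - s -> L2 (v (t + s')) /\ sqn (v (t + s')) <= M.
  by move=> /andP[a b]; apply: HM; rewrite a (le_trans b)// ltW.
have PC := pairing_const x hv t0 ts0 ts1 HM'.
rewrite (_ : tau - (tau - s) = s) in PC; last by ring.
set w := v (t + (tau - s)) in PC.
have [Lw sw] : L2 w /\ sqn w <= M by apply: HM'; rewrite ts0 lexx.
have -> : heat_conv tau (v t) x = \int[mu]_y (heat s (x - y) * w y).
  rewrite /heat_conv; under eq_Rintegral do rewrite mulrC.
  by rewrite -PC; apply: eq_Rintegral => y _; rewrite mulrC.
have Ih := integrable_heat x s0.
have Ich : mu.-integrable setT (EFin \o (fun y => c * heat s (x - y))).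
  exact: (@integrableZl _ _ _ _ _ _ c _ Ih).
have Ihw := integrable_heatL2 x s0 Lw.
have -> : \int[mu]_y (heat s (x - y) * w y) - c =
    \int[mu]_y (heat s (x - y) * w y - c * heat s (x - y)).
  by rewrite RintegralB// (RintegralZl c measurableT Ih) Rintegral_heat// mulr1.
have s20 : 0 < 2 * s by rewrite mulr_gt0.
pose k := 256 * s ^+ 2 / d ^+ 4.
have k0 : 0 <= k.
  apply: divr_ge0; last exact: exprn_ge0 (ltW d0).
  by apply: mulr_ge0; [exact: ler0n|exact: sqr_ge0].
have I2 := integrable_heat x s20.
have [mw Iw] := Lw.
pose a := k * (`|c| + heat_peak (2 * s)).
(* The first term serves near x. The others serve away from x, through |w| h <= w^2 + h^2 and h^2 <=
   heat_peak (2 s) h, where h is the kernel at time 2 s. *)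
pose G y := e / 2 * heat s (x - y) + (k * w y ^+ 2 + a * heat (2 * s) (x - y)).
have J1 : mu.-integrable setT (EFin \o (fun y => e / 2 * heat s (x - y))).
  exact: (@integrableZl _ _ _ _ _ _ (e / 2) _ Ih).
have J2 : mu.-integrable setT (EFin \o (fun y => k * w y ^+ 2)).
  exact: (@integrableZl _ _ _ _ _ _ k _ Iw).
have J3 : mu.-integrable setT (EFin \o (fun y => a * heat (2 * s) (x - y))).
  exact: (@integrableZl _ _ _ _ _ _ a _ I2).
have J4 : mu.-integrable setT (EFin \o (fun y => k * w y ^+ 2 + a * heat (2 * s) (x - y))).
  exact: (@integrableD _ _ _ _ _ _ _ _ J2 J3).
have IG : mu.-integrable setT (EFin \o G).
  exact: (@integrableD _ _ _ _ _ _ _ _ J1 J4).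
have Idiff : mu.-integrable setT (EFin \o (fun y => heat s (x - y) * w y - c * heat s (x - y))).
  exact: (@integrableB _ _ _ _ _ _ _ _ Ihw Ich).
have GE : \int[mu]_y G y = e / 2 + (k * sqn w + a).
  rewrite (RintegralD measurableT J1 J4) (RintegralD measurableT J2 J3).
  rewrite (RintegralZl (e / 2) measurableT Ih) (RintegralZl k measurableT Iw).
  by rewrite (RintegralZl a measurableT I2) !Rintegral_heat// !mulr1.
apply: le_trans (le_normr_Rintegral _ Idiff) _ => //.
apply: (@le_trans _ _ (\int[mu]_y G y)).
  apply: le_Rintegral => //; first exact: integrable_norm.
  move=> y _; rewrite (_ : _ - _ = heat s (x - y) * (w y - c)); last by ring.
  rewrite normrM (ger0_norm (heat_ge0 _ _)) /G.
  have r0 : 0 <= k * w y ^+ 2 + a * heat (2 * s) (x - y).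
    have a0 : 0 <= a by rewrite mulr_ge0// addr_ge0// expR_ge0.
    by apply: addr_ge0; apply: mulr_ge0 => //; [exact: sqr_ge0|exact: heat_ge0].
  have [xyd|xyd] := ltP `|x - y| d.
    rewrite (le_trans (_ : _ <= e / 2 * heat s (x - y)))// ?lerDl// mulrC.
    rewrite ler_wpM2r ?heat_ge0// distrC.
    apply: (Hd (t + (tau - s), y)); split => //=.
    rewrite /ball /= (_ : t + tau - (t + (tau - s)) = s); last by ring.
    by rewrite gtr0_norm.
  have l0 : 0 <= e / 2 * heat s (x - y) by rewrite mulr_ge0 ?heat_ge0// ltW.
  rewrite (le_trans (_ : _ <= k * w y ^+ 2 + a * heat (2 * s) (x - y)))// ?lerDr//.
  apply: (@le_trans _ _ (k * heat (2 * s) (x - y) * (`|w y| + `|c|))).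
    by apply: ler_pM; rewrite ?heat_ge0 ?normr_ge0 ?ler_normB// heat_tail.
  have h0 := heat_ge0 (2 * s) (x - y); have hp := heat_le_peak (x - y) s20.
  rewrite -mulrA /a -mulrA -mulrDr ler_wpM2l//.
  have hh := ler_wpM2r h0 hp.
  move: h0 hh; move: (heat (2 * s) (x - y)) (heat_peak (2 * s)) => h p h0 hh.
  rewrite -(real_normK (num_real (w y))).
  have := sqr_ge0 (`|w y| - h); have := mulr_ge0 (normr_ge0 (w y)) h0.
  by move: `|w y| `|c| => b n; rewrite sqrrB -mulr_natr expr2 -expr2 => ? ?; lra.
rewrite GE; suff : k * sqn w + a <= e / 2 by lra.
apply: le_trans sK; rewrite /a -mulrDr /k /K.
have -> : s * (256 / d ^+ 4 * (M + `|c| + 4)) =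
   256 * s / d ^+ 4 * (M + `|c| + 4) by ring.
have -> : 256 * s ^+ 2 / d ^+ 4 * (sqn w + (`|c| + heat_peak (2 * s))) =
  256 * s / d ^+ 4 * (s * (sqn w + (`|c| + heat_peak (2 * s)))) by ring.
apply: ler_wpM2l.
  apply: divr_ge0; last exact: exprn_ge0 (ltW d0).
  by apply: mulr_ge0; [exact: ler0n|exact: ltW].
have hp := heat_peak_le s20.
have hq : s * sqn w <= M.
  by apply: le_trans sw; rewrite ler_piMl ?sqn_ge0.
have hc : s * `|c| <= `|c| by rewrite ler_piMl.
clear - hp hq hc s1 s0; rewrite !mulrDr; lra.
Qed.

End Representation.

(** * The heat flow *)

Section HeatFlow.
Variable R : realType.
Implicit Types (s t x y z r : R).
Local Notation mu := (@lebesgue_measure R).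

(** All that the interpolation and the dichotomy use of the equation: square integrability and the
    semigroup law at positive times. *)
Definition heat_flow (v : R -> R -> R) : Prop :=
  (forall t, 0 < t -> L2 (v t)) /\
  forall t tau x, 0 < t -> 0 < tau -> v (t + tau) x = heat_conv tau (v t) x.

Variables (v : R -> R -> R) (hv : heat_flow v).

Lemma sqn_decr t tau : 0 < t -> 0 < tau -> sqn (v (t + tau)) <= sqn (v t).
Proof.
move=> t0 tau0; have [L2v cv] := hv.
have [I E] := integral_heat_conv tau0 (L2v t t0).
rewrite -E /sqn; apply: le_Rintegral => //.
  by have [] := L2v (t + tau) (addr_gt0 t0 tau0).
by move=> x _; rewrite cv//; exact: heat_conv_sqr_le (L2v t t0).
Qed.

Lemma sqn_mono s t : 0 < s -> s <= t -> sqn (v t) <= sqn (v s).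
Proof.
move=> s0; rewrite le_eqVlt => /predU1P[->//|st].
have := @sqn_decr s (t - s) s0; rewrite subr_gt0 => /(_ st).
by rewrite addrC subrK.
Qed.

(* Symmetry of the heat semigroup, together with weighted AM-GM. *)
Lemma sqn_halving t tau c : 0 < t -> 0 < tau -> 0 < c ->
  sqn (v t) <= c ^+ 2 * sqn (v (t + tau + tau)) ->
  sqn (v (t + tau)) <= c * sqn (v (t + tau + tau)).
Proof.
move=> t0 tau0 c0 H; have [L2v cv] := hv.
have tt0 : 0 < t + tau by rewrite addr_gt0.
have ttt0 : 0 < t + tau + tau by rewrite addr_gt0.
have La := L2v _ t0; have Lb := L2v _ tt0; have Lc := L2v _ ttt0.
have E : sqn (v (t + tau)) = \int[mu]_x (v t x * v (t + tau + tau) x).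
  have := heat_conv_sym tau0 La Lb.
  under eq_Rintegral do rewrite -cv// -expr2.
  by under [RHS]eq_Rintegral do rewrite -cv//.
have I := integrable_mulL2 La Lc.
have [_ Ia] := La; have [_ Ic] := Lc.
have Ja : mu.-integrable setT (EFin \o (fun x => c^-1 / 2 * v t x ^+ 2)).
  exact: (@integrableZl _ _ _ _ _ _ (c^-1 / 2) _ Ia).
have Jc : mu.-integrable setT (EFin \o (fun x => c / 2 * v (t + tau + tau) x ^+ 2)).
  exact: (@integrableZl _ _ _ _ _ _ (c / 2) _ Ic).
have J : mu.-integrable setT
    (EFin \o (fun x => c^-1 / 2 * v t x ^+ 2 + c / 2 * v (t + tau + tau) x ^+ 2)).
  exact: (@integrableD _ _ _ _ _ _ _ _ Ja Jc).
rewrite E; apply: (@le_trans _ _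
   (\int[mu]_x (c^-1 / 2 * v t x ^+ 2 + c / 2 * v (t + tau + tau) x ^+ 2))).
  apply: le_Rintegral => // x _.
  move: (v t x) (v (t + tau + tau) x) => a b.
  rewrite -subr_ge0 (_ : _ - _ = (2 * c)^-1 * (a - c * b) ^+ 2); last first.
    by field; rewrite gt_eqF.
  by rewrite mulr_ge0 ?sqr_ge0// invr_ge0; lra.
rewrite (RintegralD measurableT Ja Jc).
rewrite (RintegralZl (c^-1 / 2) measurableT Ia) (RintegralZl (c / 2) measurableT Ic).
rewrite -/(sqn (v t)) -/(sqn (v (t + tau + tau))).
move: H; move: (sqn (v t)) (sqn (v (t + tau + tau))) => A B H.
have : c^-1 / 2 * A <= c^-1 / 2 * (c ^+ 2 * B).
  apply: ler_wpM2l => //; apply: divr_ge0 => //; rewrite invr_ge0; exact: ltW.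
rewrite (_ : c^-1 / 2 * (c ^+ 2 * B) = c / 2 * B); first by lra.
by field; rewrite gt_eqF.
Qed.

(** Slow backward growth over tau persists at the same rate A over every dyadic fraction of tau.
    Each halving applies [sqn_halving] with c = exp(A d), where d is the new step. *)
Lemma sqn_dyadic t tau A (k : nat) : 0 < tau -> tau < t ->
  sqn (v (t - tau)) <= expR (A * tau) * sqn (v t) ->
  sqn (v (t - tau / 2 ^+ k)) <= expR (A * (tau / 2 ^+ k)) * sqn (v t).
Proof.
move=> tau0 taut H; elim: k => [|k IH]; first by rewrite expr0 divr1.
set d := tau / 2 ^+ k.+1.
have p0 : 0 < 2 ^+ k.+1 :> R by rewrite exprn_gt0.
have d0 : 0 < d by rewrite divr_gt0.
have dE : tau / 2 ^+ k = d + d.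
  by rewrite /d exprS; field; rewrite gt_eqF// exprn_gt0.
have dt : d + d <= tau.
  rewrite -dE ler_pdivrMr ?exprn_gt0// ler_peMr ?(ltW tau0)//.
  by apply: exprn_ege1; lra.
have E2 : t = t - (d + d) + d + d by ring.
have E1 : t - d = t - (d + d) + d by ring.
rewrite E1 {2}E2; apply: sqn_halving => //; first by lra.
  exact: expR_gt0.
rewrite -E2 -dE expr2 -expRD (_ : A * d + A * d = A * (tau / 2 ^+ k))//.
by rewrite dE mulrDr.
Qed.

End HeatFlow.

(** * Interpolation of the heat flow at Fekete points *)

Section KernelInterpolation.
Variable R : realType.
Implicit Types (s t x y z r : R).
Local Notation mu := (@lebesgue_measure R).

(** D^n / n! is from the Lagrange remainder, the next two factors from [gauss_der_le] with a = 1 /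
    (4 s), the last exponential from moving the centre of the Gaussian by at most D, and 4 from
    comparing the peaks at times s and 4 s. *)
Definition interp_cst (n : nat) (D s : R) : R :=
  4 * (D ^+ n / n`!%:R * (Num.sqrt (n%:R / (2 * s)) ^+ n *
    expR n%:R * expR (D ^+ 2 / (8 * s)))).

(** The intermediate point of the remainder depends on y, so its Gaussian is replaced by one centred
    at z. This halves the exponent a second time, after [gauss_der_le]; hence the kernel at time 4
    s. *)
Lemma kernel_interpolation n (x : 'I_n -> R) (a D z y s : R) :
  0 < s -> 0 <= D -> injective x -> (forall i, a <= x i <= a + D) ->
  a <= z <= a + D ->
  `|heat s (z - y) - \sum_i heat s (x i - y) * lag x i z| <=
  interp_cst n D s * heat (4 * s) (z - y).
Proof.
move=> s0 D0 xi xD zD.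
pose c := (4 * s)^-1.
have c0 : 0 < c by rewrite invr_gt0 mulr_gt0.
pose g m w := heat_peak s * gauss_der c m (w - y).
have hg m (w : R) : is_derive w 1 (g m) (g m.+1 w).
  have D1 := @is_derive1_comp _ (gauss_der c m) (fun w => w - y) w _ _
    (is_derive_gauss_der c m (w - y)).
  have D2 : is_derive w 1 (fun w => w - y) 1 by apply: is_derive_eq; ring.
  have D3 := D1 _ D2; rewrite mulr1 /comp in D3.
  by rewrite /g; apply: is_derive_eq.
have gE w : g 0%N w = heat s (w - y).
  by rewrite /g /gauss_der /gauss_poly mul1r /heat /c; congr (_ * expR (- _)); rewrite mulrC.
have [xi0 /andP[xa xb]] := lagrange_remainder hg xi xD zD.
have -> : \sum_i g 0%N (x i) * lag x i z = \sum_i heat s (x i - y) * lag x i z.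
  by apply: eq_bigr => i _; rewrite gE.
rewrite gE => ->.
rewrite addrAC subrr add0r normrM normrM /g normrM (gtr0_norm (heat_peak_gt0 s)).
rewrite normfV (ger0_norm (ler0n _ _)).
have h1 : `|\prod_i (z - x i)| <= D ^+ n.
  rewrite normr_prod -[X in D ^+ X](card_ord n) -prodr_const.
  apply: ler_prod => i _; rewrite normr_ge0/= ler_norml.
  by have := xD i; move: zD => /andP[? ?] /andP[? ?]; apply/andP; split; lra.
have h2 := gauss_der_le n (xi0 - y) c0.
have e2c : 2 * c * n%:R = n%:R / (2 * s) by rewrite /c; field; rewrite gt_eqF.
rewrite e2c in h2.
have h3 : expR (- (c * (xi0 - y) ^+ 2 / 2)) <=
    expR (D ^+ 2 / (8 * s)) * expR (- ((z - y) ^+ 2 / (4 * (4 * s)))).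
  rewrite -expRD ler_expR.
  have -> : D ^+ 2 / (8 * s) = c / 2 * D ^+ 2 by rewrite /c; field; rewrite gt_eqF.
  have -> : (z - y) ^+ 2 / (4 * (4 * s)) = c / 2 * ((z - y) ^+ 2 / 2).
    by rewrite /c; field; rewrite gt_eqF.
  rewrite -subr_ge0 (_ : _ - _ =
      c / 2 * (D ^+ 2 + (xi0 - y) ^+ 2 - (z - y) ^+ 2 / 2)); last by field.
  apply: mulr_ge0; first by rewrite divr_ge0// ltW.
  have zx : (z - xi0) ^+ 2 <= D ^+ 2.
    rewrite -(real_normK (num_real (z - xi0))) lerXn2r ?nnegrE// ler_norml.
    by move: zD => /andP[? ?]; apply/andP; split; lra.
  have := sqr_ge0 ((xi0 - y) - (z - xi0)).
  have -> : (z - y) ^+ 2 = ((xi0 - y) + (z - xi0)) ^+ 2 by congr (_ ^+ 2); ring.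
  by move: (xi0 - y) (z - xi0) zx => p q; rewrite sqrrB sqrrD; lra.
have p4 : heat_peak s <= 4 * heat_peak (4 * s).
  apply: le_trans (heat_peak_half s0) _.
  rewrite (_ : 4 * heat_peak (4 * s) = 2 * (2 * heat_peak (2 * (2 * s)))).
    by rewrite ler_wpM2l// heat_peak_half// mulr_gt0.
  by rewrite (_ : 2 * (2 * s) = 4 * s); ring.
set S := Num.sqrt _ ^+ n * expR _ in h2 *.
have S0 : 0 <= S by rewrite mulr_ge0 ?expR_ge0// exprn_ge0// sqrtr_ge0.
have h4 : `|gauss_der c n (xi0 - y)| <=
   S * (expR (D ^+ 2 / (8 * s)) * expR (- ((z - y) ^+ 2 / (4 * (4 * s))))).
  by apply: le_trans h2 _; rewrite ler_wpM2l.
have f0 : 0 < n`!%:R :> R by rewrite ltr0n fact_gt0.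
apply: (@le_trans _ _ (4 * heat_peak (4 * s) *
  (S * (expR (D ^+ 2 / (8 * s)) * expR (- ((z - y) ^+ 2 / (4 * (4 * s)))))) / n`!%:R *
  D ^+ n)).
  apply: ler_pM => //.
    by rewrite divr_ge0 ?(ltW f0)// mulr_ge0// ltW// heat_peak_gt0.
  rewrite ler_wpM2r ?invr_ge0 ?(ltW f0)//.
  by apply: ler_pM => //; exact/ltW/heat_peak_gt0.
by rewrite /interp_cst /heat -/S le_eqVlt; apply/orP; left; apply/eqP; ring.
Qed.

Lemma L2_norm f : L2 f -> L2 (fun y : R => `|f y|).
Proof.
move=> [mf If]; split; first exact: measurableT_comp.
rewrite (_ : (fun y => `|f y| ^+ 2) = (fun y => f y ^+ 2))//.
by apply/funext => y; rewrite real_normK// num_real.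
Qed.

(** Interpolation is linear, so the error for v is the kernel error integrated against [v t]. It is
    bounded by the heat convolution of |v t|, and Jensen's inequality turns the square into an
    average of v^2 that integrates well in z. *)
Lemma flow_interpolation v n (x : 'I_n -> R) (a D z t s : R) :
  heat_flow v -> 0 < t -> 0 < s ->
  0 <= D -> injective x -> (forall i, a <= x i <= a + D) -> a <= z <= a + D ->
  (v (t + s) z - \sum_i v (t + s) (x i) * lag x i z) ^+ 2 <=
  interp_cst n D s ^+ 2 * \int[mu]_y (heat (4 * s) (z - y) * v t y ^+ 2).
Proof.
move=> [L2v cv] t0 s0 D0 xi xD zD.
have Lt := L2v t t0.
have s40 : 0 < 4 * s by rewrite mulr_gt0.
have I w := integrable_heatL2 w s0 Lt.
pose W y := (heat s (z - y) - \sum_i heat s (x i - y) * lag x i z) * v t y.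
have Isum (r : seq 'I_n) : mu.-integrable setT (EFin \o (fun y => \sum_(i <- r) lag x i z * (heat s (x i - y) * v t y))) /\
   \int[mu]_y (\sum_(i <- r) lag x i z * (heat s (x i - y) * v t y)) =
   \sum_(i <- r) v (t + s) (x i) * lag x i z.
  elim: r => [|i r [IH1 IH2]].
    rewrite big_nil; split.
      rewrite (_ : _ \o _ = cst 0%E); first exact: integrable0.
      by apply/funext => y /=; rewrite big_nil.
    by under eq_Rintegral do rewrite big_nil; rewrite Rintegral_cst// mul0r.
  have J : mu.-integrable setT (EFin \o (fun y => lag x i z * (heat s (x i - y) * v t y))).
    exact: (@integrableZl _ _ _ _ _ _ (lag x i z) _ (I (x i))).
  split.
    rewrite (_ : _ \o _ = EFin \o (fun y => lag x i z * (heat s (x i - y) * v t y) +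
       \sum_(i <- r) lag x i z * (heat s (x i - y) * v t y))).
      exact: (@integrableD _ _ _ _ _ _ _ _ J IH1).
    by apply/funext => y /=; rewrite big_cons.
  under eq_Rintegral do rewrite big_cons.
  rewrite (RintegralD measurableT J IH1) IH2 big_cons.
  by rewrite (RintegralZl (lag x i z) measurableT (I (x i))) cv// mulrC.
have [I1 E1] := Isum (index_enum 'I_n).
have WE : W = fun y => heat s (z - y) * v t y - \sum_i lag x i z * (heat s (x i - y) * v t y).
  apply/funext => y; rewrite /W mulrBl mulr_suml; congr (_ - _).
  by apply: eq_bigr => i _; ring.
have IW : mu.-integrable setT (EFin \o W).
  rewrite WE; exact: (@integrableB _ _ _ _ _ _ _ _ (I z) I1).
have EW : v (t + s) z - \sum_i v (t + s) (x i) * lag x i z = \int[mu]_y W y.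
  by rewrite WE (RintegralB measurableT (I z) I1) E1 cv.
rewrite EW.
have Ln := L2_norm Lt.
have IN := integrable_heatL2 z s40 Ln.
set B := interp_cst n D s.
have B0 : 0 <= B.
  rewrite /B /interp_cst; repeat apply: mulr_ge0;
    by rewrite ?invr_ge0 ?ler0n ?expR_ge0 ?exprn_ge0 ?sqrtr_ge0.
have H : `|\int[mu]_y W y| <= B * heat_conv (4 * s) (fun y => `|v t y|) z.
  apply: le_trans (le_normr_Rintegral _ IW) _ => //.
  rewrite -(RintegralZl B measurableT IN).
  apply: le_Rintegral => //; first exact: integrable_norm.
    exact: (@integrableZl _ _ _ _ _ _ B _ IN).
  move=> y _; rewrite /W normrM mulrA ler_wpM2r//.
  exact: kernel_interpolation.
have := heat_conv_sqr_le z s40 Ln.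
under eq_Rintegral do rewrite real_normK ?num_real//.
move=> H2; rewrite -(real_normK (num_real (\int[mu]_y W y))).
have c0 : 0 <= heat_conv (4 * s) (fun y => `|v t y|) z.
  by apply: Rintegral_ge0 => y _; rewrite mulr_ge0 ?heat_ge0.
apply: (@le_trans _ _ ((B * heat_conv (4 * s) (fun y => `|v t y|) z) ^+ 2)).
  have Bc0 := mulr_ge0 B0 c0.
  by rewrite lerXn2r// nnegrE.
by rewrite exprMn ler_wpM2l ?sqr_ge0.
Qed.

End KernelInterpolation.

Section UnitSums.
Variable R : realType.
Local Notation mu := (@lebesgue_measure R).

(** The number 10 makes sqrt (n / (2 s)) at most n / (D e^5). Each of n^n / n!, [expR n%:R] and the
    recentring factor is at most e^n, and 3 - 5 = -2. *)
Lemma interp_cst_le n (D s : R) : (0 < n)%N -> 0 < D ->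
  D ^+ 2 * expR 10 / 2 / n%:R <= s -> interp_cst n D s <= 4 * expR (- (2 * n%:R)).
Proof.
move=> n0 D0 bs; have nr : 0 < n%:R :> R by rewrite ltr0n.
have E0 : 0 < expR (10 : R) by exact: expR_gt0.
have b0 : 0 < D ^+ 2 * expR 10 / 2 / n%:R.
  by rewrite !divr_gt0// mulr_gt0// exprn_gt0.
have s0 : 0 < s by exact: lt_le_trans bs.
have f0 : 0 < n`!%:R :> R by rewrite ltr0n fact_gt0.
rewrite /interp_cst ler_wpM2l//.
have h1 : Num.sqrt (n%:R / (2 * s)) <= n%:R / (D * expR 5).
  rewrite -[leRHS]gtr0_norm; last by rewrite divr_gt0// mulr_gt0// expR_gt0.
  rewrite -sqrtr_sqr ler_wsqrtr// ler_pdivrMr ?mulr_gt0//.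
  have -> : (n%:R / (D * expR 5)) ^+ 2 * (2 * s) =
     n%:R * (s / (D ^+ 2 * expR 10 / 2 / n%:R)).
    have -> : expR 10 = expR 5 * expR 5 :> R by rewrite -expRD; congr expR; ring.
    by field; rewrite !gt_eqF// expR_gt0.
  by rewrite ler_pMr// ler_pdivlMr// mul1r.
have h2 : D ^+ 2 / (8 * s) <= n%:R.
  rewrite ler_pdivrMr ?mulr_gt0//.
  apply: (@le_trans _ _ (n%:R * (8 * (D ^+ 2 * expR 10 / 2 / n%:R)))); last first.
    by rewrite !ler_wpM2l// ltW.
  have -> : n%:R * (8 * (D ^+ 2 * expR 10 / 2 / n%:R)) = D ^+ 2 * (4 * expR 10).
    by field; rewrite gt_eqF.
  rewrite ler_peMr ?sqr_ge0//.
  by have := expR_ge1Dx (10 : R); lra.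
have h3 : n%:R ^+ n / n`!%:R <= expR n%:R :> R.
  have := expR_ge1Dxn n.-1 (ltW nr); rewrite prednK//.
  by apply: le_trans; rewrite lerDr.
have h4 : Num.sqrt (n%:R / (2 * s)) ^+ n <= (n%:R / (D * expR 5)) ^+ n.
  by rewrite lerXn2r ?nnegrE ?sqrtr_ge0// (le_trans _ h1)// sqrtr_ge0.
apply: (@le_trans _ _ (D ^+ n / n`!%:R * ((n%:R / (D * expR 5)) ^+ n * expR n%:R * expR n%:R))).
  rewrite ler_wpM2l ?divr_ge0 ?exprn_ge0 ?(ltW D0)//.
  apply: ler_pM; rewrite ?expR_ge0 ?ler_expR// ?mulr_ge0 ?exprn_ge0 ?sqrtr_ge0 ?expR_ge0//.
  by rewrite ler_wpM2r ?expR_ge0.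
have -> : D ^+ n / n`!%:R * ((n%:R / (D * expR 5)) ^+ n * expR n%:R * expR n%:R) =
   n%:R ^+ n / n`!%:R * (expR n%:R * expR n%:R / expR 5 ^+ n).
  rewrite expr_div_n exprMn; field.
  by rewrite !gt_eqF ?exprn_gt0 ?expR_gt0.
apply: (@le_trans _ _ (expR n%:R * (expR n%:R * expR n%:R / expR 5 ^+ n))).
  by rewrite ler_wpM2r// divr_ge0 ?mulr_ge0 ?exprn_ge0 ?expR_ge0.
rewrite -expRM_natr -expRN -!expRD ler_expR; lra.
Qed.

Lemma Rintegral_sym_cvg (g : R -> R) : mu.-integrable setT (EFin \o g) ->
  \int[mu]_(y in `[- n%:R, n%:R[) g y @[n --> \oo] --> \int[mu]_y g y.
Proof.
move=> Ig; have mg : measurable_fun setT g.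
  by apply/measurable_EFinP; exact: measurable_int Ig.
pose f (n : nat) := g \_ (`[- n%:R, n%:R[%classic : set R).
have fE n : \int[mu]_(y in `[- n%:R, n%:R[) g y = \int[mu]_y f n y.
  by rewrite Rintegral_mkcond.
under eq_fun do rewrite fE.
have mf n : measurable_fun setT (EFin \o f n).
  apply/measurable_EFinP.
  by apply: (measurable_restrictT _ _).1 => //; exact: measurable_funTS.
have mg' : measurable_fun setT (EFin \o g) by exact/measurable_EFinP.
have fg' : {ae mu, forall y n, [set: R] y -> (`|(EFin \o f n) y| <= (EFin \o (fun y => `|g y|)%R) y)%E}.
  apply: aeW => y n _; rewrite lee_fin /f patchE; case: ifPn => // _.
  by rewrite normr0.
have fcvg' : {ae mu, forall y, [set: R] y -> (EFin \o f n) y @[n --> \oo] --> (EFin \o g) y}.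
  apply: aeW => y _; apply: cvg_EFin; first exact: nearW.
  apply: (@cvg_trans _ ((fun=> g y) @ \oo)); last exact: cvg_cst.
  apply: near_eq_cvg; near=> n; rewrite /= /f patchE ifT// inE/= in_itv/=.
  have yn : `|y| < n%:R by near: n; exact: nbhs_infty_gtr.
  by move: yn; rewrite ltr_norml => /andP[/ltW -> ->].
have [_ _ H] := @dominated_convergence _ _ R mu setT measurableT
   (fun n => EFin \o f n) _ _ mf mg' fcvg' (integrable_norm Ig) fg'.
by apply: fine_cvg; rewrite /Rintegral fineK//; exact: integrable_fin_num.
Unshelve. all: by end_near.
Qed.

(** g may change sign (it will be v^2 minus the interpolation error), so the line is exhausted by
    symmetric intervals with dominated rather than monotone convergence. *)
Lemma Rintegral_le_unit_sum (g : R -> R) (c : int -> R) (M : R) :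
  mu.-integrable setT (EFin \o g) ->
  (forall (k : int) y, k%:~R <= y <= k%:~R + 1 -> g y <= c k) ->
  (forall n : nat, \sum_(i < n + n) c (i%:Z - n%:Z) <= M) ->
  \int[mu]_y g y <= M.
Proof.
move=> Ig gc cM.
have IgD (D : set R) : measurable D -> mu.-integrable D (EFin \o g).
  by move=> mD; apply: integrableS Ig.
have step (a : int) (n : nat) : \int[mu]_(y in `[a%:~R, a%:~R + n%:R[) g y <=
    \sum_(i < n) c (a + i%:Z).
  elim: n => [|n IH].
    rewrite addr0 big_ord0 (_ : `[_, _[%classic = set0) ?Rintegral_set0//.
    by apply/seteqP; split => // y; rewrite /= in_itv/= => /andP[/le_lt_trans h /h]; rewrite ltxx.
  rewrite big_ord_recr/=.
  have -> : `[a%:~R, a%:~R + n.+1%:R[%classic =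
      `[a%:~R, a%:~R + n%:R[ `|` `[a%:~R + n%:R, a%:~R + n.+1%:R[ :> set R.
    rewrite -itv_bndbnd_setU// bnd_simp.
      by rewrite lerDl.
    by rewrite lerD2l ler_nat.
  rewrite Rintegral_setU//.
  - apply: lerD => //.
    have mI : measurable (`[a%:~R + n%:R, a%:~R + n.+1%:R[%classic : set R) by [].
    have len : fine (mu (`[a%:~R + n%:R, a%:~R + n.+1%:R[%classic : set R)) = 1.
      rewrite lebesgue_measure_itv/= lte_fin ltrD2l ltr_nat ltnS leqnn.
      by rewrite -EFinB/= -natr1; ring.
    have Icst : mu.-integrable (`[a%:~R + n%:R, a%:~R + n.+1%:R[%classic : set R)
        (EFin \o cst (c (a + n%:Z))).
      apply: measurable_bounded_integrable; [exact: mI| |exact: measurable_cst|exact: bounded_cst].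
      by rewrite /= lebesgue_measure_itv/= lte_fin ltrD2l ltr_nat ltnS leqnn -EFinB ltry.
    have Ecst : \int[mu]_(y in `[a%:~R + n%:R, a%:~R + n.+1%:R[) (cst (c (a + n%:Z))) y =
        c (a + n%:Z) by rewrite Rintegral_cst// len mulr1.
    have Ig1 := IgD _ mI.
    rewrite -[leRHS]Ecst; apply: (@le_Rintegral _ _ _ mu _ _ _ _ Ig1 Icst); first by [].
    move=> y; rewrite /= in_itv/= => /andP[y1 y2]; apply: gc.
    by rewrite intrD/= y1 -addrA natr1 ltW.
  - by apply: IgD; exact: measurableU.
  - rewrite disj_set2E; apply/eqP/seteqP; split => // y [/=].
    by rewrite !in_itv/= => /andP[_ /lt_le_trans h] /andP[/h]; rewrite ltxx.
have H := Rintegral_sym_cvg Ig.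
rewrite -(cvg_lim (@Rhausdorff R) H); apply: limr_le.
  by apply/cvg_ex; exists (\int[mu]_y g y).
apply: nearW => n; apply: le_trans (cM n).
have := step (- n%:Z) (n + n)%N.
have -> : (- n%:Z)%:~R = - n%:R :> R by rewrite mulrNz.
have -> : - n%:R + (n + n)%:R = n%:R :> R by rewrite natrD; ring.
move=> /le_trans; apply; rewrite le_eqVlt; apply/orP; left; apply/eqP.
by apply: eq_bigr => i _; rewrite addrC.
Qed.

End UnitSums.

(** * Dissipation or observation at a fixed time *)

Section Dichotomy.
Variable R : realType.
Local Notation mu := (@lebesgue_measure R).

Lemma dyadic_scale (tau b : R) : 0 < b -> b <= tau ->
  exists k : nat, b <= tau / 2 ^+ k <= 2 * b.
Proof.
move=> b0 btau; have tau0 : 0 < tau by exact: lt_le_trans btau.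
pose P k := tau / 2 ^+ k <= 2 * b.
have exP : exists k, P k.
  have [k hk] : exists k : nat, tau / (2 * b) <= k%:R.
    exists (Num.bound (tau / (2 * b))); apply/ltW/archi_boundP.
    by rewrite divr_ge0 ?mulr_ge0// ltW.
  exists k; rewrite /P ler_pdivrMr ?exprn_gt0// mulrC -ler_pdivrMr ?mulr_gt0//.
  apply: (le_trans hk); rewrite -natrX ler_nat; exact/ltnW/ltn_expl.
have [[|k] Pk kmin] := ex_minnP exP.
  by exists 0%N; rewrite expr0 divr1 btau; move: Pk; rewrite /P expr0 divr1.
exists k.+1; rewrite [X in _ && X]Pk andbT leNgt; apply/negP => h.
have : P k.
  have p0 : 0 < 2 ^+ k :> R by rewrite exprn_gt0.
  have -> : P k = (2 * (tau / 2 ^+ k.+1) <= 2 * b).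
    by rewrite /P exprS; congr (_ <= _); field; rewrite gt_eqF.
  by rewrite ler_pM2l// ltW.
by move=> /kmin; rewrite ltnn.
Qed.

Lemma lag_le n (x : 'I_n -> R) (a D e z : R) i : 1 <= D -> 0 < e ->
  e <= vdm_node x i -> (forall j, a <= x j <= a + D) -> a <= z <= a + D ->
  `|lag x i z| <= D ^+ n / e.
Proof.
move=> D1 e0 ev xD zD; have D0 : 0 < D by exact: lt_le_trans D1.
rewrite /lag prodf_div normrM normfV !normr_prod -/(vdm_node x i).
apply: ler_pM; rewrite ?invr_ge0 ?prodr_ge0//.
- apply: (@le_trans _ _ (\prod_(j | j != i) D)).
    apply: ler_prod => j _; rewrite normr_ge0/= ler_norml.
    by have := xD j; move: zD => /andP[? ?] /andP[? ?]; apply/andP; split; lra.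
  rewrite prodr_const; apply: ler_weXn2l => //.
  by rewrite -[X in (_ <= X)%N](card_ord n) max_card.
- by rewrite lef_pV2 ?posrE// (lt_le_trans e0).
Qed.

Lemma vdm_node_inj n (x : 'I_n -> R) : (forall i, 0 < vdm_node x i) -> injective x.
Proof.
move=> x0 i j xij; apply/eqP; rewrite eq_sym; apply/negPn/negP => ij.
by have := x0 i; rewrite /vdm_node (bigD1 j)//= xij subrr normr0 mul0r ltxx.
Qed.

(** The last hypothesis is the failure of dissipation over tau. It descends to a dyadic step between
    b and 2 b, where b = D^2 e^10 / (2 n) is the smallest step allowed by [interp_cst_le]; there it
    reads |v (t - sg)|^2 <= e^n |v t|^2, because n^2 / (D^2 e^10) * 2 b = n. *)
Lemma flow_dichotomy (v : R -> R -> R) n (x : int -> 'I_n -> R) (D e t tau M : R)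
    (s : int -> R) :
  heat_flow v -> (4 <= n)%N -> 1 <= D -> 0 < e ->
  (forall k i, k%:~R <= x k i <= k%:~R + D) ->
  (forall k i, e <= vdm_node (x k) i) ->
  (forall k i, `|v t (x k i)| <= s k) ->
  (forall m : nat, \sum_(i < m + m) s (i%:Z - m%:Z) ^+ 2 <= M) ->
  D ^+ 2 * expR 10 / 2 / n%:R <= tau -> tau < t ->
  sqn (v (t - tau)) <= expR (n%:R ^+ 2 / (D ^+ 2 * expR 10) * tau) * sqn (v t) ->
  sqn (v t) <= 4 * (n%:R * (D ^+ n / e)) ^+ 2 * M.
Proof.
move=> hv n4 D1 e0 xD xe xs sM btau taut qtau; have [L2v cv] := hv.
have nr : 0 < n%:R :> R by rewrite ltr0n; exact: leq_trans n4.
have D0 : 0 < D by exact: lt_le_trans D1.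
set b := D ^+ 2 * expR 10 / 2 / n%:R in btau.
have b0 : 0 < b by rewrite !divr_gt0// mulr_gt0 ?expR_gt0// exprn_gt0.
have tau0 : 0 < tau by exact: lt_le_trans btau.
have t0 : 0 < t by exact: lt_trans taut.
have [k /andP[sb1 sb2]] := dyadic_scale b0 btau.
have qs := sqn_dyadic hv k tau0 taut qtau.
set sg := tau / 2 ^+ k in sb1 sb2 qs.
have sg0 : 0 < sg by exact: lt_le_trans sb1.
have sgt : 0 < t - sg.
  rewrite subr_gt0; apply: le_lt_trans taut.
  rewrite ler_pdivrMr ?exprn_gt0// ler_peMr ?(ltW tau0)// exprn_ege1//; lra.
have qsg : sqn (v (t - sg)) <= expR n%:R * sqn (v t).
  apply: (le_trans qs); rewrite ler_wpM2r ?sqn_ge0// ler_expR.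
  apply: (@le_trans _ _ (n%:R ^+ 2 / (D ^+ 2 * expR 10) * (2 * b))).
    by rewrite ler_wpM2l// divr_ge0 ?sqr_ge0// mulr_ge0 ?sqr_ge0 ?expR_ge0.
  rewrite /b le_eqVlt; apply/orP; left; apply/eqP.
  by field; rewrite !gt_eqF ?expR_gt0.
pose B := interp_cst n D sg.
have B0 : 0 <= B.
  rewrite /B /interp_cst; repeat apply: mulr_ge0;
    by rewrite ?invr_ge0 ?ler0n ?expR_ge0 ?exprn_ge0 ?sqrtr_ge0 ?(ltW D0).
(* B^2 <= 16 e^(-4n) beats the growth e^n, so the interpolation error is at most half of |v t|^2 and
   can be absorbed. *)
have BB : 2 * B ^+ 2 * expR n%:R <= 2^-1.
  have h : B <= 4 * expR (- (2 * n%:R)).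
    by apply: interp_cst_le => //; exact: leq_trans n4.
  have h2 : B ^+ 2 <= 16 * expR (- (4 * n%:R)).
    apply: (@le_trans _ _ ((4 * expR (- (2 * n%:R))) ^+ 2)).
      by rewrite lerXn2r ?nnegrE// mulr_ge0// expR_ge0.
    rewrite exprMn -expRM_natr (_ : - (2 * n%:R) * 2 = - (4 * n%:R)); last by ring.
    by rewrite (_ : 4 ^+ 2 = 16)//; ring.
  have h3 : expR (- (4 * n%:R)) * expR n%:R <= 64^-1 :> R.
    rewrite -expRD (_ : - (4 * n%:R) + n%:R = - (3 * n%:R)); last by ring.
    rewrite expRN lef_pV2 ?posrE ?expR_gt0//.
    apply: (@le_trans _ _ (expR (1 * 6%:R))); last first.
      by rewrite ler_expR; have : 4%:R <= n%:R :> R; [rewrite ler_nat|lra].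
    rewrite expRM_natr (_ : 64 = 2 ^+ 6); last by ring.
    by rewrite lerXn2r ?nnegrE ?expR_ge0//; have := expR_ge1Dx (1 : R); lra.
  have := ler_wpM2r (expR_ge0 n%:R) h2; lra.
pose L := n%:R * (D ^+ n / e).
have L0 : 0 <= L by rewrite mulr_ge0// divr_ge0 ?exprn_ge0 ?(ltW e0)// ltW.
pose Q z := \int[mu]_y (heat (4 * sg) (z - y) * v (t - sg) y ^+ 2).
have sg40 : 0 < 4 * sg by rewrite mulr_gt0.
have [IQ EQ] := integral_heat_conv sg40 (L2v _ sgt).
have [_ Iv] := L2v _ t0.
have IBQ : mu.-integrable setT (EFin \o (fun z => 2 * B ^+ 2 * Q z)).
  exact: (@integrableZl _ _ _ _ _ _ (2 * B ^+ 2) _ IQ).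
have Ig : mu.-integrable setT (EFin \o (fun z => v t z ^+ 2 - 2 * B ^+ 2 * Q z)).
  exact: (@integrableB _ _ _ _ _ _ _ _ Iv IBQ).
have s0 k' : 0 <= s k'.
  have i : 'I_n by exists 0%N; exact: leq_trans n4.
  exact: le_trans (xs k' i).
have main : \int[mu]_z (v t z ^+ 2 - 2 * B ^+ 2 * Q z) <= 2 * L ^+ 2 * M.
  apply: (Rintegral_le_unit_sum (c := fun k => 2 * L ^+ 2 * s k ^+ 2) Ig); last first.
    move=> m; rewrite -mulr_sumr; apply: ler_wpM2l; last exact: sM.
    by apply: mulr_ge0 => //; exact: sqr_ge0.
  move=> k' z /andP[z1 z2].
  have zD : k'%:~R <= z <= k'%:~R + D by rewrite z1 (le_trans z2)// lerD2l.
  have xinj : injective (x k').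
    by apply: vdm_node_inj => i; exact: lt_le_trans (xe k' i).
  have := flow_interpolation hv sgt sg0 (ltW D0) xinj (xD k') zD.
  rewrite subrK -/B -/(Q z); set S := \sum_i _ => h.
  have hS : S ^+ 2 <= L ^+ 2 * s k' ^+ 2.
    have Ls0 := mulr_ge0 L0 (s0 k').
    rewrite -exprMn -(real_normK (num_real S)) lerXn2r// ?nnegrE//.
    apply: (le_trans (ler_norm_sum _ _ _)).
    apply: (@le_trans _ _ (\sum_(i < n) s k' * (D ^+ n / e))).
      apply: ler_sum => i _; rewrite normrM ler_pM//.
      exact: lag_le (xe k' i) (xD k') zD.
    by rewrite sumr_const card_ord /L -mulr_natr le_eqVlt; apply/orP; left; apply/eqP; ring.
  have : v t z ^+ 2 <= 2 * S ^+ 2 + 2 * (v t z - S) ^+ 2.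
    move: (v t z) S {h hS} => p q.
    rewrite -subr_ge0 (_ : _ - _ = (p - 2 * q) ^+ 2); first exact: sqr_ge0.
    by ring.
  by lra.
move: main; rewrite (RintegralB measurableT Iv IBQ) (RintegralZl (2 * B ^+ 2) measurableT IQ).
rewrite EQ -/(sqn (v t)) => main.
have : 2 * B ^+ 2 * sqn (v (t - sg)) <= 2^-1 * sqn (v t).
  apply: (@le_trans _ _ (2 * B ^+ 2 * (expR n%:R * sqn (v t)))).
    by rewrite ler_wpM2l// mulr_ge0// sqr_ge0.
  by rewrite mulrA ler_wpM2r ?sqn_ge0.
by rewrite -/L; lra.
Qed.

End Dichotomy.

(** * Telescoping in time *)

Section Telescoping.
Variable R : realType.
Local Notation mu := (@lebesgue_measure R).

(* The integral of a nonnegative function, measurable or not, is the supremum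
   over the simple functions below it. *)
Lemma ge0_integral_mono (D : set R) (f g : R -> \bar R) :
  (forall x, D x -> 0 <= f x)%E -> (forall x, D x -> f x <= g x)%E ->
  (\int[mu]_(x in D) f x <= \int[mu]_(x in D) g x)%E.
Proof.
move=> f0 fg; rewrite !ge0_integralE//; last first.
  by move=> x Dx; rewrite (le_trans (f0 x Dx))// fg.
apply: ge_ereal_sup => _ [h /= hf <-]; apply: ereal_sup_ubound; exists h => //= x.
apply: le_trans (hf x) _; rewrite !patchE; case: ifPn => //.
by rewrite inE => /fg.
Qed.

Definition lr_time (T : R) (J p : nat) : R := T / 2 + T / 2 * J%:R / p%:R.

Lemma lr_time_sub T J p : (0 < p)%N ->
  lr_time T J p - lr_time T J p.+1 = T / 2 * J%:R / (p%:R * p.+1%:R).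
Proof.
move=> p0; rewrite /lr_time -natr1.
have pr : 0 < p%:R :> R by rewrite ltr0n.
field; rewrite !gt_eqF//; lra.
Qed.

Lemma pow16_ge (p : nat) : (0 < p)%N -> 1 <= 16 ^+ p / p%:R ^+ 2 :> R.
Proof.
move=> p0; have pr : 0 < p%:R :> R by rewrite ltr0n.
rewrite ler_pdivlMr ?exprn_gt0// mul1r (_ : 16 ^+ p = (4 ^+ p) ^+ 2).
  rewrite lerXn2r ?nnegrE ?exprn_ge0//.
  by rewrite -natrX ler_nat ltnW// ltn_expl.
by rewrite -exprM mulnC exprM; congr (_ ^+ _); ring.
Qed.

(** For s in the upper half of the interval from t_(p+1) to t_p, use the alternative with tau equal
    to half its length. By monotonicity of g, both cases give g(t_p) - eps_p g(t_(p+1)) <= E_p S(s).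
    Integration over that half gives w_p g(t_p) - w_p eps_p g(t_(p+1)), and the sum over p
    telescopes once w_p eps_p <= w_(p+1). *)
Lemma telescoping (T A K c : R) : 0 < T -> 0 < A -> 0 < K -> 0 < c ->
  exists2 C : R, 0 < C & forall (g : R -> R) (S : R -> \bar R),
    (forall t, 0 <= g t) ->
    (forall s t, 0 < s -> s <= t -> g t <= g s) ->
    (forall t : R, 0 < t -> (0 <= S t)%E) ->
    (forall (p : nat) t tau, (0 < p)%N -> c / 4 ^+ p <= tau -> tau < t ->
      g t <= expR (- (A * 16 ^+ p * tau)) * g (t - tau) \/
      ((g t)%:E <= (expR (K * (16 ^+ p / p%:R ^+ 2)))%:E * S t)%E) ->
    ((g T)%:E <= C%:E * \int[mu]_(t in `]0%R, T[) S t)%E.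
Proof.
move=> T0 A0 K0 c0.
(* The first summand makes the half steps long enough for the alternative ([step1]), the second
   makes dissipation beat the next cost ([step2]). *)
pose J := (Num.bound (4 * c / T + 8 * (2 + 16 * K) / (A * T))).+1.
have [J1 J2] : 4 * c <= T * J%:R /\ 8 * (2 + 16 * K) <= A * T * J%:R.
  have a1 : 0 <= 4 * c / T by rewrite divr_ge0 ?mulr_ge0// ltW.
  have a2 : 0 <= 8 * (2 + 16 * K) / (A * T).
    by rewrite divr_ge0 ?mulr_ge0 ?(ltW A0) ?(ltW T0)//; lra.
  have := archi_boundP (addr_ge0 a1 a2); set bd := Num.bound _ => hb.
  have hJ : bd%:R <= J%:R :> R by rewrite ler_nat.
  split; rewrite [leRHS]mulrC -ler_pdivrMr ?mulr_gt0//; lra.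
have Jr : 0 < J%:R :> R by rewrite ltr0n.
pose t p := lr_time T J p.
pose d p : R := T / 2 * J%:R / (p%:R * p.+1%:R).
pose X p : R := 16 ^+ p / p%:R ^+ 2.
pose E p : R := expR (K * X p).
pose eps p := expR (- (A * 16 ^+ p * (d p / 2))).
pose w p := d p / 2 / E p.
have dE p : (0 < p)%N -> t p - t p.+1 = d p by exact: lr_time_sub.
have d0 p : (0 < p)%N -> 0 < d p.
  move=> p0; rewrite divr_gt0 ?mulr_gt0 ?ltr0n//; lra.
have E0 p : 0 < E p by exact: expR_gt0.
have w0 p : (0 < p)%N -> 0 < w p.
  by move=> p0; apply: divr_gt0 => //; apply: divr_gt0 => //; exact: d0.
have tJ : t J = T by rewrite /t /lr_time; field; rewrite gt_eqF.
have tT p : (J <= p)%N -> t p <= T.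
  move=> Jp; rewrite -[leRHS]tJ lerD2l ler_wpM2l ?mulr_ge0 ?(ltW Jr)//; first by lra.
  by rewrite lef_pV2 ?posrE ?ler_nat// ltr0n (leq_trans _ Jp).
have tT2 p : T / 2 <= t p by rewrite lerDl divr_ge0// !mulr_ge0// ltW.
have step1 p : (J <= p)%N -> c / 4 ^+ p <= d p / 2.
  move=> Jp; have p0 : (0 < p)%N by exact: leq_trans Jp.
  have pr : 0 < p%:R :> R by rewrite ltr0n.
  have pr1 : 0 < p.+1%:R :> R by rewrite ltr0n.
  have h : p%:R * p.+1%:R <= 4 ^+ p :> R.
    rewrite (_ : 4 ^+ p = 2 ^+ p * 2 ^+ p :> R); last by rewrite -exprMn; congr (_ ^+ _); ring.
    rewrite -natrX; apply: ler_pM => //; rewrite ler_nat; last exact: ltn_expl.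
    exact/ltnW/ltn_expl.
  rewrite ler_pdivrMr ?exprn_gt0//.
  have -> : d p / 2 = T * J%:R / 4 / (p%:R * p.+1%:R).
    by rewrite /d; field; rewrite !gt_eqF//=; have := pr1; rewrite -natr1.
  rewrite mulrAC ler_pdivlMr ?mulr_gt0//.
  by apply: ler_pM => //; [exact: ltW|lra].
have step2 p : (J <= p)%N -> w p * eps p <= w p.+1.
  move=> Jp; have p0 : (0 < p)%N by exact: leq_trans Jp.
  have pr : 1 <= p%:R :> R by rewrite ler1n.
  have X1 : 1 <= X p by exact: pow16_ge.
  have dd : d p <= expR 2 * d p.+1.
    apply: (@le_trans _ _ (3 * d p.+1)); last first.
      by rewrite ler_wpM2r ?(ltW (d0 _ _))//; have := expR_ge1Dx (2 : R); lra.
    rewrite -subr_ge0 (_ : _ - _ = T * J%:R * (p%:R - 1) / (p%:R * p.+1%:R * p.+2%:R)).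
      by rewrite divr_ge0// !mulr_ge0 ?subr_ge0// ltW.
    rewrite /d -(natr1 p.+1) -(natr1 p).
    by field; rewrite !gt_eqF//; lra.
  have XX : X p.+1 <= 16 * X p.
    rewrite /X exprS -!mulrA ler_wpM2l// ler_wpM2l ?exprn_ge0//.
    rewrite lef_pV2 ?posrE ?exprn_gt0 ?ltr0n//.
    by rewrite lerXn2r ?nnegrE// ler_nat.
  (* The 2 pays for d_p <= e^2 d_(p+1). The rest is at most 16 K X_p, and 16^p d_p / 2 is at least T
     J X_p / 8: the same order X_p, with J as a free factor. *)
  have h : 2 + K * X p.+1 <= K * X p + A * 16 ^+ p * (d p / 2).
    have dX : T * J%:R / 8 * X p <= 16 ^+ p * (d p / 2).
      have -> : 16 ^+ p * (d p / 2) = T * J%:R / 4 * (16 ^+ p / (p%:R * p.+1%:R)).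
        by rewrite /d -natr1; field; rewrite !gt_eqF//; lra.
      have -> : T * J%:R / 8 * X p = T * J%:R / 4 * (16 ^+ p / (p%:R * (2 * p%:R))).
        by rewrite /X; field; rewrite !gt_eqF//; lra.
      rewrite ler_wpM2l ?divr_ge0 ?mulr_ge0 ?(ltW T0)//.
      rewrite ler_wpM2l ?exprn_ge0// lef_pV2 ?posrE ?mulr_gt0 ?ltr0n//.
      by rewrite ler_wpM2l// -natr1; lra.
    have h1 : K * X p.+1 <= K * (16 * X p) by rewrite ler_wpM2l// ltW.
    have h2 : A * (T * J%:R / 8 * X p) <= A * (16 ^+ p * (d p / 2)).
      by rewrite ler_wpM2l// ltW.
    have h3 : (2 + 16 * K) * X p <= A * T * J%:R / 8 * X p.
      by rewrite ler_wpM2r//; lra.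
    have h4 : 0 <= K * X p by rewrite mulr_ge0; lra.
    rewrite -(mulrA A); lra.
  rewrite /w /eps /E -!expRN.
  apply: (@le_trans _ _ (expR 2 * d p.+1 / 2 * expR (- (K * X p)) * expR (- (A * 16 ^+ p * (d p / 2))))).
    by rewrite !ler_wpM2r ?expR_ge0// invr_ge0.
  rewrite (_ : expR 2 * d p.+1 / 2 * expR (- (K * X p)) * expR (- (A * 16 ^+ p * (d p / 2))) =
     d p.+1 / 2 * (expR 2 * expR (- (K * X p)) * expR (- (A * 16 ^+ p * (d p / 2))))); last by ring.
  apply: ler_wpM2l; first by apply: divr_ge0 => //; exact/ltW/d0.
  by rewrite -!expRD ler_expR; lra.
exists (w J)^-1; first by rewrite invr_gt0 w0.
move=> g S g0 gm S0 H.
have key p s : (J <= p)%N -> t p - d p / 2 < s < t p ->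
    (((g (t p) - eps p * g (t p.+1)) / E p)%:E <= S s)%E.
  move=> Jp /andP[s1 s2]; have p0 : (0 < p)%N by exact: leq_trans Jp.
  have := dE p p0; have := d0 p p0; have := tT2 p.+1 => h1 h2 h3.
  have s0 : 0 < s by lra.
  have g1 : g (t p) <= g s by apply: gm => //; exact: ltW.
  have sd : d p / 2 < s by lra.
  have [h|h] := H p s (d p / 2) p0 (step1 p Jp) sd.
    apply: (@le_trans _ _ 0%E); last exact: S0.
    rewrite lee_fin pmulr_lle0 ?invr_gt0// subr_le0 (le_trans g1)// (le_trans h)//.
    by rewrite ler_wpM2l ?expR_ge0// gm//; lra.
  rewrite mulrC EFinM lee_pdivrMl//; apply: le_trans h.
  rewrite lee_fin; apply: le_trans g1.
  by rewrite gerBl mulr_ge0 ?expR_ge0.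
(* S may fail to be measurable, so its integral is not split over the intervals. A measurable step
   function below S is built instead; its vanishing before the last time reached keeps the next
   interval disjoint from its support. *)
have phiP n : exists phi : R -> R, [/\ measurable_fun setT phi, (forall s, 0 <= phi s),
    (forall s, 0 < s -> ((phi s)%:E <= S s)%E), (forall s, s < t (J + n)%N -> phi s = 0) &
    ((w J * g T - w (J + n)%N * g (t (J + n)%N))%:E <= \int[mu]_(s in `]0%R, T[) (phi s)%:E)%E].
  elim: n => [|n [phi [m1 m2 m3 m4 m5]]].
    exists (cst 0); split => //.
    by rewrite addn0 tJ subrr integral0.
  set p := (J + n)%N in m4 m5; have Jp : (J <= p)%N by exact: leq_addr.
  have p0 : (0 < p)%N by exact: leq_trans Jp.
  pose a := Num.max 0 ((g (t p) - eps p * g (t p.+1)) / E p).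
  have a0 : 0 <= a by rewrite le_max lexx.
  pose I : set R := `]t p - d p / 2, t p[%classic.
  have mI : measurable I by exact: measurable_itv.
  have [dp dp0 t2 tp] : [/\ t p - t p.+1 = d p, 0 < d p, T / 2 <= t p.+1 & t p <= T].
    by split; [exact: dE|exact: d0|exact: tT2|exact: tT].
  have IT : I `<=` `]0, T[.
    by move=> s; rewrite /I /= !in_itv/= => /andP[s1 s2]; apply/andP; split; lra.
  have ma : measurable_fun setT (fun s => a * \1_I s).
    by apply: measurable_funM => //; exact: measurable_indic.
  exists (fun s => phi s + a * \1_I s); rewrite addnS -/p; split.
  - exact: measurable_funD.
  - by move=> s; rewrite addr_ge0// mulr_ge0.
  - move=> s s0; rewrite indicE; case: (boolP (s \in I)) => [|_]; last first.
      by rewrite mulr0 addr0 m3.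
    rewrite inE /I/= in_itv/= => sI; have /andP[s1 s2] := sI.
    rewrite m4// add0r mulr1 /a /Num.max; case: ifP => _; last exact: S0.
    exact: key.
  - move=> s sp; rewrite m4 ?add0r; last by lra.
    rewrite indicE; case: (boolP (s \in I)) => [|_]; last by rewrite mulr0.
    by rewrite inE /I/= in_itv/= => /andP[s1 s2]; lra.
  - under eq_integral do rewrite EFinD.
    rewrite ge0_integralD//; last 4 first.
    + by move=> s _; rewrite lee_fin.
    + by apply/measurable_EFinP; exact: measurable_funTS.
    + by move=> s _; rewrite lee_fin mulr_ge0.
    + by apply/measurable_EFinP; exact: measurable_funTS.
    have -> : (\int[mu]_(s in `]0%R, T[) (a * \1_I s)%:E)%E = (a * (d p / 2))%:E.
      under eq_integral do rewrite EFinM.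
      have mI1 : measurable_fun (`]0, T[%classic : set R) (fun s : R => (\1_I s : R)%:E).
        by apply/measurable_EFinP; apply: measurable_funTS; exact: measurable_indic.
      rewrite ge0_integralZl_EFin//.
      have muI : mu I = (d p / 2)%:E.
        rewrite lebesgue_measure_itv/= lte_fin ifT; last by lra.
        by rewrite -EFinD; congr EFin; ring.
      by rewrite integral_indic// setIidl// [X in (_ * X)%E]muI -EFinM.
    apply: le_trans (leeD m5 (lexx _)); rewrite -EFinD lee_fin.
    have wa : w p * g (t p) - w p * eps p * g (t p.+1) <= a * (d p / 2).
      rewrite (_ : _ - _ = (g (t p) - eps p * g (t p.+1)) / E p * (d p / 2)); last first.
        by rewrite /w; field; rewrite gt_eqF.
      by rewrite ler_wpM2r ?le_max ?lexx ?orbT// divr_ge0// ltW.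
    have := ler_wpM2r (g0 (t p.+1)) (step2 p Jp); lra.
have low n : ((w J * g T - w (J + n)%N * g (t (J + n)%N))%:E <=
    \int[mu]_(s in `]0%R, T[) S s)%E.
  have [phi [m1 m2 m3 m4 m5]] := phiP n.
  apply: (le_trans m5); apply: ge0_integral_mono => s.
    by move=> _; rewrite lee_fin.
  by rewrite /= in_itv/= => /andP[s0 _]; exact: m3.
have I0 : (0 <= \int[mu]_(s in `]0%R, T[) S s)%E.
  by apply: integral_ge0 => s; rewrite /= in_itv/= => /andP[s0 _]; exact: S0.
rewrite -lee_pdivrMl ?invr_gt0 ?w0// invrK -EFinM.
case: (\int[mu]_(s in _) _)%E I0 low => [r| |]; [|by move=> _ _; rewrite leey|by []].
(* The remainder w_p g(t_p) tends to 0, because w_p <= T J / p and g(t_p) <= g(T / 2). *)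
move=> _ low; rewrite lee_fin; apply/ler_addgt0Pr => e e0.
have gT0 := g0 (T / 2).
pose m := T * J%:R * g (T / 2) / e.
have m0 : 0 <= m by rewrite divr_ge0 ?mulr_ge0 ?(ltW T0) ?(ltW e0).
have bm := archi_boundP m0; set n := Num.bound m in bm.
have := low n.+1; rewrite lee_fin; set p := (J + n.+1)%N.
have p0 : (0 < p)%N by rewrite /p addnS.
have pr : 0 < p%:R :> R by rewrite ltr0n.
have hg : g (t p) <= g (T / 2) by apply: gm => //; lra.
have hw : w p <= T * J%:R / p%:R.
  apply: (@le_trans _ _ (d p / 2)).
    have E1 : 1 <= E p.
      rewrite -[leLHS]expR0 ler_expR mulr_ge0 ?(ltW K0)//.
      by rewrite (le_trans _ (pow16_ge p0)).
    rewrite ler_pdivrMr// ler_peMr//.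
    by apply: divr_ge0 => //; exact/ltW/d0.
  have -> : d p / 2 = T * J%:R / p%:R * (4 * p.+1%:R)^-1.
    by rewrite /d -natr1; field; rewrite !gt_eqF//; lra.
  rewrite ler_piMr ?divr_ge0 ?mulr_ge0 ?(ltW T0)// invf_le1 ?mulr_gt0//.
  by rewrite -natr1; lra.
have we : w p * g (t p) <= e.
  apply: (@le_trans _ _ (T * J%:R / p%:R * g (T / 2))).
    by apply: ler_pM => //; exact/ltW/w0.
  rewrite mulrAC ler_pdivrMr// [leRHS]mulrC -ler_pdivrMr//.
  have np : (n <= p)%N by exact: leq_trans (leqnSn n) (leq_addl _ _).
  by apply: le_trans (ltW bm) _; rewrite ler_nat.
by lra.
Qed.

End Telescoping.

(** * Observability *)

Section Observability.
Variable R : realType.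
Local Notation mu := (@lebesgue_measure R).

Lemma thick_nodes (alpha : R) h (gamma L : R) E :
  3 / 2 < alpha -> h_gauge alpha h -> 0 < gamma -> 0 < L ->
  thick h gamma L E ->
  exists2 K : R, 0 < K & forall p, (0 < p)%N ->
    exists x : int -> 'I_(4 ^ p) -> R,
      (forall k i, (E `&` `[k%:~R, k%:~R + L]) (x k i)) /\
      forall k i, expR (- (K * 16 ^+ p / p%:R ^+ 2)) / 2 <= vdm_node (x k) i.
Proof.
move=> a32 hh g0 L0 thE.
have [K K0 HK] := thick_far_point a32 hh g0 L0 thE.
exists K => // p p0.
have xP (k : int) : exists x : 'I_(4 ^ p) -> R,
    (forall i, (E `&` `[k%:~R, k%:~R + L]) (x i)) /\
    forall i, expR (- (K * 16 ^+ p / p%:R ^+ 2)) / 2 <= vdm_node x i.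
  apply: (fekete (a := k%:~R) (D := L)); first exact: expR_gt0.
    exact: subIsetr.
  by move=> s ss; exact: HK.
exists (fun k => projT1 (cid (xP k))); split=> k; by case: cid => x [].
Qed.

Lemma esum_sym_le (a : int -> R) (m : nat) : (forall k, 0 <= a k) ->
  ((\sum_(i < m + m) a (i%:Z - m%:Z))%:E <= \esum_(k in [set: int]) (a k)%:E)%E.
Proof.
move=> a0; pose r := [seq i%:Z - m%:Z | i <- iota 0 (m + m)].
apply: esum_ge; exists [set` r].
  by split => //; exact: finite_seq.
rewrite -fsbig_seq; last first.
  by rewrite map_inj_uniq ?iota_uniq// => i j /addIr[].
rewrite big_map sumEFin lee_fin.
by rewrite -(big_mkord xpredT (fun i => a (i%:Z - m%:Z))) /index_iota subn0.
Qed.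

Lemma l2norm_finite (a : int -> \bar R) : (forall k, (0 <= a k)%E) ->
  l2norm a = +oo%E \/ exists s : int -> R, exists M : R,
    [/\ forall k, a k = (s k)%:E,
        forall m : nat, \sum_(i < m + m) s (i%:Z - m%:Z) ^+ 2 <= M,
        0 <= M & l2norm a = (Num.sqrt M)%:E].
Proof.
move=> a0; rewrite /l2norm; set S := (\esum_(_ in _) _)%E.
have S0 : (0 <= S)%E by apply: esum_ge0 => k _; exact: poweR_ge0.
have [->|Sfin] := eqVneq S +oo%E; first by left; rewrite poweRyr// invr_eq0 pnatr_eq0.
right; have Sf : S \is a fin_num by rewrite ge0_fin_numE// ltey.
have ak k : a k \is a fin_num.
  rewrite ge0_fin_numE// ltey; apply: contra Sfin => /eqP ak; apply/eqP/eqyP => A A0.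
  suff -> : S = +oo%E by rewrite leey.
  apply/eqP; rewrite -leye_eq; apply: esum_ge; exists [set k].
    by split => //; exact: finite_set1.
  by rewrite fsbig_set1 ak gee0_abs// poweRyr ?pnatr_eq0.
exists (fine \o a), (fine S).
have aE k : a k = (fine (a k))%:E by rewrite fineK.
have SE : S = (\esum_(k in [set: int]) ((fine (a k)) ^+ 2)%:E)%E.
  apply: eq_esum => k _; rewrite [in LHS]aE gee0_abs -?aE//.
  by rewrite [in LHS]aE poweR_EFin -powR_mulrn ?fine_ge0.
split => //.
- by move=> m; rewrite -lee_fin fineK// SE; apply: esum_sym_le => k; exact: sqr_ge0.
- exact: fine_ge0.
- by rewrite -[in LHS](fineK Sf) poweR_EFin powR12_sqrt// fine_ge0.
Qed.

(** The observation is an abstract majorant [a] of |v| on the windows, so that the suprema of |u|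
    can serve for the real and for the imaginary part. *)
Lemma flow_observability (alpha : R) h (gamma L : R) E (T : R) :
  3 / 2 < alpha -> h_gauge alpha h -> 0 < gamma -> 0 < L ->
  thick h gamma L E -> 0 < T ->
  exists2 C : R, 0 < C & forall (v : R -> R -> R) (a : R -> int -> \bar R),
    heat_flow v ->
    (forall t k y, (E `&` `[k%:~R, k%:~R + L]) y -> ((`|v t y|)%:E <= a t k)%E) ->
    ((Num.sqrt (sqn (v T)))%:E <= C%:E * \int[mu]_(t in `]0%R, T[) l2norm (a t))%E.
Proof.
move=> a32 hh g0 L0 thE T0.
have [K K0 HK] := thick_nodes a32 hh g0 L0 thE.
(* A window of length D from k contains both the unit cell where v is estimated and the interval of
   length L that holds the nodes. *)
pose D := 1 + L.
have D1 : 1 <= D by rewrite lerDl ltW.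
have D0 : 0 < D by exact: lt_le_trans D1.
(* Half of the rate in [flow_dichotomy], which is stated for squared norms whereas the telescoping
   concerns norms. *)
pose A := (D ^+ 2 * expR 10)^-1 / 2.
have De0 : 0 < D ^+ 2 * expR 10 by rewrite mulr_gt0 ?expR_gt0// exprn_gt0.
have A0 : 0 < A by rewrite divr_gt0// invr_gt0.
pose c := D ^+ 2 * expR 10 / 2.
have c0 : 0 < c by rewrite divr_gt0.
(* The observation cost is 4 n D^n exp(K X) with n = 4^p; D and 4 account for D^n <= exp(D n) and 4
   n <= exp(4 n), as n <= X = 16^p / p^2. *)
have K'0 : 0 < K + D + 4 by rewrite !addr_gt0.
have [C C0 HC] := telescoping T0 A0 K'0 c0.
exists C => // v a hv va.
have [L2v cv] := hv.
apply: (HC (fun t => Num.sqrt (sqn (v t)))).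
- by move=> t; exact: sqrtr_ge0.
- by move=> s t s0 st; rewrite ler_wsqrtr// sqn_mono.
- by move=> t _; exact: poweR_ge0.
move=> p t tau p0 ctau taut.
have n4 : (4 <= 4 ^ p)%N by rewrite -[X in (X <= _)%N]expn1 leq_exp2l.
have nr : (4 ^ p)%:R = 4 ^+ p :> R by rewrite natrX.
have [qle|qgt] := leP (sqn (v t)) (expR (- (2 * (A * 16 ^+ p * tau))) * sqn (v (t - tau))).
  left; rewrite (_ : expR _ * _ = Num.sqrt (expR (- (A * 16 ^+ p * tau)) ^+ 2 * sqn (v (t - tau)))).
    rewrite ler_wsqrtr// -expRM_natr.
    by rewrite (_ : _ * 2%:R = - (2 * (A * 16 ^+ p * tau))); last by ring.
  by rewrite sqrtrM ?sqr_ge0// sqrtr_sqr gtr0_norm// expR_gt0.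
right.
have [x [xE xv]] := HK p p0.
have at0 k : (0 <= a t k)%E.
  have i : 'I_(4 ^ p) by exists 0%N; rewrite expn_gt0.
  by apply: le_trans (va t k _ (xE k i)); rewrite lee_fin.
have [->|[s [M [aE sM M0 ->]]]] := l2norm_finite at0.
  by rewrite gt0_muley ?leey// lte_fin expR_gt0.
rewrite -EFinM lee_fin.
set e := expR (- (K * 16 ^+ p / p%:R ^+ 2)) / 2 in xv.
have e0 : 0 < e by rewrite divr_gt0 ?expR_gt0.
have xD k i : k%:~R <= x k i <= k%:~R + D.
  have [_] := xE k i; rewrite /= in_itv/= => /andP[-> /le_trans]; apply.
  by rewrite lerD2l /D lerDr.
have xs k i : `|v t (x k i)| <= s k by rewrite -lee_fin -aE; exact: va.
have btau : D ^+ 2 * expR 10 / 2 / (4 ^ p)%:R <= tau by rewrite nr.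
have p16 : 16 ^+ p = 4 ^+ p ^+ 2 :> R.
  by rewrite -exprM mulnC exprM; congr (_ ^+ _); ring.
have qtau : sqn (v (t - tau)) <=
    expR ((4 ^ p)%:R ^+ 2 / (D ^+ 2 * expR 10) * tau) * sqn (v t).
  rewrite nr -p16 (_ : _ * tau = 2 * (A * 16 ^+ p * tau)); last first.
    by rewrite /A; field; rewrite !gt_eqF// expR_gt0.
  by move: qgt; rewrite expRN mulrC ltr_pdivrMr ?expR_gt0// mulrC => /ltW.
have := flow_dichotomy hv n4 D1 e0 xD xv xs sM btau taut qtau.
move=> /ler_wsqrtr; rewrite sqrtrM; last by rewrite mulr_ge0 ?sqr_ge0.
move=> /le_trans; apply; rewrite ler_wpM2r ?sqrtr_ge0//.
rewrite (_ : 4 * (_ * _) ^+ 2 = (2 * ((4 ^ p)%:R * (D ^+ (4 ^ p) / e))) ^+ 2); last by ring.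
rewrite sqrtr_sqr ger0_norm; last first.
  by rewrite !mulr_ge0// ?invr_ge0 ?exprn_ge0// ltW.
have X1 := pow16_ge R p0; set X := 16 ^+ p / p%:R ^+ 2 in X1 *.
have nX : 4 ^+ p <= X.
  rewrite /X p16 -mulrA ler_peMr ?exprn_ge0// ler_pdivlMr ?exprn_gt0 ?ltr0n// mul1r.
  rewrite -natrX -natrX ler_nat (_ : 4 ^ p = (2 ^ p) ^ 2)%N; last by rewrite -expnM mulnC expnM.
  by rewrite leq_sqr ltnW// ltn_expl.
have -> : 2 * ((4 ^ p)%:R * (D ^+ (4 ^ p) / e)) =
    4 * 4 ^+ p * D ^+ (4 ^ p) * expR (K * X).
  rewrite /e nr -mulrA -/X expRN.
  by field; rewrite gt_eqF// expR_gt0.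
apply: (@le_trans _ _ (expR (4 * 4 ^+ p) * expR (D * 4 ^+ p) * expR (K * X))).
  rewrite ler_wpM2r ?expR_ge0//; apply: ler_pM.
  - by rewrite mulr_ge0 ?exprn_ge0.
  - by rewrite exprn_ge0// ltW.
  - by have := expR_ge1Dx (4 * 4 ^+ p : R); lra.
  - rewrite -nr expRM_natr lerXn2r ?nnegrE ?expR_ge0 ?(ltW D0)//.
    by have := expR_ge1Dx D; lra.
rewrite -!expRD ler_expR.
have h1 : D * 4 ^+ p <= D * X by rewrite ler_wpM2l// ltW.
by lra.
Qed.

End Observability.

(** * From complex solutions to real heat flows *)

Section Solutions.
Variable R : realType.
Local Notation mu := (@lebesgue_measure R).
Implicit Types f : R -> R[i].

Lemma normc_sqr (z : R[i]) :
  Normc.normc z ^+ 2 = complex.Re z ^+ 2 + complex.Im z ^+ 2.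
Proof. by case: z => a b /=; rewrite sqr_sqrtr// addr_ge0 ?sqr_ge0. Qed.

Definition sqn2 f : \bar R :=
  (\int[mu]_x (complex.Re (f x) ^+ 2 + complex.Im (f x) ^+ 2)%:E)%E.

Lemma L2normE f : L2norm f = (sqn2 f `^ 2^-1)%E.
Proof.
rewrite /L2norm unlock /sqn2; congr poweR; apply: eq_integral => x _.
rewrite gee0_abs ?lee_fin ?normc_ge0//; last by case: (f x) => a b; exact: sqrtr_ge0.
rewrite poweR_EFin powR_mulrn ?normc_sqr//.
by case: (f x) => a b; exact: sqrtr_ge0.
Qed.

Lemma sqn2_ge0 f : (0 <= sqn2 f)%E.
Proof. by apply: integral_ge0 => x _; rewrite lee_fin addr_ge0 ?sqr_ge0. Qed.

Lemma in_L2_parts f : in_L2 f ->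
  L2 (fun x => complex.Re (f x)) /\ L2 (fun x => complex.Im (f x)).
Proof.
move=> [mr mi]; rewrite L2normE => /lty_poweRy; rewrite invr_eq0 pnatr_eq0 => /(_ isT) fin.
have mr2 := measurable_funX 2 mr; have mi2 := measurable_funX 2 mi.
have I : mu.-integrable setT (EFin \o (fun x => complex.Re (f x) ^+ 2 + complex.Im (f x) ^+ 2)).
  apply/integrableP; split; first by apply/measurable_EFinP; exact: measurable_funD.
  under eq_integral do rewrite gee0_abs ?lee_fin ?addr_ge0 ?sqr_ge0//.
  exact: fin.
split; split => //; apply: integrable_dominated I _ => // x;
  by rewrite ger0_norm ?sqr_ge0// ?lerDl ?lerDr sqr_ge0.
Qed.

Lemma sqn2_parts f : in_L2 f ->
  sqn2 f = (sqn (fun x => complex.Re (f x)) + sqn (fun x => complex.Im (f x)))%:E.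
Proof.
move=> /in_L2_parts[Lr Li]; have [mr Ir] := Lr; have [mi Ii] := Li.
rewrite EFinD -!sqnE// /sqn2.
under eq_integral do rewrite EFinD.
by rewrite ge0_integralD//; [move=> x _; rewrite lee_fin sqr_ge0|
  exact: measurable_int Ir|move=> x _; rewrite lee_fin sqr_ge0|exact: measurable_int Ii].
Qed.

Lemma L2norm_le_parts f : in_L2 f ->
  (L2norm f <= (Num.sqrt (sqn (fun x => complex.Re (f x))) +
                Num.sqrt (sqn (fun x => complex.Im (f x))))%:E)%E.
Proof.
move=> Lf; rewrite L2normE sqn2_parts// poweR_EFin lee_fin.
set a := sqn _; set b := sqn _.
have a0 : 0 <= a by exact: sqn_ge0.
have b0 : 0 <= b by exact: sqn_ge0.
rewrite powR12_sqrt ?addr_ge0//.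
rewrite -[leRHS]ger0_norm ?addr_ge0 ?sqrtr_ge0// -sqrtr_sqr ler_wsqrtr//.
rewrite sqrrD !sqr_sqrtr// -addrA lerD2l lerDr mulrn_wge0// mulr_ge0 ?sqrtr_ge0//.
Qed.

(* pt stands for the real or the imaginary part. *)
Lemma sqn_near (pt : R[i] -> R) f g :
  (forall z w, pt (z - w) = pt z - pt w) ->
  (forall z, pt z ^+ 2 <= complex.Re z ^+ 2 + complex.Im z ^+ 2) ->
  L2 (fun x => pt (f x)) -> L2 (fun x => pt (g x)) ->
  measurable_fun setT (fun x => complex.Re (f x - g x)) ->
  measurable_fun setT (fun x => complex.Im (f x - g x)) ->
  (L2norm (fun x => f x - g x)%R < 1)%E ->
  sqn (fun x => pt (f x)) <= 2 + 2 * sqn (fun x => pt (g x)).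
Proof.
move=> ptB pt2 Lf Lg mr mi N1.
have [mf If] := Lf; have [mg Ig] := Lg.
have S1 : (sqn2 (fun x => f x - g x)%R <= 1)%E.
  rewrite leNgt; apply/negP => S1; move: N1; rewrite L2normE; apply/negP; rewrite -leNgt.
  have := @gt0_ler_poweR R 2^-1 _ 1%E (sqn2 (fun x => f x - g x)) _ _ (ltW S1).
  rewrite poweR_EFin powR1; apply; first by rewrite invr_ge0.
  - by rewrite in_itv/= lee_fin ler01 leey.
  - by rewrite in_itv/= sqn2_ge0 leey.
have Ih : mu.-integrable setT (EFin \o (fun x => complex.Re (f x - g x) ^+ 2 + complex.Im (f x - g x) ^+ 2)).
  apply/integrableP; split.
    by apply/measurable_EFinP; apply: measurable_funD; exact: measurable_funX.
  under eq_integral do rewrite gee0_abs ?lee_fin ?addr_ge0 ?sqr_ge0//.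
  by apply: le_lt_trans S1 _; rewrite ltry.
pose hh := (fun x => complex.Re (f x - g x) ^+ 2 + complex.Im (f x - g x) ^+ 2).
have Sh : \int[mu]_x hh x <= 1.
  by rewrite -lee_fin /Rintegral fineK ?(le_trans _ S1)//; exact: integrable_fin_num.
have I1 : mu.-integrable setT (EFin \o (fun x => 2 * hh x)).
  exact: (@integrableZl _ _ _ _ _ _ 2 _ Ih).
have I2 : mu.-integrable setT (EFin \o (fun x => 2 * pt (g x) ^+ 2)).
  exact: (@integrableZl _ _ _ _ _ _ 2 _ Ig).
have I3 : mu.-integrable setT (EFin \o (fun x => 2 * hh x + 2 * pt (g x) ^+ 2)).
  exact: (@integrableD _ _ _ _ _ _ _ _ I1 I2).
apply: (@le_trans _ _ (\int[mu]_x (2 * hh x + 2 * pt (g x) ^+ 2))).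
  apply: (@le_Rintegral _ _ _ mu _ _ _ _ If I3); first by [].
  move=> x _; have := pt2 (f x - g x); rewrite ptB -/(hh x) => h.
  apply: (@le_trans _ _ (2 * (pt (f x) - pt (g x)) ^+ 2 + 2 * pt (g x) ^+ 2)); last by lra.
  move: (pt (f x)) (pt (g x)) => a b.
  rewrite -subr_ge0 (_ : _ - _ = (a - 2 * b) ^+ 2); first exact: sqr_ge0.
  by ring.
rewrite (RintegralD measurableT I1 I2) (RintegralZl 2 measurableT Ih).
rewrite (RintegralZl 2 measurableT Ig) -/(sqn (fun x => pt (g x))).
by rewrite lerD2r; lra.
Qed.

Lemma locally_bounded_segment (q : R -> R) a b :
  (forall s, a <= s <= b -> exists M, \forall t \near s, q t <= M) ->
  exists M, forall t, a <= t <= b -> q t <= M.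
Proof.
move=> lq; have /compact_near_coveringP cov := @segment_compact R a b.
have H := cov _ (+oo : set_system R) (fun M t => q t <= M) _ _.
have /filter_ex[M HM] : \forall M \near +oo, `[a, b]%classic `<=` (fun t => q t <= M).
  apply: H => s; rewrite /= in_itv/= => /lq[M0 HM].
  exists ([set t | q t <= M0], [set M | M0 <= M]) => /=.
    by split => //=; apply: nbhs_pinfty_ge; rewrite num_real.
  by move=> [t M] [/= h1 h2]; exact: le_trans h2.
by exists M => t tab; apply: HM; rewrite /= in_itv.
Qed.

(** Continuity in time with values in L2 gives local, then by compactness uniform, bounds on the
    norm over the interval from t to t + tau, as the representation formula requires. *)
Lemma heat_flow_part (pt : R[i] -> R) (u : R -> R -> R[i]) :
  (forall z w, pt (z - w) = pt z - pt w) ->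
  (forall z, pt z ^+ 2 <= complex.Re z ^+ 2 + complex.Im z ^+ 2) ->
  heat_solution u ->
  (forall t, 0 <= t -> L2 (fun x => pt (u t x))) ->
  classical_heat (fun t x => pt (u t x)) ->
  heat_flow (fun t x => pt (u t x)).
Proof.
move=> ptB pt2 [_ _ uL2 ucont] Lpt ch; split; first by move=> t t0; apply: Lpt; exact: ltW.
move=> t tau x t0 tau0; have hd := classical_heat_data ch.
have [s|M HM] := @locally_bounded_segment (fun s => sqn (fun x => pt (u s x))) t (t + tau).
  move=> /andP[ts _]; have s0 : 0 < s by exact: lt_le_trans ts.
  have s0' := ltW s0.
  exists (2 + 2 * sqn (fun x => pt (u s x))).
  have nb : nbhs (0 : \bar R)%E [set y | (y < 1)%E].
    by apply: open_nbhs_nbhs; split; [exact: open_ereal_lt_ereal|rewrite /= lte01].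
  have H : \forall r \near within `[0, +oo[%classic (nbhs s),
      (L2norm (fun x => u r x - u s x)%R < 1)%E by exact: (ucont s s0' _ nb).
  rewrite near_withinE in H.
  have pos : \forall r \near s, 0 < r by exact: lt_nbhsr.
  near=> r; have r0 : 0 < r by near: r.
  have [mr mi _] := uL2 r (ltW r0); have [mr' mi' _] := uL2 s s0'.
  apply: sqn_near => //; [exact/Lpt/ltW|exact: Lpt| | |].
  - by under eq_fun do rewrite raddfB; exact: measurable_funB.
  - by under eq_fun do rewrite raddfB; exact: measurable_funB.
  - near: r; apply: filterS2 pos H => r r0 /(_ _); apply.
    by rewrite /= in_itv/= ltW.
apply: (@heat_repr _ _ _ _ t tau x M hd) => // s /andP[s0 stau]; split.
  by apply: Lpt; rewrite addr_ge0// ltW.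
by apply: HM; rewrite lerDl s0 lerD2l.
Unshelve. all: by end_near.
Qed.

End Solutions.

Unset Implicit Arguments.

Theorem theorem2p5 (R : realType) (alpha : R) (halpha : 3 / 2 < alpha)
  (h : R -> R) (hh : h_gauge alpha h)
  (gamma L : R) (hgamma : 0 < gamma) (hL : 0 < L)
  (E : set R) (hE : thick h gamma L E) (T : R) (hT : 0 < T) :
  exists2 Cobs : R, 0 < Cobs &
    forall u : R -> R -> R[i], heat_solution u ->
      (L2norm (u T) <=
         Cobs%:E * \int[@lebesgue_measure R]_(t in `]0%R, T[)
                     l2norm (local_sup E L (u t)))%E.
Proof.
have [C C0 HC] := flow_observability halpha hh hgamma hL hE hT.
(* One C for each of the real and imaginary parts, both observed through the modulus of u. *)
exists (C + C); first exact: addr_gt0.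
move=> u hu; have [ch1 ch2 uL2 _] := hu.
have bnd (pt : R[i] -> R) t (k : int) y :
    (forall z, pt z ^+ 2 <= complex.Re z ^+ 2 + complex.Im z ^+ 2) ->
    (E `&` `[k%:~R, k%:~R + L]) y ->
    ((`|pt (u t y)|)%:E <= local_sup E L (u t) k)%E.
  move=> pt2 yE; apply: le_trans (_ : _ <= (Normc.normc (u t y))%:E)%E _.
    rewrite lee_fin; have := pt2 (u t y); case: (u t y) => a b /= ab.
    by rewrite -sqrtr_sqr ler_wsqrtr.
  by apply: ereal_sup_ubound; exists y.
have Re2 (z : R[i]) : complex.Re z ^+ 2 <= complex.Re z ^+ 2 + complex.Im z ^+ 2.
  by rewrite lerDl sqr_ge0.
have Im2 (z : R[i]) : complex.Im z ^+ 2 <= complex.Re z ^+ 2 + complex.Im z ^+ 2.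
  by rewrite lerDr sqr_ge0.
have f1 := @heat_flow_part R _ u (raddfB _) Re2 hu
  (fun t t0 => (in_L2_parts (uL2 t t0)).1) ch1.
have f2 := @heat_flow_part R _ u (raddfB _) Im2 hu
  (fun t t0 => (in_L2_parts (uL2 t t0)).2) ch2.
have o1 := HC _ (fun t => local_sup E L (u t)) f1 (fun t k y => bnd _ t k y Re2).
have o2 := HC _ (fun t => local_sup E L (u t)) f2 (fun t k y => bnd _ t k y Im2).
apply: le_trans (L2norm_le_parts (uL2 T (ltW hT))) _.
rewrite !EFinD ge0_muleDl ?lee_fin ?(ltW C0)//.
exact: leeD o1 o2.
Qed.
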